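(* Let $n \geq 1$ and let $K \subset \mathbb{R}^n$ be compact and nonempty. Then the following hold. (a) (Monotonicity) $p \mapsto \operatorname{Cap}_p(K)$ is a decreasing (i.e. non-increasing) function of $p \in \mathbb{R}$, and it is strictly decreasing on the interval $\{p \in \mathbb{R} : \operatorname{Cap}_p(K) > 0\}$ where it is positive. (b) (Diameter: $p \to -\infty$) For every $p<0$, one has $2^{1/p} \operatorname{diam}(K) \leq \operatorname{Cap}_p(K) \leq \operatorname{diam}(K)$. Hence $$\lim_{p \to -\infty} \operatorname{Cap}_p(K) = \operatorname{diam}(K).$$ In fact, when $n=1$ one has $\operatorname{Cap}_p(K) = 2^{1/p} \operatorname{diam}(K)$ for all $p \leq -1$. (c) (Volume: $p \to n$) As $p \nearrow n$, $\operatorname{Cap}_p(K) \sim \left( \frac{m_n(K)}{|\mathbb{S}^{n-1}|} (n-p) \right)^{1/p}$, in the sense that $$\lim_{p \nearrow n} \frac{\operatorname{Cap}_p(K)}{(n-p)^{1/p}} = \left( \frac{m_n(K)}{|\mathbb{S}^{n-1}|} \right)^{1/n}.$$ (d) $\operatorname{Cap}_p(K)=0$ for all $p \geq n$.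
   Context: Let $K \subset \mathbb{R}^n$ be compact. A probability measure on $K$ means a positive unit Borel measure on $K$. Logarithmic energy: $V_{\log}(K) = \min_\mu \int_K \int_K \log \frac{1}{|x-y|} \, d\mu(x) \, d\mu(y)$, the minimum being over all probability measures $\mu$ on $K$ (value in $(-\infty,+\infty]$, with the kernel equal to $+\infty$ when $x=y$); $V_{\log}(\emptyset) = +\infty$. Riesz $p$-energy, for $p \in \mathbb{R}\setminus\{0\}$: $V_p(K) = \min_\mu \int_K \int_K |x-y|^{-p} \, d\mu(x) \, d\mu(y)$ if $p>0$ (value in $(0,+\infty]$, with the kernel equal to $+\infty$ when $x=y$), and $V_p(K) = \max_\mu \int_K \int_K |x-y|^{-p} \, d\mu(x) \, d\mu(y)$ if $p<0$, the minimum and maximum being over all probability measures $\mu$ on $K$. By convention $V_p(\emptyset) = +\infty$ for $p>0$ and $V_p(\emptyset)=0$ for $p<0$. Riesz $p$-capacity: $\operatorname{Cap}_p(K) = V_p(K)^{-1/p}$ for $p \neq 0$, and $\operatorname{Cap}_0(K) = \exp(-V_{\log}(K))$ (logarithmic capacity), with the conventions $(+\infty)^{-1/p} = 0$ for $p>0$ and $\exp(-\infty)=0$. $m_n$ denotes Lebesgue measure on $\mathbb{R}^n$; $|\mathbb{S}^{n-1}|$ is the $(n-1)$-dimensional surface measure of the unit sphere in $\mathbb{R}^n$ (so $|\mathbb{S}^0|=2$); $\operatorname{diam}(K) = \max_{x,y \in K} |x-y|$. *)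

(* Defs.v *)
From mathcomp Require Import all_boot all_order all_algebra.
From mathcomp Require Import all_classical all_reals all_analysis.

Set Implicit Arguments.
Unset Strict Implicit.
Unset Printing Implicit Defensive.

Import Order.TTheory GRing.Theory Num.Theory.
Import numFieldNormedType.Exports.

Local Open Scope classical_set_scope.
Local Open Scope ring_scope.

Section EuclideanSpace.
Context {R : realType} {n : nat}.

(* The library norm on 'rV[R]_n is the sup norm; it induces the same topology,
   hence the same compact sets and the same Borel sets. *)
Definition enorm (x : 'rV[R]_n) : R := Num.sqrt (\sum_(i < n) x 0 i ^+ 2).

Definition diam (K : set 'rV[R]_n) : R :=
  sup [set enorm (x - y) | x in K & y in K].

Definition box (a b : 'rV[R]_n) : set 'rV[R]_n :=
  [set x | forall i, a 0 i < x 0 i <= b 0 i].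

Definition box_volume (a b : 'rV[R]_n) : R :=
  \prod_(i < n) Num.max 0 (b 0 i - a 0 i).

(* Lebesgue outer measure, i.e. Lebesgue measure on (Lebesgue-measurable, in
   particular Borel) sets. *)
Definition lebesgue_rV (A : set 'rV[R]_n) : \bar R :=
  ereal_inf [set (\sum_(k <oo) (box_volume (ab k).1 (ab k).2)%:E)%E
            | ab in [set ab : nat -> 'rV[R]_n * 'rV[R]_n
                    | A `<=` \bigcup_k box (ab k).1 (ab k).2]].

Definition usphere : set 'rV[R]_n := [set u | enorm u = 1].

Definition cone (E : set 'rV[R]_n) : set 'rV[R]_n :=
  [set x | exists r u, [/\ 0 < r <= 1, (E `&` usphere) u & x = r *: u]].

(* Surface measure from polar coordinates, dx = r^(n-1) dr dsigma(u): the cone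
   over E inside the unit ball has volume sigma(E) * \int_0^1 r^(n-1) dr. *)
Definition surface_measure (E : set 'rV[R]_n) : \bar R :=
  (n%:R%:E * lebesgue_rV (cone E))%E.

Definition borel_rV := g_sigma_algebraType (@open 'rV[R]_n).

Definition prob_on (K : set 'rV[R]_n) : set (probability borel_rV R) :=
  [set mu | mu K = 1%E].

Definition energy (k : 'rV[R]_n -> 'rV[R]_n -> \bar R) (K : set 'rV[R]_n)
    (mu : probability borel_rV R) : \bar R :=
  (\int[mu]_(x in K) \int[mu]_(y in K) k x y)%E.

Definition log_kernel (x y : 'rV[R]_n) : \bar R :=
  if x == y then +oo%E else (ln (enorm (x - y))^-1)%:E.

(* The diagonal case is explicit because 0 `^ (- p) = 0 also when 0 < p. *)
Definition riesz_kernel (p : R) (x y : 'rV[R]_n) : \bar R :=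
  if (0 < p) && (x == y) then +oo%E else (enorm (x - y) `^ (- p))%:E.

(* Minima and maxima over probability measures are taken as infima and suprema
   in \bar R; the infimum over an empty family is +oo. *)
Definition log_energy (K : set 'rV[R]_n) : \bar R :=
  ereal_inf [set energy log_kernel K mu | mu in prob_on K].

Definition riesz_energy (p : R) (K : set 'rV[R]_n) : \bar R :=
  if 0 < p then ereal_inf [set energy (riesz_kernel p) K mu | mu in prob_on K]
  else if K == set0 then 0%E
  else ereal_sup [set energy (riesz_kernel p) K mu | mu in prob_on K].

(* The default branch implements (+oo)^(-1/p) = 0 for 0 < p; for p < 0 and K
   compact the energy is finite. *)
Definition riesz_capacity (p : R) (K : set 'rV[R]_n) : R :=
  if p == 0 then fine (expeR (- log_energy K))
  else match riesz_energy p K with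
       | v%:E => v `^ (- p^-1)
       | _ => 0
       end.

End EuclideanSpace.

Arguments usphere R n : clear implicits.
Arguments borel_rV R n : clear implicits.

(* Main.v *)
From HB Require Import structures.
Require Import Defs.
From mathcomp Require Import all_boot all_order all_algebra.
From mathcomp Require Import all_classical all_reals all_analysis.
From mathcomp Require Import measurable_realfun ring lra.

Set Implicit Arguments.
Unset Strict Implicit.
Unset Printing Implicit Defensive.

Import Order.TTheory GRing.Theory Num.Theory.
Import numFieldNormedType.Exports.

Local Open Scope classical_set_scope.
Local Open Scope ring_scope.

(** The capacity is compared with a radius r > 0 through the power loss
    L_p(w) = (w^(-p) - 1) / p, with L_0(w) = - ln w: whatever the sign of p,
    r < Cap_p(K) if and only if some probability on K gives the loss
    L_p(|x - y| / r) a negative mean (lt_capacity_loss). This turns the minimum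
    for p > 0, the logarithmic energy for p = 0 and the maximum for p < 0 into
    one and the same condition.

    Monotonicity: L_p(w) increases with p, because in the variable u = ln w the
    derivative of L_q - L_p is exp(-p u) - exp(-q u), which changes sign at
    u = 0 only. Hence a negative mean for q is one for every p < q. For
    strictness, L_q exceeds L_p by a fixed amount as soon as w <= 1/2, and by
    compactness two independent points of K are closer than Cap_q(K) / 4 with a
    probability bounded below uniformly in the measure (close_pairs).

    Diameter: no distance exceeds diam K, so no loss is negative at r = diam K;
    conversely the measure with mass 1/2 at both ends of a diameter gives the
    lower bound. On the line, for points u and v of [0, 1] and s >= 1,
    |u - v|^s <= u (1 - v) + (1 - u) v, and the mean of the right-hand side is
    2 m (1 - m) <= 1/2, where m is the mean of u.

    Volume: put N for the dimension and s = N - p. If balls of radius r have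
    measure at most, or at least, C r^N, then the integral of |x - y|^(-p) over
    a ball of radius D is at most, or at least, N C D^s / s
    (radial_integral_le, radial_integral_ge). For the uniform measure on K this
    bounds s V_p(K) from above, in the limit, by |S| / m(K), where |S| is the
    surface measure of the sphere and V_p the energy. For the lower bound let A be a
    neighbourhood of K and m the uniform measure on A. The radial integrals
    bound the mutual energy of m with any probability mu on K from below, and
    the energy of m from above, by quantities equivalent to |S| / (s m(A)); the
    Cauchy-Schwarz inequality E(mu, m)^2 <= E(mu, mu) E(m, m) then bounds
    E(mu, mu) from below by a quantity of the same size (mean_riesz_lower).
    Letting p tend to N and then A shrink to K gives the limit. Vanishing for
    p >= N follows, since Cap_N <= Cap_p for p < N and Cap_p tends to 0.

    The Cauchy-Schwarz inequality expresses that the Riesz kernel is positive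
    definite (riesz_mutual_le). On a bounded set inverse stereographic
    projection gives unit vectors whose scalar product w satisfies
    1 - w = c g(x) g(y) |x - y|^2; hence |x - y|^(-p) is, up to factors
    depending on x alone and on y alone, (1 - w)^(-p/2), whose binomial series
    in powers of the Gram kernel w has nonnegative coefficients.

    Lebesgue measure is given as an outer measure by covers with boxes. It is a
    measure on Borel sets by Caratheodory's criterion for half-spaces, gives
    boxes their volume (by induction on the dimension), and scales like r^N
    under homotheties, so that the measure of a
    ball is r^N times that of the unit ball. *)

(** * Lebesgue measure on Borel sets *)

Section LebesgueOuter.
Context {R : realType} {n : nat}.
Local Notation V := 'rV[R]_n.+1.
Implicit Types (a b : V) (A : set V).
Local Notation lam := (@lebesgue_rV R n.+1).

Lemma box_volume_ge0 a b : 0 <= box_volume a b.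
Proof. by apply: prodr_ge0 => i _; rewrite le_max lexx. Qed.

Lemma box_volume00 a : box_volume a a = 0.
Proof. by rewrite /box_volume big_ord_recl subrr maxxx mul0r. Qed.

Lemma lebesgue_rV_le_cover A (ab : nat -> V * V) :
  A `<=` \bigcup_k box (ab k).1 (ab k).2 ->
  (lam A <= \sum_(k <oo) (box_volume (ab k).1 (ab k).2)%:E)%E.
Proof. by move=> cov; apply: ereal_inf_lbound; exists ab. Qed.

Lemma lebesgue_rV_ge0 A : (0 <= lam A)%E.
Proof.
apply: le_ereal_inf_tmp => _ [ab _ <-]; apply: nneseries_ge0 => k _ _.
by rewrite lee_fin box_volume_ge0.
Qed.

Lemma lebesgue_rV_adherent A (e : R) : 0 < e -> (lam A < +oo)%E ->
  exists ab : nat -> V * V, A `<=` \bigcup_k box (ab k).1 (ab k).2 /\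
    (\sum_(k <oo) (box_volume (ab k).1 (ab k).2)%:E <= lam A + e%:E)%E.
Proof.
move=> e0 Aoo; have Afin : lam A \is a fin_num.
  by rewrite ge0_fin_numE// lebesgue_rV_ge0.
have [_ [ab cov <-] lt] := lb_ereal_inf_adherent e0 Afin.
by exists ab; split => //; exact: ltW.
Qed.

Lemma le_lebesgue_rV : {homo lam : A B / A `<=` B >-> (A <= B)%E}.
Proof.
move=> A B AB; apply: le_ereal_inf => _ [ab cov <-]; exists ab => //.
exact: subset_trans cov.
Qed.

Lemma lebesgue_rV_le_box A a b : A `<=` box a b ->
  (lam A <= (box_volume a b)%:E)%E.
Proof.
move=> Aab; pose ab k : V * V := if k is 0%N then (a, b) else (0, 0).
have cov : A `<=` \bigcup_k box (ab k).1 (ab k).2.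
  by move=> x /Aab xab; exists 0%N.
apply: (le_trans (lebesgue_rV_le_cover cov)).
rewrite nneseries_recl//; last by move=> k _; rewrite lee_fin box_volume_ge0.
rewrite /= eseries0 ?adde0// => -[|k]// _ _.
by rewrite /= box_volume00.
Qed.

Lemma lebesgue_rV0 : lam set0 = 0%E.
Proof.
apply/eqP; rewrite eq_le lebesgue_rV_ge0 andbT.
have := @lebesgue_rV_le_box set0 0 0; rewrite box_volume00; exact.
Qed.

(** Covers of the F i whose excesses decrease geometrically are merged into a
    single sequence by a bijection between nat and nat * nat. *)
Lemma lebesgue_rV_sigma_subadditive : sigma_subadditive lam.
Proof.
move=> F.
have [[i Fi]|] := pselect (exists i, lam (F i) = +oo%E).
  by rewrite (eseries_pinfty _ _ Fi) ?leey// => k _;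
     rewrite -ltNye (lt_le_trans _ (lebesgue_rV_ge0 _)).
move=> /forallNP Foo; apply/lee_addgt0Pr => e e0.
have /choice[G GP] : forall i, exists ab : nat -> V * V,
    F i `<=` \bigcup_k box (ab k).1 (ab k).2 /\
    (\sum_(k <oo) (box_volume (ab k).1 (ab k).2)%:E <=
      lam (F i) + (e / (2 ^ i.+1)%:R)%:E)%E.
  move=> i; apply: lebesgue_rV_adherent.
    by rewrite divr_gt0// ltr0n expn_gt0.
  by rewrite ltey; apply/eqP/Foo.
rewrite (le_trans _ (epsilon_trick _ _ (ltW e0)))//; last first.
  by move=> i; exact: lebesgue_rV_ge0.
have /card_esym/ppcard_eqP[f] := card_nat2.
pose v (ij : nat * nat) := (box_volume (G ij.1 ij.2).1 (G ij.1 ij.2).2)%:E.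
have v0 ij : (0 <= v ij)%E by rewrite lee_fin box_volume_ge0.
apply: (@le_trans _ _ (\sum_(k <oo) v (f k))%E).
  apply: (@lebesgue_rV_le_cover _ (fun k => G (f k).1 (f k).2)).
  move=> x [i _ /(GP i).1[j _ xij]].
  by exists (f^-1%FUN (i, j)) => //=; rewrite invK ?inE.
have fb : set_bij setT setT f by exact: bij.
have s0 i : (0 <= \sum_(j <oo) v (i, j))%E by apply: nneseries_ge0 => *.
rewrite [leLHS](_ : _ = \sum_(i <oo) \sum_(j <oo) v (i, j))%E; last first.
  rewrite !nneseries_esumT//.
  under [RHS]eq_esum do rewrite nneseries_esumT//.
  rewrite (@esum_esum _ _ _ _ (fun=> setT) (fun i j => v (i, j)))//.
  rewrite -(reindex_esum _ _ _ v fb).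
  by congr esum; apply/seteqP; split.
apply: lee_nneseries => i _; first by move=> *; exact: s0.
by have [_] := GP i.
Qed.

HB.instance Definition _ := isOuterMeasure.Build R V lam
  lebesgue_rV0 lebesgue_rV_ge0 le_lebesgue_rV lebesgue_rV_sigma_subadditive.

End LebesgueOuter.

Section LebesgueBorel.
Context {R : realType} {n : nat}.
Local Notation V := 'rV[R]_n.+1.
Local Notation lam := (@lebesgue_rV R n.+1).

Lemma borel_open (U : set V) : open U -> measurable (U : set (borel_rV R n.+1)).
Proof. by move=> oU; exact: sub_sigma_algebra. Qed.

Definition half_space (i : 'I_n.+1) (c : R) : set V := [set x | x 0 i <= c].

(** A hyperplane orthogonal to an axis cuts a box into two boxes whose volumes
    add up; cutting all boxes of a cover yields covers of both parts. *)
Lemma half_space_caratheodory i c : lam.-caratheodory (half_space i c).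
Proof.
apply: le_caratheodory_measurable => X; have [XE|Xoo] := eqVneq (lam X) +oo%E.
  by rewrite [leRHS]XE leey.
apply/lee_addgt0Pr => e e0.
have [|ab [cov leX]] := lebesgue_rV_adherent (A := X) e0; first by rewrite ltey.
apply: le_trans leX.
pose lo k : V := \row_j (if j == i then Num.min ((ab k).2 0 i) c else (ab k).2 0 j).
pose hi k : V := \row_j (if j == i then Num.max ((ab k).1 0 i) c else (ab k).1 0 j).
have cut k : (box_volume (ab k).1 (ab k).2)%:E =
    ((box_volume (ab k).1 (lo k))%:E + (box_volume (hi k) (ab k).2)%:E)%E.
  rewrite -EFinD; congr EFin.
  have volE a b : box_volume a b = Num.max 0 (b 0 i - a 0 i) *
      \prod_(j < n.+1 | j != i) Num.max 0 (b 0 j - a 0 j).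
    by rewrite /box_volume (bigD1 i).
  rewrite !volE.
  have E1 : \prod_(j < n.+1 | j != i) Num.max 0 (lo k 0 j - (ab k).1 0 j) =
      \prod_(j < n.+1 | j != i) Num.max 0 ((ab k).2 0 j - (ab k).1 0 j).
    by apply: eq_bigr => j ji; rewrite !mxE (negbTE ji).
  have E2 : \prod_(j < n.+1 | j != i) Num.max 0 ((ab k).2 0 j - hi k 0 j) =
      \prod_(j < n.+1 | j != i) Num.max 0 ((ab k).2 0 j - (ab k).1 0 j).
    by apply: eq_bigr => j ji; rewrite !mxE (negbTE ji).
  rewrite E1 E2 -mulrDl; congr (_ * _); rewrite !mxE eqxx.
  move: ((ab k).1 0 i) ((ab k).2 0 i) => x y.
  by case: (leP y c) => ?; case: (leP x c) => ?; rewrite /Num.max; do !case: ltP => ?; lra.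
under eq_eseriesr do rewrite cut.
rewrite nneseriesD; [|by move=> k _ _; rewrite lee_fin box_volume_ge0..].
apply: leeD.
  apply: (@lebesgue_rV_le_cover _ _ _ (fun k => ((ab k).1, lo k))).
  move=> x [/cov[k _ xk] xc]; exists k => //= j; rewrite !mxE.
  case: eqVneq => [->|_]; last exact: xk.
  by rewrite le_min xc; have /andP[-> ->] := xk i.
apply: (@lebesgue_rV_le_cover _ _ _ (fun k => (hi k, (ab k).2))).
move=> x [/cov[k _ xk] /= /negP]; rewrite -ltNge => xc; exists k => //= j.
rewrite !mxE; case: eqVneq => [->|_]; last exact: xk.
by rewrite gt_max xc; have /andP[-> ->] := xk i.
Qed.

Lemma box_caratheodory (a b : V) : lam.-caratheodory (box a b).
Proof.
rewrite (_ : box a b =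
    \bigcap_(i : 'I_n.+1) (half_space i (b 0 i) `\` half_space i (a 0 i))).
  apply: (@fin_bigcap_measurable _ (caratheodory_type lam)) => // i _.
  apply: (@measurableD _ (caratheodory_type lam));
  exact: half_space_caratheodory.
apply/seteqP; split => [x xab i _|x xab i].
  have /andP[ax xb] := xab i; split => //=.
  by apply/negP; rewrite /half_space /= -ltNge.
by have [xb /= /negP] := xab i I; rewrite -ltNge => ->.
Qed.

(** An open set is the union of the boxes with rational corners inside it, and
    there are countably many of them. *)
Lemma open_caratheodory (U : set V) : open U -> lam.-caratheodory U.
Proof.
move=> oU.
pose q (ab : 'rV[rat]_n.+1 * 'rV[rat]_n.+1) : set V :=
  box (map_mx ratr ab.1) (map_mx ratr ab.2).
pose F ab := if `[< q ab `<=` U >] then q ab else set0.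
have -> : U = \bigcup_ab F ab.
  apply/seteqP; split => [x Ux|x [ab _]]; last first.
    by rewrite /F; case: ifPn => // /asboolP qU /qU.
  have /nbhs_ballP[e /= e0 eU] : nbhs x U by exact: open_nbhs_nbhs.
  have /choice[a aP] : forall i, exists r : rat, x 0 i - e < ratr r < x 0 i.
    by move=> i; have [|r] := @rat_in_itvoo R (x 0 i - e) (x 0 i);
      [lra|rewrite in_itv /=; exists r].
  have /choice[b bP] : forall i, exists r : rat, x 0 i < ratr r < x 0 i + e.
    by move=> i; have [|r] := @rat_in_itvoo R (x 0 i) (x 0 i + e);
      [lra|rewrite in_itv /=; exists r].
  exists (\row_i a i, \row_i b i) => //; rewrite /F ifT.
    move=> i; rewrite !mxE /=.
    by have /andP[_ ->] := aP i; have /andP[/ltW -> _] := bP i.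
  apply/asboolP => y yab; apply: eU; split => // i j; rewrite ord1.
  have := yab j; rewrite !mxE /= => /andP[ya yb].
  have /andP[a1 a2] := aP j; have /andP[b1 b2] := bP j.
  by rewrite /ball /= ltr_norml; apply/andP; split; lra.
apply: (@countable_bigcupT_measurable _ (caratheodory_type lam)) => // ab.
rewrite /F; case: ifPn => _; last exact: caratheodory_measurable_set0.
exact: box_caratheodory.
Qed.

Lemma borel_caratheodory (A : set V) :
  measurable (A : set (borel_rV R n.+1)) -> lam.-caratheodory A.
Proof.
move: A; apply: (@smallest_sub _ _ _ (lam.-caratheodory)); last exact: open_caratheodory.
exact: (sigma_algebra_measurable (caratheodory_type lam)).
Qed.

(** A separate constant on the Borel structure, where lebesgue_rV is
    additive and can carry an instance of measure. *)
Definition leb (A : set (borel_rV R n.+1)) : \bar R := lam A.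

Lemma leb_sigma_additive : semi_sigma_additive leb.
Proof.
move=> F mF tF mUF.
apply: (@caratheodory_measure_sigma_additive R V lam F _ tF).
  by move=> i; apply: borel_caratheodory; exact: mF.
exact: borel_caratheodory.
Qed.

HB.instance Definition _ := isMeasure.Build _ (borel_rV R n.+1) R leb
  lebesgue_rV0 lebesgue_rV_ge0 leb_sigma_additive.

End LebesgueBorel.

Section BoxVolume.
Context {R : realType}.

Lemma lebesgue_measure_oc (a b : R) :
  lebesgue_measure (`]a, b]%classic : set R) = (Num.max 0 (b - a))%:E.
Proof.
rewrite lebesgue_measure_itv /= lte_fin; case: ltP => ab.
  by rewrite max_r// subr_ge0 ltW.
by rewrite max_l// subr_le0.
Qed.

(** Box volumes with coordinates indexed by all natural numbers, so that an
    induction on the dimension stays within one type of points. *)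
Definition nvol N (a b : nat -> R) := \prod_(i < N) Num.max 0 (b i - a i).

Lemma nvol_ge0 N a b : 0 <= nvol N a b.
Proof. by apply: prodr_ge0 => i _; rewrite le_max lexx. Qed.

(** Induction on the dimension: the sections of the boxes at each height t
    of the last coordinate cover the section of the covered box, and the
    inequality between sections is integrated over t. Only the boxes marked by
    w take part, since at height t only the boxes that meet it have a
    section. *)
Lemma nvol_le_cover N : forall (a b : nat -> R) (A B : nat -> nat -> R)
    (w : nat -> bool),
  (forall x : nat -> R, (forall i, (i < N)%N -> a i < x i <= b i) ->
    exists k, w k /\ forall i, (i < N)%N -> A k i < x i <= B k i) ->
  ((nvol N a b)%:E <= \sum_(k <oo) (if w k then nvol N (A k) (B k) else 0)%:E)%E.
Proof.
elim: N => [|N IH] a b A B w cov.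
  have [//|k [wk _]] := cov (fun=> 0).
  rewrite (nneseriesD1 (n := k))//; last first.
    by move=> j _; rewrite lee_fin; case: ifP => // _; rewrite nvol_ge0.
  rewrite wk /nvol !big_ord0 leeDl// nneseries_ge0// => j _ _.
  by rewrite lee_fin big_ord0; case: ifP.
pose g k t : \bar R := ((if w k then nvol N (A k) (B k) else 0)%:E *
   (\1_(`]A k N, B k N]%classic) t)%:E)%E.
have c0 k : 0 <= (if w k then nvol N (A k) (B k) else 0).
  by case: ifP => // _; rewrite nvol_ge0.
have g0 k t : (0 <= g k t)%E by rewrite mule_ge0 // lee_fin.
have mg k : measurable_fun [set: R] (g k).
  by apply: emeasurable_funM => //; apply/measurable_EFinP/measurable_indic.
have section t : a N < t <= b N -> ((nvol N a b)%:E <= \sum_(k <oo) g k t)%E.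
  move=> tab.
  apply: le_trans (IH a b A B (fun k => w k && (A k N < t <= B k N)) _) _.
    move=> x xab; have [i|k [wk kP]] := cov (fun i => if i == N then t else x i).
      rewrite ltnS leq_eqVlt; case: eqVneq => [-> //|_ /=]; exact: xab.
    exists k; split; first by have := kP N (ltnSn N); rewrite eqxx wk.
    by move=> i iN; have := kP i (ltnW iN); rewrite lt_eqF.
  apply: lee_nneseries => k _; first by
    rewrite lee_fin; case: ifP => // _; rewrite nvol_ge0.
  rewrite /g -EFinM lee_fin indicE; case: (w k) => /=; last by rewrite mul0r.
  case: ifPn => [tk|_]; last by rewrite mulr_ge0 ?nvol_ge0.
  by rewrite mem_set ?mulr1//= in_itv.
have -> : (nvol N.+1 a b)%:E =
    (\int[lebesgue_measure]_(t in `]a N, b N]%classic) (nvol N a b)%:E)%E.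
  by rewrite integral_cst//= lebesgue_measure_oc -EFinM /nvol big_ord_recr.
apply: (@le_trans _ _
    (\int[lebesgue_measure]_(t in `]a N, b N]%classic) \sum_(k <oo) g k t)%E).
  apply: ge0_le_integral => //.
  - by move=> t _; rewrite lee_fin nvol_ge0.
  - apply: ge0_emeasurable_sum => [|k]; first by move=> *; exact: g0.
    by move=> _; apply: measurable_funTS; exact: mg.
apply: (@le_trans _ _ (\int[lebesgue_measure]_t \sum_(k <oo) g k t)%E).
  apply: ge0_subset_integral => //.
    apply: ge0_emeasurable_sum => [|k]; first by move=> *; exact: g0.
    by move=> _; exact: mg.
  by move=> t _; apply: nneseries_ge0 => *; exact: g0.
rewrite integral_nneseries//; apply: lee_nneseries => [k _|k _].
  by move=> *; apply: integral_ge0 => *; exact: g0.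
rewrite /g ge0_integralZl//; last by rewrite lee_fin.
  2: exact/measurable_EFinP/measurable_indic.
have -> : (\int[lebesgue_measure]_x (\1_(`]A k N, B k N]%classic : set R) x)%:E)%E =
    (Num.max 0 (B k N - A k N))%:E.
  rewrite integral_indic// setIT; exact: lebesgue_measure_oc.
rewrite -EFinM lee_fin.
by case: (w k); rewrite /nvol ?big_ord_recr// mul0r.
Qed.

End BoxVolume.

Section LebesgueScaling.
Context {R : realType} {n : nat}.
Local Notation V := 'rV[R]_n.+1.
Local Notation lam := (@lebesgue_rV R n.+1).
Implicit Types (a b c x : V) (A : set V).

Lemma lebesgue_rV_box_ge a b : ((box_volume a b)%:E <= lam (box a b))%E.
Proof.
apply: le_ereal_inf_tmp => _ [ab cov <-].
pose f (x : V) (i : nat) := x 0 (inord i).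
have volE (x y : V) : box_volume x y = nvol n.+1 (f x) (f y).
  by apply: eq_bigr => i _; rewrite /f inord_val.
rewrite volE; under eq_eseriesr do rewrite volE.
apply: le_trans (nvol_le_cover (A := fun k => f (ab k).1)
  (B := fun k => f (ab k).2) (w := xpredT) _) _ => //.
move=> x xab; have /cov[k _ kP] : box a b (\row_i x i).
  by move=> i; have := xab i (ltn_ord i); rewrite mxE /f inord_val.
exists k; split => // i iN.
by have := kP (Ordinal iN); rewrite mxE /f (_ : inord i = Ordinal iN)//;
  apply/val_inj; rewrite /= inordK.
Qed.

Lemma lebesgue_rV_affine_le A (r : R) c : 0 < r ->
  (lam [set (r *: x + c)%R | x in A] <= (r ^+ n.+1)%:E * lam A)%E.
Proof.
move=> r0; rewrite -lee_pdivrMl ?exprn_gt0//.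
apply: le_ereal_inf_tmp => _ [ab cov <-].
rewrite lee_pdivrMl ?exprn_gt0//.
pose h x := r *: x + c.
have cov' : [set r *: x + c | x in A] `<=`
    \bigcup_k box (h (ab k).1, h (ab k).2).1 (h (ab k).1, h (ab k).2).2.
  move=> _ [x Ax <-]; have [k _ xk] := cov _ Ax; exists k => // i.
  by have := xk i; rewrite !mxE ltrD2r lerD2r ltr_pM2l// ler_pM2l.
apply: le_trans (lebesgue_rV_le_cover (ab := fun k => (h (ab k).1, h (ab k).2)) cov') _.
rewrite -nneseriesZl//; last by move=> k _; rewrite lee_fin box_volume_ge0.
apply: lee_nneseries => k _; first by rewrite lee_fin box_volume_ge0.
rewrite -EFinM lee_fin /box_volume -[X in r ^+ X]card_ord -prodr_const -big_split /=.
apply: ler_prod => i _; rewrite le_max lexx /= !mxE.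
by rewrite opprD addrACA subrr addr0 -mulrBr -{1}(mulr0 r) maxr_pMr// ltW.
Qed.

(** The inverse affine map gives the reverse inequality. *)
Lemma lebesgue_rV_affine A (r : R) c : 0 < r ->
  lam [set (r *: x + c)%R | x in A] = ((r ^+ n.+1)%:E * lam A)%E.
Proof.
move=> r0; apply/eqP; rewrite eq_le lebesgue_rV_affine_le//=.
have ri0 : 0 < r^-1 by rewrite invr_gt0.
have := lebesgue_rV_affine_le [set r *: x + c | x in A] (- (r^-1 *: c)) ri0.
rewrite [X in lam X](_ : _ = A); last first.
  have hK x : r^-1 *: (r *: x + c) - r^-1 *: c = x.
    by rewrite scalerDr scalerA mulVf ?gt_eqF// scale1r addrK.
  apply/seteqP; split => [_ [_ [x Ax <-] <-]|x Ax]; first by rewrite hK.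
  by exists (r *: x + c); [exists x|rewrite hK].
by rewrite exprVn lee_pdivlMl// exprn_gt0.
Qed.

End LebesgueScaling.

(** * Euclidean distances, balls and the unit sphere *)

Section EuclideanNorm.
Context {R : realType} {n : nat}.
Local Notation V := 'rV[R]_n.
Implicit Types (x y : V) (e r : R).

Lemma enorm_ge0 x : 0 <= enorm x.
Proof. exact: sqrtr_ge0. Qed.

Lemma enorm_sqr x : enorm x ^+ 2 = \sum_(i < n) x 0 i ^+ 2.
Proof. by rewrite sqr_sqrtr// sumr_ge0// => i _; rewrite sqr_ge0. Qed.

Lemma coord_le_enorm x i : `|x 0 i| <= enorm x.
Proof.
rewrite -sqrtr_sqr ler_wsqrtr// (bigD1 i)//= lerDl.
by rewrite sumr_ge0// => j _; rewrite sqr_ge0.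
Qed.

(** A crude bound, enough to compare Euclidean with coordinatewise
    boundedness. *)
Lemma enorm_le_coord x e : 0 <= e -> (forall i, `|x 0 i| <= e) ->
  enorm x <= n%:R * e.
Proof.
move=> e0 xe; rewrite -(ler_pXn2r (n := 2)) ?nnegrE ?mulr_ge0 ?enorm_ge0//.
rewrite enorm_sqr; apply: (@le_trans _ _ (\sum_(i < n) e ^+ 2)).
  apply: ler_sum => i _; rewrite -real_normK ?num_real//.
  by rewrite ler_pXn2r ?nnegrE.
rewrite sumr_const card_ord -[leLHS]mulr_natl exprMn; apply: ler_wpM2r; rewrite ?sqr_ge0//.
by rewrite -natrX ler_nat; case: (n) => // m; rewrite leq_pmulr.
Qed.

Lemma coord_le_norm x i : `|x 0 i| <= `|x|.
Proof.
rewrite [leRHS]/Num.norm /= mx_normrE.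
by apply/bigmax_geP; right => /=; exists (0, i).
Qed.

Lemma norm_le_enorm x : `|x| <= enorm x.
Proof.
rewrite [leLHS]/Num.norm /= mx_normrE; apply/bigmax_leP; split; first exact: enorm_ge0.
by move=> [i j] _ /=; rewrite ord1 coord_le_enorm.
Qed.

Lemma enorm0 : enorm (0 : V) = 0.
Proof.
by rewrite /enorm big1 ?sqrtr0// => i _; rewrite mxE expr0n.
Qed.

Lemma enorm_eq0 x : (enorm x == 0) = (x == 0).
Proof.
apply/eqP/eqP => [x0|->]; last exact: enorm0.
apply/rowP => i; rewrite mxE; apply/eqP; rewrite -normr_le0 -x0.
exact: coord_le_enorm.
Qed.

Lemma enorm_gt0 x : (0 < enorm x) = (x != 0).
Proof. by rewrite lt_neqAle enorm_ge0 andbT eq_sym enorm_eq0. Qed.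

Lemma enormZ r x : 0 <= r -> enorm (r *: x) = r * enorm x.
Proof.
move=> r0; rewrite /enorm; under eq_bigr do rewrite mxE exprMn.
by rewrite -mulr_sumr sqrtrM ?sqr_ge0// sqrtr_sqr ger0_norm.
Qed.

Lemma enormN x : enorm (- x) = enorm x.
Proof.
by rewrite /enorm; congr Num.sqrt; apply: eq_bigr => i _; rewrite mxE sqrrN.
Qed.

Lemma enormC x y : enorm (x - y) = enorm (y - x).
Proof. by rewrite -enormN opprB. Qed.

End EuclideanNorm.

Section BorelFunctions.
Context {R : realType} {n : nat}.
Local Notation V := 'rV[R]_n.
Local Notation T := (borel_rV R n).

Lemma measurable_coord (i : 'I_n) :
  measurable_fun [set: T] (fun x : T => (x : V) 0 i).
Proof.
apply: (measurability _ (RGenOpens.measurableE R)).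
move=> _ [_ [a [b ->] <-]]; rewrite setTI; apply: sub_sigma_algebra.
have /continuousP := @coord_continuous R 1 n 0 i.
by apply; exact: interval_open.
Qed.

Lemma measurable_sqrt : measurable_fun [set: R] (@Num.sqrt R).
Proof. by apply: continuous_measurable_fun; exact: sqrt_continuous. Qed.

Lemma measurable_fun_enorm d (S : measurableType d) (f : S -> V) :
  (forall i, measurable_fun [set: S] (fun s => f s 0 i)) ->
  measurable_fun [set: S] (fun s => enorm (f s)).
Proof.
move=> mf; apply: (measurableT_comp measurable_sqrt).
by apply: measurable_sum => i; exact: measurable_funX.
Qed.

Lemma measurable_dist :
  measurable_fun [set: T * T] (fun z : T * T => enorm ((z.1 : V) - z.2)).
Proof.
apply: measurable_fun_enorm => i.
rewrite (_ : (fun _ => _) = (fun z : T * T => (z.1 : V) 0 i - (z.2 : V) 0 i)).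
  apply: measurable_funB.
    exact: (measurableT_comp (measurable_coord i) measurable_fst).
  exact: (measurableT_comp (measurable_coord i) measurable_snd).
by apply/funext => z; rewrite !mxE.
Qed.

Lemma measurable_dist_to (x : V) :
  measurable_fun [set: T] (fun y : T => enorm (x - y)).
Proof. exact: (measurableT_comp measurable_dist (pair1_measurable (x : T))). Qed.

Definition eball (x : V) (r : R) : set T := [set y | enorm (x - y) <= r].

Lemma measurable_eball x r : measurable (eball x r).
Proof.
rewrite -[eball x r]setTI; rewrite (_ : eball x r =
  (fun y : T => enorm (x - y)) @^-1` `]-oo, r]%classic); last first.
  by apply/seteqP; split => y /=; rewrite in_itv.
exact: measurable_dist_to.
Qed.

Lemma compact_borel (K : set V) : compact K -> measurable (K : set T).
Proof.
move=> cK; have := compact_closed (@norm_hausdorff _ _) cK.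
move=> /closed_openC /(@sub_sigma_algebra _ setT open) mK.
by rewrite -(setCK K); exact: (@measurableC _ T).
Qed.

Lemma compact_dist_bounded (K : set V) : compact K ->
  exists2 D, 0 < D & forall x y, K x -> K y -> enorm (x - y) <= D.
Proof.
move=> /compact_bounded[M [_ KM]].
have M1 : forall x, K x -> `|x| <= `|M| + 1.
  by apply: KM; rewrite (le_lt_trans (ler_norm M))// ltrDl.
exists (n%:R * ((`|M| + 1) *+ 2) + 1).
  by rewrite ltr_wpDl// mulr_ge0// mulrn_wge0// addr_ge0.
move=> x y Kx Ky; apply: (@le_trans _ _ (n%:R * ((`|M| + 1) *+ 2))).
  apply: enorm_le_coord; first by rewrite mulrn_wge0// addr_ge0.
  move=> i; apply: le_trans (coord_le_norm _ _) _.
  by rewrite (le_trans (ler_normB _ _))// mulr2n lerD ?M1.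
by rewrite lerDl.
Qed.

End BorelFunctions.

Section BallMeasure.
Context {R : realType} {n : nat}.
Local Notation V := 'rV[R]_n.+1.
Local Notation lam := (@lebesgue_rV R n.+1).
Local Notation leb := (@leb R n).

Lemma leb_bounded_lty (A : set V) (e : R) :
  (forall x, A x -> forall i, `|x 0 i| <= e) -> (lam A < +oo)%E.
Proof.
move=> Ae; apply: le_lt_trans (lebesgue_rV_le_box (a := const_mx (- e - 1))
  (b := const_mx e) _) (ltry _).
move=> x /Ae xe i; rewrite !mxE; have := xe i; rewrite ler_norml => /andP[? ->].
by rewrite andbT; lra.
Qed.

Lemma leb_eball_lty (x : V) r : (leb (eball x r) < +oo)%E.
Proof.
apply: (@leb_bounded_lty _ (enorm x + r)) => y xy i.
rewrite -(subKr x y) mxE; apply: (le_trans (ler_normD _ _)).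
rewrite mxE normrN lerD ?coord_le_enorm//; apply: le_trans xy.
exact: coord_le_enorm.
Qed.

Definition ball_volume : R := fine (leb (eball 0 1)).

Lemma ball_volumeE : (ball_volume%:E = leb (eball 0 1))%E.
Proof.
by rewrite fineK// ge0_fin_numE ?leb_eball_lty// measure_ge0.
Qed.

(** All balls are homothetic to the unit ball. *)
Lemma leb_eball (x : V) (r : R) : 0 < r ->
  leb (eball x r) = (ball_volume * r ^+ n.+1)%:E.
Proof.
move=> r0; rewrite mulrC EFinM ball_volumeE -[RHS](lebesgue_rV_affine _ x r0).
congr lam; apply/seteqP; split => [y xy|_ [y y1 <-]].
  exists (r^-1 *: (y - x)); last first.
    by rewrite scalerA mulfV ?gt_eqF// scale1r subrK.
  rewrite /eball /= sub0r enormN enormZ ?invr_ge0 ?(ltW r0)//.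
  by rewrite enormC mulrC ler_pdivrMr// mul1r.
rewrite /eball /= opprD addrCA subrr addr0 enormN enormZ ?(ltW r0)//.
by rewrite ler_piMr ?(ltW r0)//; move: y1; rewrite /eball /= sub0r enormN.
Qed.

(** The unit ball contains a small box. *)
Lemma ball_volume_gt0 : 0 < ball_volume.
Proof.
rewrite -lte_fin ball_volumeE.
pose e : R := n.+1%:R^-1.
apply: (@lt_le_trans _ _ (lam (box 0 (const_mx e)))).
  apply: lt_le_trans (lebesgue_rV_box_ge _ _); rewrite lte_fin.
  by apply: prodr_gt0 => i _; rewrite !mxE subr0 lt_max invr_gt0 ltr0n orbT.
apply: le_lebesgue_rV => x xe; rewrite /eball /= sub0r enormN.
rewrite (le_trans (enorm_le_coord (e := e) _ _)) ?invr_ge0//; last first.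
  by rewrite mulfV.
move=> i; have := xe i; rewrite !mxE => /andP[/ltW x0 xi].
by rewrite ger0_norm.
Qed.

(** Small balls have small measure. *)
Lemma leb_set1 (x : V) : leb [set x] = 0%E.
Proof.
apply/eqP; rewrite eq_le measure_ge0 andbT.
have le r : 0 < r -> (leb [set x] <= (ball_volume * r)%:E)%E.
  move=> r0; have m0 : 0 < Num.min 1 r by rewrite lt_min r0 ltr01.
  apply: (@le_trans _ _ (leb (eball x (Num.min 1 r)))).
    apply: le_lebesgue_rV => _ ->; rewrite /eball /= subrr enorm0; exact: ltW.
  rewrite leb_eball// lee_fin ler_pM2l ?ball_volume_gt0//.
  rewrite exprS (le_trans (ler_piMr (ltW m0) _))//.
    by rewrite exprn_ile1 ?(ltW m0)// ge_min lexx.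
  by rewrite ge_min lexx orbT.
apply/lee_addgt0Pr => e e0; rewrite add0e.
have := le (ball_volume^-1 * e); rewrite mulrA mulfV ?gt_eqF ?ball_volume_gt0//.
by rewrite mul1r; apply; rewrite mulr_gt0// invr_gt0 ball_volume_gt0.
Qed.

(** The cone over the sphere is the unit ball without its centre. *)
Lemma surface_measure_usphere :
  surface_measure (usphere R n.+1) = (n.+1%:R * ball_volume)%:E.
Proof.
rewrite EFinM ball_volumeE /surface_measure; congr (_ * _)%E.
apply/eqP; rewrite eq_le; apply/andP; split.
  apply: le_lebesgue_rV => _ [r [u [/andP[r0 r1] [_ u1] ->]]].
  by rewrite /eball /= sub0r enormN enormZ ?(ltW r0)// u1 mulr1.
have sub : eball 0 1 `<=` cone (usphere R n.+1) `|` [set (0 : V)].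
  move=> x; rewrite /eball /= sub0r enormN => x1.
  have [->|x0] := eqVneq x 0; [by right|left].
  exists (enorm x), ((enorm x)^-1 *: x); rewrite x1 enorm_gt0 x0; split => //.
    split; rewrite /usphere /= enormZ ?invr_ge0 ?enorm_ge0//.
      by rewrite mulVf// enorm_eq0.
    by rewrite mulVf// enorm_eq0.
  by rewrite scalerA mulfV ?enorm_eq0// scale1r.
apply: (le_trans (le_lebesgue_rV sub)).
apply: (le_trans (outer_measureU2 lam _ _)).
by rewrite [X in (_ + X)%E]leb_set1 adde0.
Qed.

End BallMeasure.

(** * Integrals over products and of functions bounded below *)

Section ProductIntegral.
Local Open Scope ereal_scope.
Context d1 d2 (T1 : measurableType d1) (T2 : measurableType d2) (R : realType).
Variable m1 : {sigma_finite_measure set T1 -> \bar R}.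
Variable m2 : {sigma_finite_measure set T2 -> \bar R}.

Lemma integral_setX (A : set T1) (B : set T2) (f : T1 * T2 -> \bar R) :
  measurable A -> measurable B -> measurable_fun setT f ->
  (forall x y, A x -> B y -> 0 <= f (x, y)) ->
  \int[m1 \x m2]_(z in A `*` B) f z = \int[m1]_(x in A) \int[m2]_(y in B) f (x, y).
Proof.
move=> mA mB mf f0; rewrite integral_mkcond fubini_tonelli1; last 2 first.
- apply/(measurable_restrictT _ _).1; first exact: measurableX.
  exact: measurable_funTS.
- by move=> [x y]; rewrite /patch; case: ifPn => //; rewrite inE => -[/= ? ?]; exact: f0.
rewrite [RHS]integral_mkcond; apply: eq_integral => x _ /=.
rewrite /fubini_F /patch; case: ifPn => xA.
  rewrite [RHS]integral_mkcond; apply: eq_integral => y _ /=.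
  by rewrite /patch in_setX /= xA.
by apply: integral0_eq => y _; rewrite in_setX /= (negbTE xA).
Qed.

End ProductIntegral.

Section BoundedBelow.
Local Open Scope ereal_scope.
Context d (T : measurableType d) (R : realType).
Variables (mu : {measure set T -> \bar R}) (D : set T).
Hypotheses (mD : measurable D) (muD : mu D = 1).

Lemma integral_cst1 (c : R) : \int[mu]_(x in D) c%:E = c%:E.
Proof. by rewrite integral_cst//= muD mule1. Qed.

(** The identity h^+ + c^+ = g + h^- + c^- for h = g - c has nonnegative terms
    only, and h^- has a finite integral. *)
Lemma ge0_integralB_cst (g : T -> \bar R) (c : R) :
  measurable_fun D g -> (forall x, D x -> 0 <= g x) ->
  \int[mu]_(x in D) (g x - c%:E) = \int[mu]_(x in D) g x - c%:E.
Proof.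
move=> mg g0; pose h x := g x - c%:E.
have mh : measurable_fun D h by apply: emeasurable_funB.
have mhp : measurable_fun D h^\+ by exact: measurable_funepos.
have mhn : measurable_fun D h^\- by exact: measurable_funeneg.
rewrite -/(h _) integralE.
pose cp : R := Num.max c 0%R; pose cn : R := Num.max (- c)%R 0%R.
have cp0 : (0 <= cp%:E) by rewrite lee_fin le_max lexx orbT.
have cn0 : (0 <= cn%:E) by rewrite lee_fin le_max lexx orbT.
have E : \int[mu]_(x in D) h^\+ x + cp%:E =
    \int[mu]_(x in D) g x + \int[mu]_(x in D) h^\- x + cn%:E.
  rewrite -(integral_cst1 cp) -(integral_cst1 cn) -!ge0_integralD//; last first.
    - exact: emeasurable_funD.
    - by move=> x Dx; rewrite adde_ge0// g0.
  apply: eq_integral => x /[!inE] Dx; rewrite funeposE funenegE /h /cp /cn.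
  have := g0 _ Dx; case: (g x) => [r| |]//= r0; last by rewrite ?maxye ?maxNye.
  rewrite -?EFinN -?EFinD -!EFin_max -!EFinD; congr EFin.
  by rewrite /Num.max; do !case: ltP => ?; lra.
have Nle : \int[mu]_(x in D) h^\- x <= cp%:E.
  rewrite -(integral_cst1 cp); apply: ge0_le_integral => //.
  move=> x Dx; rewrite funenegE /h /cp ge_max cp0 andbT.
  have := g0 _ Dx; case: (g x) => [r| |]//= r0; last by rewrite leNye.
  rewrite lee_fin le_max; apply/orP; left.
  by move: r0; rewrite lee_fin => ?; lra.
have N0 : 0 <= \int[mu]_(x in D) h^\- x by apply: integral_ge0.
have P0 : 0 <= \int[mu]_(x in D) h^\+ x by apply: integral_ge0.
have G0 : 0 <= \int[mu]_(x in D) g x by apply: integral_ge0.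
have cE : c = (cp - cn)%R.
  by rewrite /cp /cn /Num.max; do !case: ltP => ?; lra.
move: E Nle N0 P0 G0; move: (\int[mu]_(x in D) h^\- x) (\int[mu]_(x in D) h^\+ x)
  (\int[mu]_(x in D) g x) => [a| |] [b| |] [e| |]//=.
rewrite -!EFinD => -[E] _ _ _ _; congr EFin; lra.
Qed.

(** The loss at one radius is an affine function of the loss at another one,
    and of the kernel. Their integrals may be +oo; that f is bounded below makes
    both sides meaningful. *)
Lemma integral_affine (f : T -> \bar R) (B a b : R) :
  measurable_fun D f -> (forall x, D x -> (- B)%:E <= f x) -> (0 <= a)%R ->
  \int[mu]_(x in D) (a%:E * f x + b%:E) = a%:E * \int[mu]_(x in D) f x + b%:E.
Proof.
move=> mf fB a0.
pose g x := f x + B%:E.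
have mg : measurable_fun D g by apply: emeasurable_funD.
have g0 x : D x -> 0 <= g x.
  by move=> /fB; rewrite /g EFinN -leeBlDr// sub0e.
have fE : \int[mu]_(x in D) f x = \int[mu]_(x in D) g x - B%:E.
  rewrite -ge0_integralB_cst//; apply: eq_integral => x _.
  by rewrite /g addeK.
have -> : \int[mu]_(x in D) (a%:E * f x + b%:E) =
    \int[mu]_(x in D) (a%:E * g x - (a * B - b)%:E).
  apply: eq_integral => x /[!inE] Dx; rewrite /g; have := fB _ Dx.
  case: (f x) => [r _| _|]//=.
    by rewrite -?EFinN -!EFinM -!EFinD; congr EFin; ring.
  have [->|a1] := eqVneq a 0%R; last by rewrite gt0_muley ?lte_fin ?lt0r ?a1.
  by rewrite !mul0e !add0e; congr EFin; ring.
rewrite ge0_integralB_cst//; last 2 first.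
- exact: measurable_funeM.
- by move=> x Dx; rewrite mule_ge0// ?lee_fin// g0.
rewrite ge0_integralZl// ?lee_fin// fE.
have : 0 <= \int[mu]_(x in D) g x by apply: integral_ge0.
case: (\int[mu]_(x in D) g x) => [r _| _|]//=.
  by rewrite -?EFinN -!EFinM -!EFinD; congr EFin; ring.
have [->|a1] := eqVneq a 0%R; last by rewrite gt0_muley ?lte_fin ?lt0r ?a1.
by rewrite !mul0e !add0e; congr EFin; ring.
Qed.

(** The form in which a pointwise gap on a set of positive measure becomes a
    gap between means; f and g may have infinite integrals. *)
Lemma le_integral_gap (f g : T -> \bar R) (E : set T) (B e : R) :
  measurable_fun D f -> measurable_fun D g -> measurable E -> E `<=` D ->
  (0 <= e)%R ->
  (forall x, D x -> (- B)%:E <= f x) ->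
  (forall x, D x -> f x <= g x) -> (forall x, E x -> f x + e%:E <= g x) ->
  \int[mu]_(x in D) f x + e%:E * mu E <= \int[mu]_(x in D) g x.
Proof.
move=> mf mg mE ED e0 fB fg gap.
pose f' x := f x + B%:E; pose g' x := g x + B%:E.
have f0 x : D x -> 0 <= f' x.
  by move=> /fB; rewrite /f' EFinN -leeBlDr// sub0e.
have fg' x : D x -> f' x <= g' x by move=> Dx; rewrite leeD2r// fg.
have g0 x : D x -> 0 <= g' x by move=> Dx; rewrite (le_trans (f0 _ Dx))// fg'.
have mf' : measurable_fun D f' by apply: emeasurable_funD.
have mg' : measurable_fun D g' by apply: emeasurable_funD.
have -> : \int[mu]_(x in D) f x = \int[mu]_(x in D) f' x - B%:E.
  by rewrite -ge0_integralB_cst//; apply: eq_integral => x _; rewrite /f' addeK.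
have -> : \int[mu]_(x in D) g x = \int[mu]_(x in D) g' x - B%:E.
  by rewrite -ge0_integralB_cst//; apply: eq_integral => x _; rewrite /g' addeK.
rewrite addeAC leeD2r//.
have mI : measurable_fun D (fun x => e%:E * (\1_E x)%:E).
  apply: measurable_funeM; apply/measurable_EFinP; exact: measurable_indic.
have -> : e%:E * mu E = \int[mu]_(x in D) (e%:E * (\1_E x)%:E).
  rewrite ge0_integralZl//.
  2: by apply/measurable_EFinP; exact: measurable_indic.
  by rewrite integral_indic// setIidl.
rewrite -ge0_integralD//; last by move=> x _; rewrite -EFinM lee_fin mulr_ge0.
apply: ge0_le_integral => //.
- by move=> x Dx; rewrite adde_ge0 ?f0// -EFinM lee_fin mulr_ge0.
- exact: emeasurable_funD.
- move=> x Dx; rewrite indicE; case: (boolP (x \in E)) => [/[!inE] Ex|_] /=.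
    by rewrite mule1 /f' /g' addeAC leeD2r// gap.
  by rewrite mule0 adde0 fg'.
Qed.

End BoundedBelow.

(** * The power loss and its dependence on the exponent *)

Section PowerLoss.
Context {R : realType}.
Implicit Types (p q r u v w : R).

(** The loss in logarithmic scale, u = ln w. *)
Definition expLoss p u : R := if p == 0 then - u else (expR (- p * u) - 1) / p.

Lemma is_derive_expLoss p u : is_derive u 1 (expLoss p) (- expR (- p * u)).
Proof.
rewrite /expLoss; case: eqVneq => [->|p0].
  by rewrite oppr0 mul0r expR0; apply: is_deriveN.
have H : is_derive u 1 (fun v => - p * v) (- p).
  rewrite -[X in is_derive _ _ _ X]mulr1; exact: is_deriveZ.
have H1 := is_derive1_comp (is_derive_expR (- p * u)) H.
have H2 := is_deriveB H1 (is_derive_cst (1 : R) u 1).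
have H3 := is_deriveZ (p^-1) H2.
rewrite (_ : - expR _ = p^-1 *: (expR (- p * u) * - p - 0)); last first.
  by rewrite subr0 mulrC; rewrite /GRing.scale /=; field.
rewrite (_ : (fun _ => _) = p^-1 \*: (expR \o *%R (- p) - cst 1)) //.
by apply/funext => v; rewrite mulrC.
Qed.

Lemma expLoss0 p : expLoss p 0 = 0.
Proof.
by rewrite /expLoss; case: eqP => _; rewrite ?oppr0// mulr0 expR0 subrr mul0r.
Qed.

Lemma is_derive_expLossB p q (x : R) :
  is_derive x 1 (expLoss q - expLoss p) (- expR (- q * x) - - expR (- p * x)).
Proof. exact: is_deriveB (is_derive_expLoss q x) (is_derive_expLoss p x). Qed.

Lemma expLossB_MVT p q u v : u < v -> exists2 c, u < c < v &
  (expLoss q v - expLoss p v) - (expLoss q u - expLoss p u) =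
  (expR (- p * c) - expR (- q * c)) * (v - u).
Proof.
move=> uv; have dg := is_derive_expLossB p q.
have [c] := @MVT R (expLoss q - expLoss p) _ u v uv (fun x _ => dg x)
  (derivable_within_continuous (fun x _ => @ex_derive _ _ _ _ _ _ _ (dg x))).
rewrite in_itv /= => uv' E; exists c => //.
by rewrite [LHS]E opprK [X in X * _]addrC.
Qed.

(** Convexity in the order is read off the derivative in u, which is
    exp(-p u) - exp(-q u) and changes sign at u = 0 only. *)
Lemma expLossB_decr p q u v : p < q -> u < v -> v <= 0 ->
  expLoss q v - expLoss p v < expLoss q u - expLoss p u.
Proof.
move=> pq uv v0.
have [c /andP[uc cv] E] := expLossB_MVT p q uv.
rewrite -subr_lt0 E pmulr_llt0 ?subr_gt0// subr_lt0 ltr_expR.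
by rewrite ltr_nM2r ?ltrN2// (lt_le_trans cv).
Qed.

Lemma expLoss_le p q u : p <= q -> expLoss p u <= expLoss q u.
Proof.
rewrite le_eqVlt => /predU1P[->//|pq].
rewrite -subr_ge0; have [u0|u0|->] := ltgtP u 0; last by rewrite !expLoss0 subrr.
  have := expLossB_decr pq u0 (lexx 0); rewrite !expLoss0 subrr; exact: ltW.
have [c /andP[c0 cu]] := expLossB_MVT p q u0.
rewrite !expLoss0 subrr subr0 => ->.
rewrite mulr_ge0 ?subr0 ?(ltW u0)// subr_ge0 ler_expR.
by rewrite ler_wpM2r ?lerN2 ?(ltW pq)// ltW.
Qed.

(** The affine normalisation of w^(-p) with value 0 and slope -1 at w = 1; the
    value at p = 0 is the limit. *)
Definition powLoss p w : R := if p == 0 then - ln w else (w `^ (- p) - 1) / p.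

Lemma powLossE p w : 0 < w -> powLoss p w = expLoss p (ln w).
Proof.
by move=> w0; rewrite /powLoss /expLoss; case: eqP => // _; rewrite /powR gt_eqF.
Qed.

Lemma powLoss_0 p : p < 0 -> powLoss p 0 = - p^-1.
Proof.
move=> p0; rewrite /powLoss lt_eqF// powR0 ?oppr_eq0 ?lt_eqF//.
by rewrite sub0r mulN1r.
Qed.

Lemma powLoss_1 p : powLoss p 1 = 0.
Proof. by rewrite powLossE// ln1 expLoss0. Qed.

(** For q < 0 the loss also makes sense at w = 0, where it is the limit from
    the right. *)
Lemma powLoss_gap p q : p < q ->
  exists2 e, 0 < e & forall w, 0 <= w <= 2^-1 -> (w = 0 -> q < 0) ->
    powLoss p w + e <= powLoss q w.
Proof.
move=> pq; pose u := ln (2^-1 : R).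
have u0 : u < 0 by rewrite ln_lt0// invr_gt0 ltr0n invf_lt1// ltr1n.
exists (expLoss q u - expLoss p u).
  by have := expLossB_decr pq u0 (lexx 0); rewrite !expLoss0 subrr.
move=> w /andP[w0 w2] wq; rewrite addrC -lerBrDr.
move: w0; rewrite le_eqVlt => /predU1P[w0|w0].
  have q0 : q < 0 by exact: wq.
  have p0 : p < 0 by exact: lt_trans pq q0.
  rewrite -w0 !powLoss_0// /expLoss !lt_eqF//.
  have : expR (- q * u) / q <= expR (- p * u) / p.
    suff : expR (- p * u) / - p <= expR (- q * u) / - q by rewrite !invrN !mulrN lerN2.
    apply: ler_pM; rewrite ?expR_ge0 ?invr_ge0 ?oppr_ge0 ?(ltW p0)//.
      by rewrite ler_expR ler_wnM2r ?(ltW u0)// lerN2 ltW.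
    by rewrite lef_pV2 ?posrE ?oppr_gt0// lerN2 ltW.
  rewrite !mulrBl !mul1r; lra.
rewrite !powLossE//; have [->//|] := eqVneq w (2^-1).
move=> w2'; have wu : ln w < u.
  by rewrite ltr_ln ?posrE ?invr_gt0// lt_neqAle w2'.
exact/ltW/(expLossB_decr pq wu)/ltW.
Qed.

Lemma powLoss_le p q w : 0 <= w -> (w = 0 -> q < 0) -> p <= q ->
  powLoss p w <= powLoss q w.
Proof.
move=> w0 wq; rewrite le_eqVlt => /predU1P[->//|pq].
move: w0; rewrite le_eqVlt => /predU1P[w0|w0].
  have [e e0 /(_ w)] := powLoss_gap pq.
  move=> /(_ _ wq) H; apply: le_trans (H _); first by rewrite lerDl ltW.
  by rewrite -w0 lexx invr_ge0 ler0n.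
by rewrite !powLossE// expLoss_le// ltW.
Qed.

Lemma powLoss_nincr p w v : 0 <= w -> (w = 0 -> p < 0) -> 0 < v -> w <= v ->
  powLoss p v <= powLoss p w.
Proof.
move=> w0 wp v0 wv; rewrite /powLoss; case: eqVneq => [p0|p0].
  rewrite lerN2 ler_ln ?posrE// lt_neqAle w0 eq_sym andbT.
  by apply/eqP => /wp; rewrite p0 ltxx.
move: p0; rewrite neq_lt => /orP[p0|p0].
  rewrite ler_wnM2r ?invr_le0 ?(ltW p0)// lerD2r//.
  by rewrite ge0_ler_powR ?nnegrE ?oppr_ge0 ?(ltW p0)// ltW.
have {}w0 : 0 < w.
  by rewrite lt_neqAle w0 andbT; apply/eqP => /esym/wp; rewrite ltNge (ltW p0).
rewrite ler_wpM2r ?invr_ge0 ?(ltW p0)// lerD2r// !powRN.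
by rewrite lef_pV2 ?posrE ?powR_gt0// ge0_ler_powR ?nnegrE ?(ltW p0) ?(ltW w0) ?(ltW v0).
Qed.

(** Changing the unit of length acts affinely on losses. *)
Lemma powLossM p w a : 0 <= w -> (w = 0 -> p < 0) -> 0 < a ->
  powLoss p (w * a) = a `^ (- p) * powLoss p w + powLoss p a.
Proof.
move=> w0 wp a0; rewrite /powLoss; case: eqVneq => [p0|p0].
  have {}w0 : 0 < w.
    by rewrite lt_neqAle w0 andbT; apply/eqP => /esym/wp; rewrite p0 ltxx.
  by rewrite p0 oppr0 powRr0 mul1r lnM ?posrE// opprD.
rewrite powRM// ?(ltW a0)//; field.
exact: p0.
Qed.

End PowerLoss.

(** * Capacities through mean losses *)

Section PowerMono.
Context {R : realType}.
Implicit Types (p r s u v : R).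

Lemma ltr_powR_mono s u v : 0 < s -> 0 <= u -> 0 <= v ->
  (u `^ s < v `^ s) = (u < v).
Proof.
move=> s0 u0 v0; apply/idP/idP; last first.
  by move=> uv; apply: gt0_ltr_powR; rewrite // nnegrE.
by apply: contraTT; rewrite -!leNgt => vu; rewrite ge0_ler_powR ?nnegrE// ltW.
Qed.

(** For negative exponents V |-> V^(-1/p) is increasing, so a capacity above r
    is an energy above r^(-p); for positive exponents it is decreasing. *)
Lemma lt_powR_invN p r v : p < 0 -> 0 < r -> 0 <= v ->
  (r < v `^ (- p^-1)) = (r `^ (- p) < v).
Proof.
move=> p0 r0 v0; have p1 : 0 < - p^-1 by rewrite oppr_gt0 invr_lt0.
rewrite -[in RHS](ltr_powR_mono p1) ?powR_ge0// -powRrM.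
by rewrite mulrNN mulfV ?lt_eqF// powRr1// ltW.
Qed.

Lemma lt_powR_invP p r v : 0 < p -> 0 < r -> 0 < v ->
  (r < v `^ (- p^-1)) = (v < r `^ (- p)).
Proof.
move=> p0 r0 v0; have p1 : 0 < p^-1 by rewrite invr_gt0.
rewrite -[in RHS](ltr_powR_mono p1) ?powR_ge0 ?(ltW v0)// -powRrM.
rewrite mulNr mulfV ?gt_eqF// powR_inv1 ?(ltW r0)// powRN.
by rewrite -[in LHS](invrK r) ltf_pV2 ?posrE ?invr_gt0// powR_gt0.
Qed.

End PowerMono.

Section Energies.
Context {R : realType} {n : nat}.
Local Notation V := 'rV[R]_n.
Local Notation T := (borel_rV R n).
Implicit Types (p r d M : R) (K : set V) (mu : probability T R).

(** The kernels depend on the distance d only. At d = 0 the loss is infinite for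
    p >= 0, as are the Riesz kernel for p > 0 and the logarithmic kernel, while
    for p < 0 the formula for powLoss has the right limit there. *)
Definition riesz_dist p d : \bar R :=
  if (0 < p) && (d == 0) then +oo%E else (d `^ (- p))%:E.
Definition log_dist d : \bar R := if d == 0 then +oo%E else (ln d^-1)%:E.
Definition loss_dist p r d : \bar R :=
  if (0 <= p) && (d == 0) then +oo%E else (powLoss p (d / r))%:E.

Lemma measurable_powLoss p : measurable_fun [set: R] (powLoss p).
Proof.
rewrite /powLoss; case: eqP => _.
  exact: (measurableT_comp (@oppr_measurable _ _) (@measurable_ln R)).
by apply: measurable_funM => //; apply: measurable_funB.
Qed.

Lemma measurable_if0 (b : bool) (f : R -> R) : measurable_fun [set: R] f ->
  measurable_fun [set: R] (fun d => if b && (d == 0) then +oo%E else (f d)%:E).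
Proof.
move=> mf; have mf' : measurable_fun [set: R] (fun d => (f d)%:E).
  exact/measurable_EFinP.
case: b => //=; apply: measurable_fun_ifT => //.
exact: measurable_fun_eqr.
Qed.

Lemma measurable_riesz_dist p : measurable_fun [set: R] (riesz_dist p).
Proof. by apply: measurable_if0; exact: measurable_powR. Qed.

Lemma measurable_log_dist : measurable_fun [set: R] log_dist.
Proof.
rewrite (_ : log_dist =
    (fun d => if true && (d == 0) then +oo%E else (- ln d)%:E)).
  apply: measurable_if0.
  exact: (measurableT_comp (@oppr_measurable _ _) (@measurable_ln R)).
apply/funext => d; rewrite /log_dist /=; case: eqVneq => // d0.
case: (ltP 0 d) => [d1|d1]; first by rewrite lnV ?posrE.
by rewrite !ln0 ?oppr0// invr_le0.
Qed.

Lemma measurable_loss_dist p r : measurable_fun [set: R] (loss_dist p r).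
Proof.
apply: measurable_if0.
apply: (measurableT_comp (measurable_powLoss p)); exact: measurable_funM.
Qed.

Lemma loss_dist_riesz p r d : 0 < p -> 0 < r -> 0 <= d ->
  loss_dist p r d = ((r `^ p / p)%:E * riesz_dist p d + (- p^-1)%:E)%E.
Proof.
move=> p0 r0 d0; rewrite /loss_dist /riesz_dist p0 (ltW p0) /=.
case: eqVneq => [_|d1]; first by rewrite gt0_muley ?lte_fin ?divr_gt0 ?powR_gt0.
rewrite -EFinM -EFinD /powLoss gt_eqF// powRM ?invr_ge0 ?(ltW r0)//.
rewrite [r^-1 `^ _](_ : _ = r `^ p); last first.
  by rewrite -powR_inv1 ?(ltW r0)// -powRrM mulrNN mul1r.
congr EFin; field; exact: lt0r_neq0.
Qed.

Lemma loss_dist_rieszN p r d : p < 0 -> 0 < r -> 0 <= d ->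
  loss_dist p r d = ((- p^-1)%:E - (r `^ p / - p)%:E * riesz_dist p d)%E.
Proof.
move=> p0 r0 d0; rewrite /loss_dist /riesz_dist leNgt p0 /= ltNge (ltW p0) /=.
rewrite -EFinD /powLoss lt_eqF// powRM ?invr_ge0 ?(ltW r0)//.
rewrite [r^-1 `^ _](_ : _ = r `^ p); last first.
  by rewrite -powR_inv1 ?(ltW r0)// -powRrM mulrNN mul1r.
congr EFin; field; exact: ltr0_neq0.
Qed.

Lemma loss_dist_log r d : 0 < r -> 0 <= d ->
  loss_dist 0 r d = (1%:E * log_dist d + (ln r)%:E)%E.
Proof.
move=> r0; rewrite le_eqVlt => /predU1P[<-|d0].
  by rewrite /loss_dist /log_dist lexx eqxx mul1e.
rewrite /loss_dist /log_dist lexx gt_eqF// mul1e -EFinD /powLoss eqxx.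
by rewrite lnM ?posrE ?invr_gt0// !lnV ?posrE// opprD opprK.
Qed.

Lemma loss_dist_ge p r d M : 0 < r -> 0 <= d <= M -> 0 < M ->
  ((powLoss p (M / r))%:E <= loss_dist p r d)%E.
Proof.
move=> r0 /andP[d0 dM] M0; rewrite /loss_dist; case: ifPn => [_|]; first exact: leey.
rewrite negb_and -ltNge => pd; rewrite lee_fin; apply: powLoss_nincr.
- by rewrite divr_ge0// ltW.
- move=> /eqP; rewrite mulf_eq0 invr_eq0 (gt_eqF r0) orbF => d1.
  by move: pd; rewrite d1 orbF.
- by rewrite divr_gt0.
- by rewrite ler_pM2r ?invr_gt0.
Qed.

Lemma log_dist_ge d M : 0 <= d <= M -> 0 < M -> ((- ln M)%:E <= log_dist d)%E.
Proof.
move=> /andP[d0 dM] M0; have := @loss_dist_ge 0 1 d M ltr01.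
rewrite d0 dM loss_dist_log// ln1 adde0 mul1e divr1 /powLoss eqxx; exact.
Qed.

Lemma riesz_dist_ge0 p d : (0 <= riesz_dist p d)%E.
Proof. by rewrite /riesz_dist; case: ifP => // _; rewrite lee_fin powR_ge0. Qed.

(** One integral over the product, instead of the iterated integrals of the
    energy, so that a relation between kernels and losses is integrated only
    once. *)
Definition mean_dist (g : R -> \bar R) K mu : \bar R :=
  (\int[mu \x mu]_(z in K `*` K) g (enorm (z.1 - z.2)))%E.

Lemma measurable_fun_dist (g : R -> \bar R) : measurable_fun [set: R] g ->
  measurable_fun [set: T * T] (fun z : T * T => g (enorm ((z.1 : V) - z.2))).
Proof. by move=> mg; exact: (measurableT_comp mg measurable_dist). Qed.

Lemma prod_prob_on K mu : measurable (K : set T) -> prob_on K mu ->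
  ((mu \x mu)%E (K `*` K) = 1)%E.
Proof.
by move=> mK muK; rewrite product_measure1E// -[RHS]mule1; congr (_ * _)%E; exact: muK.
Qed.

(** Tonelli's theorem applies after a shift, since g is bounded below on K. *)
Lemma energy_mean_dist (g : R -> \bar R) K mu (B : R) :
  measurable (K : set T) -> prob_on K mu -> measurable_fun [set: R] g ->
  (forall x y, K x -> K y -> ((- B)%:E <= g (enorm (x - y)))%E) ->
  energy (fun x y => g (enorm (x - y))) K mu = mean_dist g K mu.
Proof.
move=> mK muK mg gB; pose h (z : T * T) := (g (enorm ((z.1 : V) - z.2)) + B%:E)%E.
have mg' := measurable_fun_dist mg.
have mh : measurable_fun setT h by exact: emeasurable_funD.
have h0 x y : K x -> K y -> (0 <= h (x, y))%E.
  by move=> Kx Ky; have := gB _ _ Kx Ky; rewrite /h EFinN -leeBlDr// sub0e.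
have mD : measurable (K `*` K : set (T * T)) by exact: measurableX.
have gE (z : T * T) : g (enorm ((z.1 : V) - z.2)) = (h z - B%:E)%E by rewrite /h addeK.
pose h' : T * T -> \bar R := h \_ ((K : set T) `*` (K : set T)).
have mh' : measurable_fun setT h'.
  by apply/(measurable_restrictT _ _).1 => //; exact: measurable_funTS.
have h'0 z : (0 <= h' z)%E.
  by rewrite /h' /patch; case: ifPn => //; case: z => x y; rewrite inE => -[]; exact: h0.
have inner x : K x -> (\int[mu]_(y in K) h (x, y) = fubini_F mu h' x)%E.
  move=> Kx; rewrite integral_mkcond; apply: eq_integral => y _.
  have xK : x \in (K : set T) by rewrite inE.
  by rewrite /h' /patch in_setX /= xK.
rewrite /mean_dist; under eq_integral do rewrite gE.
rewrite (ge0_integralB_cst mD (prod_prob_on mK muK)); last 2 first.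
- exact: measurable_funTS.
- by move=> [x y] [/= Kx Ky]; exact: h0.
rewrite integral_setX// /energy -(ge0_integralB_cst mK muK); last 2 first.
- apply: (eq_measurable_fun (fubini_F mu h')).
    by move=> x /[!inE] Kx; rewrite inner.
  by apply: measurable_funTS; exact: measurable_fun_fubini_tonelli_F.
- by move=> x Kx; apply: integral_ge0 => y Ky; exact: h0.
apply: eq_integral => x /[!inE] Kx; rewrite -(ge0_integralB_cst mK muK)//.
- by apply: eq_integral => y _; rewrite -gE.
- apply: measurable_funTS; exact: (measurableT_comp mh (pair1_measurable x)).
- by move=> y Ky; exact: h0.
Qed.

Lemma riesz_kernel_dist p :
  @riesz_kernel R n p = (fun x y => riesz_dist p (enorm (x - y))).
Proof.
by apply/funext => x; apply/funext => y; rewrite /riesz_kernel /riesz_dist enorm_eq0 subr_eq0.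
Qed.

Lemma log_kernel_dist : @log_kernel R n = (fun x y => log_dist (enorm (x - y))).
Proof.
by apply/funext => x; apply/funext => y; rewrite /log_kernel /log_dist enorm_eq0 subr_eq0.
Qed.

End Energies.

Section CapacityByLoss.
Context {R : realType} {n : nat}.
Local Notation V := 'rV[R]_n.
Local Notation T := (borel_rV R n).
Implicit Types (p q r : R) (mu : probability T R).
Variables (K : set V) (M : R).
Hypotheses (mK : measurable (K : set T)) (M0 : 0 < M).
Hypothesis KM : forall x y, K x -> K y -> enorm (x - y) <= M.

Let mKK : measurable ((K : set T) `*` (K : set T)).
Proof. exact: measurableX. Qed.

Let dist_itv (z : V * V) : (K `*` K) z -> 0 <= enorm (z.1 - z.2) <= M.
Proof. by move=> [K1 K2]; rewrite enorm_ge0 KM. Qed.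

Let mdist (g : R -> \bar R) : measurable_fun [set: R] g ->
  measurable_fun ((K : set T) `*` (K : set T))
    (fun z : T * T => g (enorm ((z.1 : V) - z.2))).
Proof. by move=> mg; apply: measurable_funTS; apply: measurable_fun_dist. Qed.

Let mean_loss p r mu := mean_dist (loss_dist p r) K mu.
Let mean_riesz p mu := mean_dist (riesz_dist p) K mu.

Lemma mean_riesz_ge0 p mu : (0 <= mean_riesz p mu)%E.
Proof. by apply: integral_ge0 => z _; exact: riesz_dist_ge0. Qed.

Lemma mean_lossP p r mu : prob_on K mu -> 0 < p -> 0 < r ->
  mean_loss p r mu = ((r `^ p / p)%:E * mean_riesz p mu + (- p^-1)%:E)%E.
Proof.
move=> muK p0 r0.
rewrite -(integral_affine mKK (prod_prob_on mK muK) (B := 0))//; last 3 first.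
- exact: mdist (measurable_riesz_dist _).
- by move=> z _; rewrite oppr0 riesz_dist_ge0.
- by rewrite divr_ge0 ?powR_ge0 ?ltW.
by apply: eq_integral => z _; rewrite loss_dist_riesz ?enorm_ge0.
Qed.

Lemma mean_loss0 r mu : prob_on K mu -> 0 < r ->
  mean_loss 0 r mu = (mean_dist log_dist K mu + (ln r)%:E)%E.
Proof.
move=> muK r0; rewrite -[X in (X + _)%E]mul1e.
rewrite -(integral_affine mKK (prod_prob_on mK muK) (B := ln M))//; last 2 first.
- exact: mdist measurable_log_dist.
- by move=> z /dist_itv zM; exact: log_dist_ge.
by apply: eq_integral => z _; rewrite loss_dist_log ?enorm_ge0.
Qed.

Lemma measurable_mean_loss p r :
  measurable_fun ((K : set T) `*` (K : set T))
    (fun z : T * T => loss_dist p r (enorm ((z.1 : V) - z.2))).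
Proof.
exact: mdist (measurable_loss_dist _ _).
Qed.

Lemma mean_loss_ge p r z : 0 < r -> (K `*` K) z ->
  ((- - powLoss p (M / r))%:E <= loss_dist p r (enorm (z.1 - z.2)))%E.
Proof. by move=> r0 /dist_itv zM; rewrite opprK; exact: loss_dist_ge. Qed.

(** For negative p loss and kernel have a constant positive combination; after
    a shift the three functions are nonnegative. *)
Lemma mean_lossN p r mu : prob_on K mu -> p < 0 -> 0 < r ->
  exists2 e, mean_riesz p mu = e%:E & 0 <= e <= M `^ (- p) /\
  mean_loss p r mu = (- p^-1 - r `^ p / - p * e)%:E.
Proof.
move=> muK p0 r0; have PK := prod_prob_on mK muK.
have c0 : 0 < r `^ p / - p by rewrite divr_gt0 ?powR_gt0 ?oppr_gt0.
have E0 := mean_riesz_ge0 p mu.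
have EM : (mean_riesz p mu <= (M `^ (- p))%:E)%E.
  rewrite -(integral_cst1 mKK PK); apply: ge0_le_integral => //.
  - by move=> z _; exact: riesz_dist_ge0.
  - exact: mdist (measurable_riesz_dist _).
  move=> z /dist_itv /andP[d0 dM]; rewrite /riesz_dist ltNge (ltW p0) /= lee_fin.
  by rewrite ge0_ler_powR ?nnegrE ?oppr_ge0 ?(ltW p0) ?(ltW M0).
have sum : ((r `^ p / - p)%:E * mean_riesz p mu +
    (mean_loss p r mu + (- powLoss p (M / r))%:E) =
    (- p^-1 - powLoss p (M / r))%:E)%E.
  rewrite -[X in (_ + (X + _))%E]mul1e.
  rewrite -(integral_affine mKK PK (- powLoss p (M / r)) (measurable_mean_loss p r)
    (fun z Kz => mean_loss_ge p r0 Kz))//.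
  rewrite -ge0_integralZl ?lee_fin ?(ltW c0)//; last 2 first.
  - exact: mdist (measurable_riesz_dist _).
  - by move=> z _; exact: riesz_dist_ge0.
  rewrite -ge0_integralD//; last 4 first.
  - by move=> z _; rewrite mule_ge0 ?riesz_dist_ge0 ?lee_fin ?(ltW c0).
  - apply: measurable_funeM; exact: mdist (measurable_riesz_dist _).
  - move=> z Kz; rewrite mul1e; have := mean_loss_ge p r0 Kz.
    by rewrite EFinN -leeBlDr// sub0e.
  - by apply: emeasurable_funD => //; apply: measurable_funeM; exact: measurable_mean_loss.
  rewrite -[RHS](integral_cst1 mKK PK); apply: eq_integral => z _.
  rewrite mul1e loss_dist_rieszN ?enorm_ge0// /riesz_dist ltNge (ltW p0) /=.
  by rewrite -!EFinM -!EFinD; congr EFin; ring.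
move: sum E0 EM; case: (mean_riesz p mu) => [e| |]//.
rewrite !lee_fin => + e0 eM; exists e => //; split; first by rewrite e0.
move: sum; case: (mean_loss p r mu) => [l| |]//=.
by rewrite -!EFinM -!EFinD => -[H]; congr EFin; lra.
Qed.

Lemma riesz_energyP p : 0 < p ->
  riesz_energy p K = ereal_inf [set mean_riesz p mu | mu in prob_on K].
Proof.
move=> p0; rewrite /riesz_energy p0; congr ereal_inf.
rewrite riesz_kernel_dist; apply: eq_imagel => mu muK.
apply: (@energy_mean_dist _ _ _ _ _ 0) => //; first exact: measurable_riesz_dist.
by move=> x y _ _; rewrite oppr0 riesz_dist_ge0.
Qed.

Lemma riesz_energyN p : K !=set0 -> p < 0 ->
  riesz_energy p K = ereal_sup [set mean_riesz p mu | mu in prob_on K].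
Proof.
move=> K0 p0; rewrite /riesz_energy ltNge (ltW p0) /= ifF; last first.
  by apply/negbTE/set0P.
congr ereal_sup; rewrite riesz_kernel_dist; apply: eq_imagel => mu muK.
apply: (@energy_mean_dist _ _ _ _ _ 0) => //; first exact: measurable_riesz_dist.
by move=> x y _ _; rewrite oppr0 riesz_dist_ge0.
Qed.

Lemma log_energyE :
  log_energy K = ereal_inf [set mean_dist log_dist K mu | mu in prob_on K].
Proof.
rewrite /log_energy; congr ereal_inf.
rewrite log_kernel_dist; apply: eq_imagel => mu muK.
apply: (@energy_mean_dist _ _ _ _ _ (ln M)) => //; first exact: measurable_log_dist.
by move=> x y Kx Ky; apply: log_dist_ge => //; rewrite enorm_ge0 KM.
Qed.

Lemma mean_riesz_ge p mu : prob_on K mu -> 0 < p ->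
  ((M `^ (- p))%:E <= mean_riesz p mu)%E.
Proof.
move=> muK p0; rewrite -(integral_cst1 mKK (prod_prob_on mK muK)).
apply: ge0_le_integral => //.
- by move=> z _; rewrite lee_fin powR_ge0.
- exact: mdist (measurable_riesz_dist _).
move=> z /dist_itv /andP[d0 dM]; rewrite /riesz_dist p0 /=.
case: eqVneq => [_|d1]; first exact: leey.
have {}d0 : 0 < enorm (z.1 - z.2) by rewrite lt_neqAle eq_sym d1.
by rewrite lee_fin !powRN lef_pV2 ?posrE ?powR_gt0// ge0_ler_powR ?nnegrE ?(ltW p0) ?(ltW d0) ?(ltW M0).
Qed.

Lemma mean_log_ge mu : prob_on K mu -> ((- ln M)%:E <= mean_dist log_dist K mu)%E.
Proof.
move=> muK; have := mean_loss0 muK ltr01; rewrite ln1 adde0 => <-.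
have PK := prod_prob_on mK muK.
have lb z : (K `*` K) z -> ((- ln M)%:E <= loss_dist 0 1 (enorm (z.1 - z.2)))%E.
  by move=> Kz; have := mean_loss_ge 0 ltr01 Kz; rewrite opprK divr1 /powLoss eqxx.
have := integral_affine mKK PK (a := 1) (ln M) (measurable_mean_loss 0 1) lb ler01.
rewrite mul1e => H; rewrite EFinN -[X in (X <= _)%E]sub0e leeBlDr// -H.
apply: integral_ge0 => z /lb; rewrite mul1e EFinN -leeBlDr// sub0e; exact.
Qed.

Lemma dirac_prob_on x : K x -> prob_on K (@dirac _ T x R).
Proof. by move=> Kx; rewrite /prob_on /= diracE mem_set. Qed.

(** For p < 0 a negative mean loss asks for a large energy, for p > 0 for a small
    one: in both cases the energy is on the side of r^(-p) that puts the
    capacity above r. *)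
Lemma mean_lossN_lt0 p r mu : prob_on K mu -> p < 0 -> 0 < r ->
  (mean_loss p r mu < 0)%E = ((r `^ (- p))%:E < mean_riesz p mu)%E.
Proof.
move=> muK p0 r0; have [e -> [eM ->]] := mean_lossN muK p0 r0.
have a0 : 0 < r `^ p by rewrite powR_gt0.
rewrite !lte_fin powRN -[X in X < e]mulr1 ltr_pdivrMl// -[RHS]subr_lt0.
rewrite (_ : - p^-1 - _ = (1 - r `^ p * e) / - p); last by field; rewrite lt_eqF.
by rewrite pmulr_llt0 ?invr_gt0 ?oppr_gt0.
Qed.

Lemma mean_lossP_lt0 p r mu : prob_on K mu -> 0 < p -> 0 < r ->
  (mean_loss p r mu < 0)%E = (mean_riesz p mu < (r `^ (- p))%:E)%E.
Proof.
move=> muK p0 r0; rewrite mean_lossP//; have a0 : 0 < r `^ p by rewrite powR_gt0.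
have := mean_riesz_ge0 p mu; case: (mean_riesz p mu) => [e _| _|]//; last first.
  by rewrite gt0_muley ?lte_fin ?divr_gt0.
rewrite -EFinM -EFinD !lte_fin powRN -[X in e < X]mulr1 ltr_pdivlMl// -[RHS]subr_lt0.
rewrite (_ : _ - p^-1 = (r `^ p * e - 1) / p); last by field; rewrite gt_eqF.
by rewrite pmulr_llt0 ?invr_gt0.
Qed.

Lemma lt_capacity_lossN p r : K !=set0 -> p < 0 -> 0 < r ->
  r < riesz_capacity p K <-> exists2 mu, prob_on K mu & (mean_loss p r mu < 0)%E.
Proof.
move=> K0 p0 r0; rewrite /riesz_capacity lt_eqF// riesz_energyN//.
have lossE mu muK := @mean_lossN_lt0 p r mu muK p0 r0.
set S := [set _ | _ in _].
have leM : (ereal_sup S <= (M `^ (- p))%:E)%E.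
  apply: ge_ereal_sup => _ [mu muK <-].
  by have [e -> [/andP[_ eM] _]] := mean_lossN muK p0 r0; rewrite lee_fin.
have ge0 : (0 <= ereal_sup S)%E.
  have [x Kx] := K0; apply: le_trans (mean_riesz_ge0 p (@dirac _ T x R)) _.
  by apply: ereal_sup_ubound; exists (@dirac _ T x R) => //; exact: dirac_prob_on.
have [v vE v0] : exists2 v, ereal_sup S = v%:E & 0 <= v.
  by move: leM ge0; case: (ereal_sup S) => [v| |]// _ v0; exists v.
rewrite vE lt_powR_invN// -lte_fin -vE; split.
  by move=> /ereal_sup_gt[_ [mu muK <-] lt]; exists mu; rewrite ?lossE.
move=> [mu muK]; rewrite lossE// => /lt_le_trans; apply.
by apply: ereal_sup_ubound; exists mu.
Qed.

Lemma lt_capacity_lossP p r : 0 < p -> 0 < r ->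
  r < riesz_capacity p K <-> exists2 mu, prob_on K mu & (mean_loss p r mu < 0)%E.
Proof.
move=> p0 r0; rewrite /riesz_capacity gt_eqF// riesz_energyP//.
have lossE mu muK := @mean_lossP_lt0 p r mu muK p0 r0.
set S := [set _ | _ in _].
have leM : ((M `^ (- p))%:E <= ereal_inf S)%E.
  by apply: le_ereal_inf_tmp => _ [mu muK <-]; exact: mean_riesz_ge.
split.
  case vE : (ereal_inf S) leM => [v| |]//; last by rewrite ltNge (ltW r0).
  rewrite lee_fin => vM; have v0 : 0 < v by apply: lt_le_trans vM; exact: powR_gt0.
  rewrite lt_powR_invP// -lte_fin -vE => /ereal_inf_lt[_ [mu muK <-] lt].
  by exists mu; rewrite ?lossE.
move=> [mu muK]; rewrite lossE// => lt.
have : (ereal_inf S < (r `^ (- p))%:E)%E.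
  by apply: le_lt_trans lt; apply: ereal_inf_lbound; exists mu.
case vE : (ereal_inf S) leM => [v| |]//.
rewrite lee_fin lte_fin => vM vr.
by rewrite lt_powR_invP//; apply: lt_le_trans vM; exact: powR_gt0.
Qed.

Lemma lt_capacity_loss0 r : 0 < r ->
  r < riesz_capacity 0 K <-> exists2 mu, prob_on K mu & (mean_loss 0 r mu < 0)%E.
Proof.
move=> r0; rewrite /riesz_capacity eqxx log_energyE.
have lossE mu : prob_on K mu ->
    (mean_loss 0 r mu < 0)%E = (mean_dist log_dist K mu < (- ln r)%:E)%E.
  by move=> muK; rewrite mean_loss0// EFinN -lteBrDr// sub0e.
set S := [set _ | _ in _].
have leM : ((- ln M)%:E <= ereal_inf S)%E.
  by apply: le_ereal_inf_tmp => _ [mu muK <-]; exact: mean_log_ge.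
split.
  case vE : (ereal_inf S) leM => [v| |]//=; last by rewrite ltNge (ltW r0).
  rewrite -[r in r < _]lnK ?posrE// ltr_expR ltrNr -lte_fin -vE => _.
  by move=> /ereal_inf_lt[_ [mu muK <-] lt]; exists mu; rewrite ?lossE.
move=> [mu muK]; rewrite lossE// => lt.
have : (ereal_inf S < (- ln r)%:E)%E.
  by apply: le_lt_trans lt; apply: ereal_inf_lbound; exists mu.
case vE : (ereal_inf S) leM => [v| |]//= _.
by rewrite lte_fin -[r in _ -> r < _]lnK ?posrE// ltr_expR ltrNr.
Qed.

(** One criterion for all p, which makes monotonicity in p a matter of comparing
    losses pointwise. *)
Lemma lt_capacity_loss p r : K !=set0 -> 0 < r ->
  r < riesz_capacity p K <-> exists2 mu, prob_on K mu & (mean_loss p r mu < 0)%E.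
Proof.
move=> K0 r0; have [p0|p0|->] := ltgtP p 0.
- exact: lt_capacity_lossN.
- exact: lt_capacity_lossP.
- exact: lt_capacity_loss0.
Qed.

Lemma riesz_capacity_ge0 p : 0 <= riesz_capacity p K.
Proof.
rewrite /riesz_capacity; case: ifP => _; first exact/fine_ge0/expeR_ge0.
by case: riesz_energy => // v; exact: powR_ge0.
Qed.

End CapacityByLoss.

(** * Monotonicity in the exponent *)

Section Monotonicity.
Context {R : realType} {n : nat}.
Local Notation V := 'rV[R]_n.
Local Notation T := (borel_rV R n).
Implicit Types (p q r d e : R) (mu : probability T R).

Lemma loss_dist_le p q r d : p <= q -> 0 < r -> 0 <= d ->
  (loss_dist p r d <= loss_dist q r d)%E.
Proof.
move=> pq r0 d0; rewrite /loss_dist; case: ifPn => [/andP[p0 ->]|pd].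
  by rewrite (le_trans p0 pq).
case: ifPn => [_|]; first exact: leey.
rewrite negb_and -ltNge => qd; rewrite lee_fin powLoss_le// ?divr_ge0// ?(ltW r0)//.
move=> /eqP; rewrite mulf_eq0 invr_eq0 (gt_eqF r0) orbF => d1.
by move: qd; rewrite d1 orbF.
Qed.

Lemma loss_dist_gap p q : p < q -> exists2 e, 0 < e & forall r d, 0 < r ->
  0 <= d -> d <= r / 2 -> (loss_dist p r d + e%:E <= loss_dist q r d)%E.
Proof.
move=> pq; have [e e0 gap] := powLoss_gap pq; exists e => // r d r0 d0 dr.
rewrite /loss_dist; case: ifPn => [/andP[p0 ->]|pd].
  by rewrite (le_trans p0 (ltW pq)).
case: ifPn => [_|]; first exact: leey.
rewrite negb_and -ltNge => qd; rewrite -EFinD lee_fin; apply: gap.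
  rewrite divr_ge0// ?(ltW r0)//=.
  by rewrite ler_pdivrMr// mulrC.
move=> /eqP; rewrite mulf_eq0 invr_eq0 (gt_eqF r0) orbF => d1.
by move: qd; rewrite d1 orbF.
Qed.

Lemma loss_distM p r r' d : 0 < r -> 0 < r' -> 0 <= d ->
  loss_dist p r' d =
  (((r / r') `^ (- p))%:E * loss_dist p r d + (powLoss p (r / r'))%:E)%E.
Proof.
move=> r0 r'0 d0; rewrite /loss_dist.
have rr0 : 0 < r / r' by rewrite divr_gt0.
case: ifPn => [_|]; first by rewrite gt0_muley// lte_fin powR_gt0.
rewrite negb_and -ltNge => pd; rewrite -EFinM -EFinD -powLossM//.
- by congr (powLoss p _)%:E; field; rewrite !gt_eqF.
- by rewrite divr_ge0// ltW.
- move=> /eqP; rewrite mulf_eq0 invr_eq0 (gt_eqF r0) orbF => d1.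
  by move: pd; rewrite d1 orbF.
Qed.

Lemma measurable_dist_le e :
  measurable [set z : T * T | enorm ((z.1 : V) - z.2) <= e].
Proof.
have -> : [set z : T * T | enorm ((z.1 : V) - z.2) <= e] = setT `&`
    (fun z : T * T => enorm ((z.1 : V) - z.2)) @^-1` `]-oo, e]%classic.
  by rewrite setTI; apply/seteqP; split => z /=; rewrite in_itv.
exact: measurable_dist.
Qed.

(** For w = r / Cap_q close to 1 the change of the radius from r to Cap_q costs
    less than the gap e, because the loss is continuous and vanishes at 1. *)
Lemma powLoss_near1 p e : 0 < e ->
  exists2 w, 2^-1 <= w < 1 & powLoss p w < w `^ (- p) * e.
Proof.
move=> e0; pose h u := expR (- p * u) * e - expLoss p u.
have ch : {for 0, continuous h}.
  apply: cvgB; last first.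
    apply: differentiable_continuous; apply/derivable1_diffP.
    exact: (@ex_derive _ _ _ _ _ _ _ (is_derive_expLoss p 0)).
  apply: cvgMl; apply: continuous_comp; last exact: continuous_expR.
  exact: mulrl_continuous.
have h0 : 0 < h 0 by rewrite /h expLoss0 mulr0 expR0 mul1r subr0.
have l2 : 0 < ln (2 : R) by rewrite ln_gt0// ltr1n.
have : \forall u \near 0^'-, [/\ 0 < h u, u < 0 & - ln 2 < u].
  near=> u; split.
  - near: u; apply: cvg_within; exact: cvgr_gt ch _ h0.
  - by [].
  - by near: u; apply: nbhs_left_gt; rewrite oppr_lt0.
case/filter_ex => u [hu u0 u2]; exists (expR u).
  rewrite -[X in _ < X]expR0 ltr_expR u0 andbT.
  by rewrite -[X in X <= _]lnK ?posrE ?invr_gt0// lnV ?posrE// ler_expR ltW.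
rewrite powLossE ?expR_gt0// expRK -subr_gt0.
by rewrite -expRM [u * _]mulrC.
Unshelve. all: by end_near. Qed.

Lemma measure_bigcup_seq_le (mu : {measure set T -> \bar R}) (I : eqType) (s : seq I)
    (B : I -> set T) : (forall i, measurable (B i)) ->
  (mu (\bigcup_(i in [set` s]) B i) <= \sum_(i <- s) mu (B i))%E.
Proof.
move=> mB; elim: s => [|i s IH].
  by rewrite big_nil set_nil bigcup_set0 measure0.
rewrite big_cons; apply: (@le_trans _ _ (mu (B i `|` \bigcup_(j in [set` s]) B j))).
  apply: le_measure; rewrite ?inE.
  - apply: fin_bigcup_measurable => //; exact: finite_seq.
  - apply: measurableU => //; apply: fin_bigcup_measurable => //; exact: finite_seq.
  - move=> x [j /=]; rewrite inE => /predU1P[->|js] Bx; [by left|right].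
    by exists j.
apply: (le_trans (measureU2 _ _ _)) => //.
  by apply: fin_bigcup_measurable => //; exact: finite_seq.
exact: leeD2l.
Qed.

(** Two independent points of K are close to each other with a probability
    bounded below: one of finitely many small sets covering K has mass at
    least 1/N, and both points lie in it with probability at least 1/N^2. *)
Lemma close_pairs (K : set V) e : compact K -> 0 < e ->
  exists2 c, 0 < c & forall mu, prob_on K mu ->
    (c%:E <= (mu \x mu) [set z : T * T |
      (K `*` K) z /\ (enorm ((z.1 : V) - z.2) <= e)%R])%E.
Proof.
move=> cK e0; have mK := compact_borel cK.
(* sup norm balls of radius f have Euclidean diameter at most e *)
pose f := e / (n.+1%:R *+ 2); have f0 : 0 < f by rewrite divr_gt0// mulrn_wgt0.
have := cK; rewrite compact_cover.
move=> /(_ V K (fun x => ball x f)) []; first by move=> x _; exact: ball_open.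
  by move=> x Kx; exists x => //; exact: ballxx.
move=> D _ cov; pose s := finmap.enum_fset D.
pose B (x : V) : set T := K `&` ball x f.
have mB x : measurable (B x).
  by apply: measurableI => //; apply: sub_sigma_algebra; exact: ball_open.
pose N : R := (size s).+1%:R; have N0 : 0 < N by rewrite ltr0n.
exists (N^-1 ^+ 2); first by rewrite exprn_gt0// invr_gt0.
move=> mu muK.
have [x _ Bx] : exists2 x, x \in s & ((N^-1)%:E <= mu (B x))%E.
  apply: contrapT => nex; suff : (mu K < 1)%E by rewrite [X in (X < _)%E]muK ltxx.
  have KB : (K : set T) `<=` \bigcup_(x in [set` s]) B x.
    by move=> x Kx; have [y yD xy] := cov _ Kx; exists y.
  apply: (@le_lt_trans _ _ (\sum_(x <- s) mu (B x))%E).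
    apply: le_trans (measure_bigcup_seq_le mu _ mB).
    apply: le_measure KB; rewrite ?inE//.
    by apply: fin_bigcup_measurable => //; exact: finite_seq.
  apply: (@le_lt_trans _ _ (\sum_(x <- s) (N^-1)%:E)%E).
    rewrite big_seq [leRHS]big_seq; apply: lee_sum => x xD.
    by rewrite leNgt; apply/negP => lt; apply: nex; exists x => //; exact: ltW.
  rewrite sumEFin lte_fin big_const_seq count_predT iter_addr addr0.
  by rewrite -[_ *+ _]mulr_natr ltr_pdivrMl// mulr1 ltr_nat.
apply: (@le_trans _ _ ((mu \x mu) (B x `*` B x))%E).
  rewrite product_measure1E// expr2 EFinM; apply: lee_pmul => //;
  by rewrite lee_fin invr_ge0 ltW.
apply: le_measure; rewrite ?inE.
- exact: measurableX.
- apply: measurableI; first exact: measurableX.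
  exact: measurable_dist_le.
move=> [y z] [/= [Ky [_ xy]] [Kz [_ xz]]]; split => //=.
apply: (@le_trans _ _ (n%:R * (f *+ 2))).
  apply: enorm_le_coord; first by rewrite mulrn_wge0// ltW.
  move=> i; have := xy 0 i; have := xz 0 i; rewrite /ball /= !mxE => h1 h2.
  rewrite (_ : y 0 i - z 0 i = (x 0 i - z 0 i) - (x 0 i - y 0 i)); last by ring.
  by rewrite (le_trans (ler_normB _ _))// mulr2n lerD// ltW.
rewrite /f mulrnAr -mulrnAl mulrA ler_pdivrMr ?mulrn_wgt0// mulrC.
by rewrite ler_wpM2l ?(ltW e0)// lerMn2r ler_nat leqnSn orbT.
Qed.

Variable K : set V.
Hypotheses (cK : compact K) (K0 : K !=set0).

Let mK : measurable (K : set T) := compact_borel cK.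

Lemma mean_loss_le p q r mu : prob_on K mu -> p <= q -> 0 < r ->
  (mean_dist (loss_dist p r) K mu <= mean_dist (loss_dist q r) K mu)%E.
Proof.
move=> muK pq r0; have [M M0 KM] := compact_dist_bounded cK.
have mKK : measurable ((K : set T) `*` (K : set T)) by exact: measurableX.
have := le_integral_gap mKK (prod_prob_on mK muK)
  (measurable_mean_loss p r) (measurable_mean_loss q r)
  measurable0 (@sub0set _ _) (lexx 0) (fun z Kz => mean_loss_ge M0 KM p r0 Kz).
rewrite measure0 mule0 adde0; apply => // z _; apply: loss_dist_le => //.
exact: enorm_ge0.
Qed.

(** A radius strictly between the two capacities would have a negative mean
    loss for q, hence for p. *)
Lemma riesz_capacity_nincr p q : p <= q -> riesz_capacity q K <= riesz_capacity p K.
Proof.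
move=> pq; have [M M0 KM] := compact_dist_bounded cK.
rewrite leNgt; apply/negP => lt.
pose r := (riesz_capacity p K + riesz_capacity q K) / 2.
have cp0 := riesz_capacity_ge0 K p.
have r0 : 0 < r by rewrite /r; lra.
have /(lt_capacity_loss mK M0 KM q K0 r0)[mu muK lt0] : r < riesz_capacity q K.
  by rewrite /r; lra.
have : r < riesz_capacity p K.
  apply/(lt_capacity_loss mK M0 KM p K0 r0); exists mu => //.
  exact: le_lt_trans (mean_loss_le muK pq r0) lt0.
by rewrite /r; lra.
Qed.

(** Along measures whose q-mean distance is almost r = Cap_q, the gap between
    the losses on close pairs makes the p-loss at r negative by a fixed amount,
    so it is still negative at Cap_q itself. *)
Lemma riesz_capacity_decr p q : 0 < riesz_capacity q K -> p < q ->
  riesz_capacity q K < riesz_capacity p K.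
Proof.
set m := riesz_capacity q K => m0 pq.
have [M M0 KM] := compact_dist_bounded cK.
have mKK : measurable ((K : set T) `*` (K : set T)) by exact: measurableX.
have [e e0 gap] := loss_dist_gap pq.
have m4 : 0 < m / 4 by rewrite divr_gt0.
have [c c0 close] := close_pairs cK m4.
have [r [r0 [rm m2 small]]] : exists r, 0 < r /\ [/\ r < m, m / 2 <= r &
    powLoss p (r / m) < (r / m) `^ (- p) * (e * c)].
  have [w /andP[w2 w1] small] := powLoss_near1 p (mulr_gt0 e0 c0).
  have w0 : 0 < w by apply: lt_le_trans w2; rewrite invr_gt0.
  exists (m * w); rewrite mulr_gt0//; split => //.
  rewrite gtr_pMr// w1 ler_pM2l// w2; split => //.
  by rewrite mulrAC mulfV ?gt_eqF// mul1r.
have /(lt_capacity_loss mK M0 KM q K0 r0)[mu muK lt0] := rm.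
apply/(lt_capacity_loss mK M0 KM p K0 m0); exists mu => //.
have PK := prod_prob_on mK muK.
have lossM : (mean_dist (loss_dist p m) K mu = ((r / m) `^ (- p))%:E *
    mean_dist (loss_dist p r) K mu + (powLoss p (r / m))%:E)%E.
  rewrite -(integral_affine mKK PK _ (measurable_mean_loss p r)
    (fun z Kz => mean_loss_ge M0 KM p r0 Kz)) ?powR_ge0//.
  by apply: eq_integral => z _; apply: loss_distM => //; exact: enorm_ge0.
have gapI : (mean_dist (loss_dist p r) K mu + (e * c)%:E <= mean_dist (loss_dist q r) K mu)%E.
  pose E := [set z : T * T | (K `*` K) z /\ (enorm ((z.1 : V) - z.2) <= m / 4)%R].
  have mE : measurable E.
    by apply: measurableI => //; exact: measurable_dist_le.
  have H := le_integral_gap mKK PK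
    (measurable_mean_loss p r) (measurable_mean_loss q r) mE (fun z Ez => Ez.1)
    (ltW e0) (fun z Kz => mean_loss_ge M0 KM p r0 Kz).
  apply: (le_trans _ (H _ _)).
  - by rewrite leeD2l// EFinM lee_pmul2l ?lte_fin//; exact: close.
  - by move=> z _; apply: loss_dist_le; rewrite ?(ltW pq) ?enorm_ge0.
  - by move=> z [_ zm]; apply: gap; rewrite ?enorm_ge0//; lra.
rewrite lossM; have a0 : 0 < (r / m) `^ (- p) by rewrite powR_gt0// divr_gt0.
have := le_lt_trans gapI lt0.
case: (mean_dist (loss_dist p r) K mu) => [l| |]//=; last first.
  by move=> _; rewrite gt0_muleNy ?lte_fin// ltNyr.
rewrite -!EFinM -!EFinD !lte_fin => lec.
have : (r / m) `^ (- p) * (l + e * c) < 0 by rewrite pmulr_rlt0.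
by rewrite mulrDr; lra.
Qed.

End Monotonicity.

(** * Diameter bounds and capacities of subsets of the line *)

Lemma mnormalizeE d (T : measurableType d) (R : realType)
    (m : {measure set T -> \bar R}) (P : probability T R) (c : R) (A : set T) :
  0 < c -> m setT = c%:E -> (mnormalize m P A = m A * (c^-1)%:E)%E.
Proof. by move=> c0 mT; rewrite /mnormalize mT /= eqe gt_eqF. Qed.

Section Diameter.
Context {R : realType} {n : nat}.
Local Notation V := 'rV[R]_n.
Local Notation T := (borel_rV R n).
Implicit Types (p r d e : R) (mu : probability T R).
Variable K : set V.
Hypotheses (cK : compact K) (K0 : K !=set0).

Let mK : measurable (K : set T) := compact_borel cK.

Lemma dist_le_diam x y : K x -> K y -> enorm (x - y) <= diam K.
Proof.
move=> Kx Ky; have [M M0 KM] := compact_dist_bounded cK.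
apply: ub_le_sup; last by exists x => //; exists y.
by exists M => _ [u Ku [v Kv <-]]; exact: KM.
Qed.

Lemma diam_ge0 : 0 <= diam K.
Proof. by have [x Kx] := K0; have := dist_le_diam Kx Kx; rewrite subrr enorm0. Qed.

Lemma riesz_capacity_le_diam p : riesz_capacity p K <= diam K.
Proof.
have [M M0 KM] := compact_dist_bounded cK.
rewrite leNgt; apply/negP => lt.
pose r := (diam K + riesz_capacity p K) / 2.
have d0 := diam_ge0.
have r0 : 0 < r by rewrite /r; lra.
have rd : diam K <= r by rewrite /r; lra.
have /(lt_capacity_loss mK M0 KM p K0 r0)[mu muK] : r < riesz_capacity p K.
  by rewrite /r; lra.
apply/negP; rewrite -leNgt; apply: integral_ge0 => z [Kz1 Kz2].
have -> : 0%E = (powLoss p (r / r))%:E by rewrite divff ?gt_eqF// powLoss_1.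
by apply: loss_dist_ge; rewrite ?enorm_ge0 ?(le_trans (dist_le_diam _ _)).
Qed.

Lemma borel_set1 (x : V) : measurable ([set x] : set T).
Proof. apply: compact_borel; exact: compact_set1. Qed.

(** The measure with mass 1/2 at x and at y has the energy |x - y|^(-p) / 2. *)
Lemma riesz_capacity_ge_dist p x y : p < 0 -> K x -> K y ->
  2 `^ p^-1 * enorm (x - y) <= riesz_capacity p K.
Proof.
move=> p0 Kx Ky; set d := enorm (x - y).
have [M M0 KM] := compact_dist_bounded cK.
have [d0|d0] := eqVneq d 0; first by rewrite d0 mulr0 riesz_capacity_ge0.
have xy : x != y by move: d0; rewrite /d enorm_eq0 subr_eq0.
have {}d0 : 0 < d by rewrite lt_neqAle eq_sym d0 enorm_ge0.
rewrite leNgt; apply/negP => lt; have c0 := riesz_capacity_ge0 K p.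
pose r := (riesz_capacity p K + 2 `^ p^-1 * d) / 2.
have r0 : 0 < r by rewrite /r; lra.
have rp : r `^ (- p) < 2^-1 * d `^ (- p).
  have -> : 2^-1 * d `^ (- p) = (2 `^ p^-1 * d) `^ (- p).
    rewrite powRM ?powR_ge0 ?(ltW d0)// -powRrM mulrN mulVf ?lt_eqF//.
    by rewrite powR_inv1.
  by rewrite ltr_powR_mono ?oppr_gt0 ?mulr_ge0 ?powR_ge0 ?(ltW d0) ?(ltW r0)// /r; lra.
suff : r < riesz_capacity p K by rewrite /r; lra.
pose m := measure_add (@dirac _ T x R) (@dirac _ T y R).
pose mu : probability T R := mnormalize m (@dirac _ T x R).
have m_sum A : m A = (@dirac _ T x R A + @dirac _ T y R A)%E.
  exact: measure_addE.
have muE A : mu A = ((@dirac _ T x R A + @dirac _ T y R A) * (2^-1)%:E)%E.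
  rewrite -m_sum; apply: mnormalizeE => //.
  by rewrite [LHS]m_sum !diracT -EFinD.
have muK : prob_on K mu.
  rewrite /prob_on /= muE !diracE !mem_set//= -EFinD -EFinM; congr EFin.
  by rewrite mulfV.
apply/(lt_capacity_loss mK M0 KM p K0 r0); exists mu => //.
rewrite (mean_lossN_lt0 mK M0 KM)//.
apply: (@lt_le_trans _ _ (2^-1 * d `^ (- p))%:E); first by rewrite lte_fin.
pose E : set (T * T) := [set x] `*` [set y] `|` [set y] `*` [set x].
have mE : measurable E.
  by apply: measurableU; apply: measurableX; exact: borel_set1.
have mKK : measurable ((K : set T) `*` (K : set T)) by exact: measurableX.
have EK : E `<=` (K `*` K) by move=> z [|] [/= -> ->].
have muE2 : ((mu \x mu) E = (2^-1)%:E)%E.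
  rewrite measureU//; [|by apply: measurableX; exact: borel_set1..|].
    rewrite [LHS](_ : _ = mu [set x] * mu [set y] + mu [set y] * mu [set x])%E; last first.
      by congr (_ + _)%E; apply: product_measure1E; exact: borel_set1.
    have same (a : T) : @dirac _ T a R [set a] = 1%E by rewrite diracE mem_set.
    have other (a b : T) : a != b -> @dirac _ T a R [set b] = 0%E.
      by move=> /eqP ab; rewrite diracE memNset.
    rewrite !muE !same (other x y)// (other y x) 1?eq_sym//.
    by rewrite adde0 add0e !mul1e -!EFinM -!EFinD; congr EFin; field.
  by apply/seteqP; split => // z [[/= -> _] [/= /eqP]]; rewrite (negbTE xy).
have mf : measurable_fun ((K : set T) `*` (K : set T))
    (fun z : T * T => riesz_dist p (enorm ((z.1 : V) - z.2))).
  by apply: measurable_funTS; apply: measurable_fun_dist; exact: measurable_riesz_dist.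
apply: (@le_trans _ _ (\int[mu \x mu]_(z in E) riesz_dist p (enorm ((z.1 : V) - z.2)))%E); last first.
  by apply: ge0_subset_integral => // z _; exact: riesz_dist_ge0.
rewrite mulrC EFinM -muE2 -integral_cst//.
apply: ge0_le_integral => //.
- by move=> z _; rewrite lee_fin powR_ge0.
- exact: measurable_funS mf.
- move=> z Ez; rewrite /riesz_dist ltNge (ltW p0) /= lee_fin.
  have -> : enorm (z.1 - z.2) = d by case: Ez => -[/= -> ->]; rewrite // enormC.
  exact: lexx.
Qed.

Lemma riesz_capacity_ge_diam p : p < 0 -> 2 `^ p^-1 * diam K <= riesz_capacity p K.
Proof.
move=> p0; have t0 : 0 < (2 : R) `^ p^-1 by rewrite powR_gt0.
rewrite -ler_pdivlMl//; apply: ge_sup.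
  by have [x Kx] := K0; exists (enorm (x - x)); exists x => //; exists x.
move=> _ [x Kx [y Ky <-]]; rewrite ler_pdivlMl//.
exact: riesz_capacity_ge_dist.
Qed.

(** 2^(1/p) tends to 1, with 1 - 2^(1/p) <= - ln 2 / p. *)
Lemma cvg_riesz_capacity_diam : riesz_capacity p K @[p --> -oo] --> diam K.
Proof.
apply/cvgrPdist_le => e e0; have d0 := diam_ge0.
have l2 : 0 < ln (2 : R) by rewrite ln_gt0// ltr1n.
near=> p.
have p0 : p < 0 by near: p; exact: nbhs_ninfty_lt.
have pe : diam K * ln 2 / e <= - p.
  by rewrite lerNr; near: p; apply: nbhs_ninfty_le; exact: num_real.
rewrite ger0_norm ?subr_ge0 ?riesz_capacity_le_diam//.
have := riesz_capacity_ge_diam p0.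
have : 1 + p^-1 * ln 2 <= 2 `^ p^-1 by rewrite /powR gt_eqF// expR_ge1Dx.
move=> /(ler_wpM2r d0) h1 h2.
have : diam K * ln 2 / (- p) <= e.
  by rewrite ler_pdivrMr ?oppr_gt0// [e * _]mulrC -ler_pdivrMr.
have -> : diam K * ln 2 / - p = - (p^-1 * ln 2 * diam K).
  by field; rewrite lt_eqF.
move: h1; rewrite mulrDl mul1r; lra.
Unshelve. all: by end_near. Qed.

(** On the line every |u - v|^s with s >= 1 and u, v in [0, 1] is at most
    u (1 - v) + (1 - u) v, whose mean is 2 m (1 - m) <= 1/2 for the mean m. *)
Lemma dist_powR_le_affine (s u v : R) : 1 <= s -> 0 <= u <= 1 -> 0 <= v <= 1 ->
  `|u - v| `^ s <= u * (1 - v) + (1 - u) * v.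
Proof.
move=> s1 /andP[u0 u1] /andP[v0 v1].
have d1 : `|u - v| <= 1 by rewrite ler_norml; apply/andP; split; lra.
apply: (@le_trans _ _ `|u - v|).
  have [d0|d0] := eqVneq `|u - v| 0.
    by rewrite d0 powR0// gt_eqF// (lt_le_trans ltr01).
  rewrite -[leRHS]powRr1//; apply: ger_powR => //.
  by rewrite lt_neqAle eq_sym d0 normr_ge0.
by rewrite ler_norml; apply/andP; split; nra.
Qed.

(** The coordinate normalised to [0, 1] is u; the affine majorant of the kernel
    is a sum of two products, so its double integral factors. *)
Lemma mean_riesz_line p mu (f : V -> R) : prob_on K mu -> p <= -1 ->
  measurable_fun [set: T] (f : T -> R) -> (forall x, K x -> 0 <= f x <= diam K) ->
  (forall x y, enorm (x - y) = `|f x - f y|) -> 0 < diam K ->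
  (mean_dist (riesz_dist p) K mu <= (2^-1 * diam K `^ (- p))%:E)%E.
Proof.
move=> muK p1 mf f01 fdist L0; set L := diam K in f01 L0 *.
have p0 : p < 0 by apply: le_lt_trans p1 _; rewrite oppr_lt0.
pose u x := f x / L.
have u01 x : K x -> 0 <= u x <= 1.
  by move=> /f01 /andP[f0 fL]; rewrite divr_ge0 ?(ltW L0)//= ler_pdivrMr// mul1r.
have fE x : f x = L * u x by rewrite /u mulrC divfK ?gt_eqF.
have mu_ : measurable_fun [set: T] (u : T -> R) by exact: measurable_funM.
have mu1 : measurable_fun [set: T] ((fun x => 1 - u x) : T -> R) by exact: measurable_funB.
clearbody u.
have mKK : measurable ((K : set T) `*` (K : set T)) by exact: measurableX.
have [m [m01 mE mE1]] : exists m, [/\ 0 <= m <= 1, (\int[mu]_(x in K) (u x)%:E = m%:E)%E &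
    (\int[mu]_(x in K) (1 - u x)%:E = (1 - m)%:E)%E].
  have i0 : (0 <= \int[mu]_(x in K) (u x)%:E)%E.
    by apply: integral_ge0 => x /u01 /andP[? _]; rewrite lee_fin.
  have i1 : (0 <= \int[mu]_(x in K) (1 - u x)%:E)%E.
    by apply: integral_ge0 => x /u01 /andP[_ ?]; rewrite lee_fin subr_ge0.
  have : (\int[mu]_(x in K) (u x)%:E + \int[mu]_(x in K) (1 - u x)%:E = 1)%E.
    rewrite -ge0_integralD//.
    - rewrite -(integral_cst1 mK muK); apply: eq_integral => x _.
      by rewrite -EFinD addrC subrK.
    - by move=> x /u01 /andP[? _]; rewrite lee_fin.
    - by apply: measurable_funTS; exact/measurable_EFinP.
    - by move=> x /u01 /andP[_ ?]; rewrite lee_fin subr_ge0.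
    - by apply: measurable_funTS; exact/measurable_EFinP.
  move: i0 i1; case: (\int[mu]_(x in K) (u x)%:E)%E => [a| |];
    case: (\int[mu]_(x in K) (1 - u x)%:E)%E => [b| |]//.
  rewrite !lee_fin => a0 b0 [ab]; exists a; split => //; first by lra.
  by congr EFin; lra.
pose h (z : T * T) := ((L `^ (- p))%:E * (u z.1 * (1 - u z.2) + (1 - u z.1) * u z.2)%:E)%E.
have mh : measurable_fun setT h.
  apply: measurable_funeM; apply/measurable_EFinP; apply: measurable_funD;
    apply: measurable_funM.
  - exact: (measurableT_comp mu_ measurable_fst).
  - exact: (measurableT_comp mu1 measurable_snd).
  - exact: (measurableT_comp mu1 measurable_fst).
  - exact: (measurableT_comp mu_ measurable_snd).
have h0 x y : K x -> K y -> (0 <= h (x, y))%E.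
  move=> /u01 /andP[? ?] /u01 /andP[? ?]; rewrite /h -EFinM lee_fin mulr_ge0 ?powR_ge0//=.
  by rewrite addr_ge0// mulr_ge0// subr_ge0.
apply: (@le_trans _ _ (\int[mu \x mu]_(z in K `*` K) h z)%E).
  apply: ge0_le_integral => //.
  - by move=> z _; exact: riesz_dist_ge0.
  - by apply: measurable_funTS; apply: measurable_fun_dist; exact: measurable_riesz_dist.
  - exact: measurable_funTS.
  move=> z [/= Kz1 Kz2]; rewrite /riesz_dist ltNge (ltW p0) /= /h -EFinM lee_fin.
  rewrite fdist (_ : f z.1 - f z.2 = L * (u z.1 - u z.2)); last first.
    by rewrite !fE mulrBr.
  rewrite normrM powRM// gtr0_norm// ler_wpM2l ?powR_ge0//.
  by apply: dist_powR_le_affine; rewrite ?u01//; lra.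
rewrite integral_setX//.
have inner x : K x -> (\int[mu]_(y in K) h (x, y) =
    (L `^ (- p) * (1 - m))%:E * (u x)%:E + (L `^ (- p) * m)%:E * (1 - u x)%:E)%E.
  move=> Kx; have /andP[ux0 ux1] := u01 _ Kx.
  rewrite /h ge0_integralZl_EFin ?powR_ge0//; last 2 first.
  - move=> y /u01 /andP[? ?]; rewrite lee_fin /=.
    by rewrite addr_ge0// mulr_ge0// subr_ge0.
  - apply: measurable_funTS; apply/measurable_EFinP => /=.
    by apply: measurable_funD; apply: measurable_funM.
  under eq_integral do rewrite EFinD !EFinM /=.
  rewrite ge0_integralD//; first last.
  - by apply: measurable_funTS; apply: measurable_funeM; exact/measurable_EFinP.
  - by move=> y /u01 /andP[? ?]; rewrite -EFinM lee_fin mulr_ge0// subr_ge0.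
  - by apply: measurable_funTS; apply: measurable_funeM; exact/measurable_EFinP.
  - by move=> y /u01 /andP[? ?]; rewrite -EFinM lee_fin mulr_ge0// subr_ge0.
  rewrite !ge0_integralZl_EFin ?subr_ge0//; first last.
  - by apply: measurable_funTS; exact/measurable_EFinP.
  - by move=> y /u01 /andP[? ?]; rewrite lee_fin ?subr_ge0.
  - by apply: measurable_funTS; exact/measurable_EFinP.
  - by move=> y /u01 /andP[? ?]; rewrite lee_fin ?subr_ge0.
  by rewrite mE mE1 -!(EFinM, EFinD); congr EFin; ring.
have /andP[m0 m1] := m01.
rewrite (eq_integral (fun x : T => (L `^ (- p) * (1 - m))%:E * (u x)%:E +
    (L `^ (- p) * m)%:E * (1 - u x)%:E)%E); last by move=> x /[!inE]; exact: inner.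
rewrite ge0_integralD//; first last.
- by apply: measurable_funTS; apply: measurable_funeM; exact/measurable_EFinP.
- by move=> y /u01 /andP[? ?]; rewrite -EFinM lee_fin !mulr_ge0 ?powR_ge0// subr_ge0.
- by apply: measurable_funTS; apply: measurable_funeM; exact/measurable_EFinP.
- by move=> y /u01 /andP[? ?]; rewrite -EFinM lee_fin !mulr_ge0 ?powR_ge0// subr_ge0.
rewrite !ge0_integralZl_EFin ?mulr_ge0 ?powR_ge0 ?subr_ge0//; first last.
- by apply: measurable_funTS; exact/measurable_EFinP.
- by move=> y /u01 /andP[? ?]; rewrite lee_fin ?subr_ge0.
- by apply: measurable_funTS; exact/measurable_EFinP.
- by move=> y /u01 /andP[? ?]; rewrite lee_fin ?subr_ge0.
rewrite mE mE1 -!EFinM -!EFinD lee_fin.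
rewrite (_ : _ + _ = L `^ (- p) * (2 * (m * (1 - m)))); last by ring.
rewrite [leRHS]mulrC ler_wpM2l ?powR_ge0//.
by have := sqr_ge0 (2 * m - 1); rewrite expr2; nra.
Qed.

End Diameter.

Section Line.
Context {R : realType}.
Local Notation V := 'rV[R]_1.
Variable K : set V.
Hypotheses (cK : compact K) (K0 : K !=set0).

(** The normalised coordinate is (x - inf K) / diam K. *)
Lemma riesz_capacity_line (p : R) : p <= -1 ->
  riesz_capacity p K = 2 `^ p^-1 * diam K.
Proof.
move=> p1; have p0 : p < 0 by apply: le_lt_trans p1 _; rewrite oppr_lt0.
have mK := compact_borel cK; have [M M0 KM] := compact_dist_bounded cK.
have c0 := riesz_capacity_ge0 K p.
have t0 : 0 < (2 : R) `^ p^-1 by rewrite powR_gt0.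
apply/eqP; rewrite eq_le riesz_capacity_ge_diam// andbT.
have [L0|L0] := eqVneq (diam K) 0.
  by rewrite L0 mulr0 -L0 riesz_capacity_le_diam.
have {}L0 : 0 < diam K by rewrite lt_neqAle eq_sym L0 diam_ge0.
rewrite leNgt; apply/negP => lt.
pose r := (riesz_capacity p K + 2 `^ p^-1 * diam K) / 2.
have r0 : 0 < r by rewrite /r; have := mulr_gt0 t0 L0; lra.
have /(lt_capacity_loss mK M0 KM p K0 r0)[mu muK] : r < riesz_capacity p K.
  by rewrite /r; lra.
rewrite (mean_lossN_lt0 mK M0 KM)//; apply/negP; rewrite -leNgt.
have edist (x y : V) : enorm (x - y) = `|x 0 0 - y 0 0|.
  by rewrite /enorm big_ord1 sqrtr_sqr !mxE.
pose A := [set (x : V) 0 0 | x in K].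
have Alb x : K x -> lbound A (x 0 0 - diam K).
  move=> Kx _ [y Ky <-]; have := dist_le_diam cK Kx Ky.
  by rewrite edist ler_norml => /andP[_ ?]; lra.
have [x0 Kx0] := K0.
apply: (@le_trans _ _ (2^-1 * diam K `^ (- p))%:E).
  pose f (x : V) := x 0 0 - inf A.
  apply: (@mean_riesz_line _ _ _ cK p mu f) => //.
  - by apply: measurable_funB => //; exact: measurable_coord.
  - move=> x Kx; apply/andP; split.
      rewrite subr_ge0; apply: ge_inf; last by exists x.
      by exists (x0 0 0 - diam K); exact: Alb.
    rewrite lerBlDr -lerBlDl; apply: lb_le_inf; last exact: Alb.
    by exists (x0 0 0), x0.
  - by move=> x y; rewrite edist /f; congr Num.norm; ring.
rewrite lee_fin.
have -> : 2^-1 * diam K `^ (- p) = (2 `^ p^-1 * diam K) `^ (- p).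
  rewrite powRM ?powR_ge0 ?(ltW L0)// -powRrM mulrN mulVf ?lt_eqF//.
  by rewrite powR_inv1.
have tL0 := mulr_gt0 t0 L0.
rewrite ge0_ler_powR ?nnegrE ?oppr_ge0 ?(ltW tL0) ?(ltW r0) ?(ltW p0)//.
by rewrite /r; lra.
Qed.

End Line.

(** * Radial integrals of a power of the distance *)

Section RadialLayers.
Context {R : realType}.
Implicit Types (p l D d : R).

Lemma nneseries_geometric (b z : R) : 0 <= z < 1 ->
  (\sum_(j <oo) (b * z ^+ j)%:E = (b / (1 - z))%:E)%E.
Proof.
move=> /andP[z0 z1]; apply/cvg_lim => //.
have /(_ b z) := @cvg_geometric_series R.
rewrite ger0_norm// => /(_ z1) H.
rewrite (_ : (fun n => _) = EFin \o series (geometric b z)).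
  by apply: cvg_EFin => //; exact: nearW.
by apply/funext => k /=; rewrite sumEFin.
Qed.

Lemma onem_expRN_le l : 1 - expR (- l) <= l.
Proof. by have := expR_ge1Dx (- l); lra. Qed.

Lemma onem_expRN_ge l : l * expR (- l) <= 1 - expR (- l).
Proof.
have := expR_ge1Dx l; rewrite -(ler_pM2r (expR_gt0 (- l))) -expRD subrr expR0.
by rewrite mulrDl mul1r; lra.
Qed.

(** Removes the loss factor exp(k l) of a discretisation of step l. *)
Lemma le_of_expR (I A k : R) : 0 <= A -> 0 < k ->
  (forall l, 0 < l -> I <= A * expR (k * l)) -> I <= A.
Proof.
move=> A0 k0 H; apply/ler_addgt0Pr => e e0.
pose l := ln (1 + e / (A + 1)) / k.
have A1 : 0 < A + 1 by rewrite ltr_pwDr.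
have e1 : 0 < e / (A + 1) by rewrite divr_gt0.
have l0 : 0 < l by rewrite divr_gt0// ln_gt0// ltrDl.
apply: (le_trans (H l l0)); rewrite /l mulrC (mulrC k) divfK ?gt_eqF//.
rewrite lnK ?posrE ?addr_gt0// mulrDl mul1r lerD2l -mulrA ler_piMr ?(ltW e0)//.
by rewrite mulrC ler_pdivrMr// mul1r lerDl.
Qed.

(** The kernel X^(-p) is compared with a step function that changes at the
    radii D q^j, q = exp(-l); layer_weight is the height of its j-th step. The
    integral of a step function only involves measures of balls, and l tends to
    0 at the end. *)
Definition layer_radius D l (j : nat) : R := D * expR (- (j%:R * l)).
Definition layer_weight p l D (j : nat) : R :=
  D `^ (- p) * (expR (l * p) - 1) * expR (l * p) ^+ j.

Lemma sum_layer_weight p l D k :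
  D `^ (- p) + \sum_(j < k) layer_weight p l D j = D `^ (- p) * expR (l * p) ^+ k.
Proof.
elim: k => [|k IH]; first by rewrite big_ord0 addr0 expr0 mulr1.
by rewrite big_ord_recr /= addrA IH /layer_weight exprS; ring.
Qed.

Lemma layer_weight_ge0 p l D j : 0 < p -> 0 < l -> 0 <= layer_weight p l D j.
Proof.
move=> p0 l0; rewrite !mulr_ge0 ?powR_ge0 ?exprn_ge0 ?expR_ge0//.
by rewrite subr_ge0 -expR0 ler_expR mulr_ge0// ltW.
Qed.

(** k is the integer part of ln(D / d) / l. *)
Lemma layer_index p l D d : 0 < p -> 0 < l -> 0 < d <= D -> exists k,
  (forall j, (d <= layer_radius D l j) = (j <= k)%N) /\
  D `^ (- p) * expR (l * p) ^+ k <= d `^ (- p) <= D `^ (- p) * expR (l * p) ^+ k.+1.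
Proof.
move=> p0 l0 /andP[d0 dD]; have D0 := lt_le_trans d0 dD.
pose x := ln (D / d) / l.
have x0 : 0 <= x by rewrite divr_ge0 ?(ltW l0)// ln_ge0// ler_pdivlMr// mul1r.
have /andP[xk kx] := truncn_itv x0; set k := Num.trunc x in xk kx.
have dE : d = D * expR (- (x * l)).
  rewrite /x divfK ?gt_eqF// expRN lnK ?posrE ?divr_gt0// invf_div mulrCA.
  by rewrite divff ?mulr1// gt_eqF.
have powE (y : R) : (D * expR (- (y * l))) `^ (- p) = D `^ (- p) * expR (y * (l * p)).
  by rewrite powRM ?expR_ge0 ?(ltW D0)// -expRM mulNr mulrN opprK mulrA.
exists k; split=> [j|].
  rewrite {1}dE /layer_radius ler_pM2l// ler_expR lerN2 ler_pM2r//.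
  apply/idP/idP => [jx|jk]; last by apply: le_trans xk; rewrite ler_nat.
  by rewrite -ltnS -(ltr_nat R); exact: le_lt_trans jx kx.
have lp0 : 0 < l * p by rewrite mulr_gt0.
rewrite dE powE -!expRM_natl !ler_pM2l ?powR_gt0// !ler_expR !ler_pM2r// xk.
exact: ltW.
Qed.

Context (disp : measure_display) (S : measurableType disp) (nu : {measure set S -> \bar R}).
Variables (E : set S) (X : S -> R) (N : nat) (C D p : R).
Hypotheses (mE : measurable E) (mX : measurable_fun [set: S] X).
Hypotheses (D0 : 0 < D) (XD : forall x, E x -> 0 <= X x <= D).
Hypotheses (C0 : 0 <= C) (p0 : 0 < p) (pN : p < N%:R).

Let A r : set S := E `&` [set x | X x <= r].

Let mA r : measurable (A r).
Proof.
apply: measurableI => //; rewrite (_ : [set x | _] = setT `&` X @^-1` `]-oo, r]%classic).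
  exact: mX.
by rewrite setTI; apply/seteqP; split => x /=; rewrite in_itv.
Qed.

Let AD : A D = E.
Proof. by apply/seteqP; split => [x []//|x Ex]; split => //; have /andP[] := XD Ex. Qed.

(** The shift e = 0 gives a majorant of the kernel, e = 1 a minorant. *)
Let layers l e x : \bar R := ((D `^ (- p))%:E +
  \sum_(j <oo) (layer_weight p l D j)%:E * (\1_(A (layer_radius D l (j + e))) x)%:E)%E.

Lemma integral_layers l e : 0 < l -> (\int[nu]_(x in E) layers l e x =
  (D `^ (- p))%:E * nu E +
  \sum_(j <oo) (layer_weight p l D j)%:E * nu (A (layer_radius D l (j + e))))%E.
Proof.
move=> l0; have w0 j : (0 <= (layer_weight p l D j)%:E)%E.
  by rewrite lee_fin layer_weight_ge0.
have t0 j x : (0 <= (layer_weight p l D j)%:E * (\1_(A (layer_radius D l (j + e))) x)%:E)%E.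
  by rewrite mule_ge0// lee_fin.
have mt j : measurable_fun E (fun x => (layer_weight p l D j)%:E *
    (\1_(A (layer_radius D l (j + e))) x)%:E)%E.
  apply: measurable_funeM; apply/measurable_EFinP; exact: measurable_indic.
rewrite ge0_integralD//; first last.
- by apply: ge0_emeasurable_sum => [j x _ _|j _]; [exact: t0|exact: mt].
- by move=> x _; apply: nneseries_ge0 => *; exact: t0.
- by move=> x _; rewrite lee_fin powR_ge0.
rewrite integral_cst//; congr (_ + _)%E; rewrite integral_nneseries//.
apply: eq_eseriesr => j _; rewrite ge0_integralZl_EFin ?layer_weight_ge0//; last first.
  by apply/measurable_EFinP; exact: measurable_indic.
by rewrite integral_indic// setIidl// => x [].
Qed.

Let measurable_layers l e : 0 < l -> measurable_fun E (layers l e).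
Proof.
move=> l0; apply: emeasurable_funD => //.
apply: ge0_emeasurable_sum => [j x _ _|j _].
  by rewrite mule_ge0// lee_fin ?layer_weight_ge0.
apply: measurable_funeM; apply/measurable_EFinP; exact: measurable_indic.
Qed.

Let measurable_riesz_X : measurable_fun E (fun x => riesz_dist p (X x)).
Proof.
by apply: measurable_funTS; exact: (measurableT_comp (measurable_riesz_dist p)).
Qed.

Let layers_ge l x k : 0 < l -> E x ->
  (forall j, (j < k)%N -> X x <= layer_radius D l j) ->
  ((D `^ (- p) * expR (l * p) ^+ k)%:E <= layers l 0 x)%E.
Proof.
move=> l0 Ex H; rewrite -sum_layer_weight EFinD leeD2l//.
apply: le_trans (nneseries_lim_ge k _); last first.
  by move=> j _ _; rewrite mule_ge0// lee_fin ?layer_weight_ge0.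
rewrite big_mkord -sumEFin; apply: lee_sum => j _.
by rewrite indicE addn0 mem_set ?mule1//; split => //; exact: H.
Qed.

Let riesz_le_layers l x : 0 < l -> E x -> (riesz_dist p (X x) <= layers l 0 x)%E.
Proof.
move=> l0 Ex; have /andP[X0 XleD] := XD Ex; rewrite /riesz_dist p0 /=.
case: eqVneq => [x0|x0]; last first.
  have [|k [kP /andP[_ kle]]] := @layer_index p l D (X x) p0 l0.
    by rewrite lt_neqAle eq_sym x0 X0.
  apply: (@le_trans _ _ (D `^ (- p) * expR (l * p) ^+ k.+1)%:E).
    by rewrite lee_fin.
  by apply: layers_ge => // j; rewrite ltnS kP.
rewrite leye_eq; apply/eqP/eq_infty => r.
have lp0 : 0 < l * p by rewrite mulr_gt0.
pose y := `|r| / D `^ (- p) / (l * p).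
have y0 : 0 <= y by rewrite !divr_ge0 ?powR_ge0 ?(ltW lp0).
have /andP[_ ky] := truncn_itv y0; set k := (Num.trunc y).+1 in ky.
apply: (@le_trans _ _ (D `^ (- p) * expR (l * p) ^+ k)%:E); last first.
  by apply: layers_ge => // j _; rewrite x0 mulr_ge0 ?expR_ge0 ?(ltW D0).
rewrite lee_fin (le_trans (ler_norm r))// mulrC -ler_pdivrMr ?powR_gt0//.
rewrite -expRM_natl (le_trans _ (expR_ge1Dx _))// -[leLHS]add0r lerD//.
by rewrite -ler_pdivrMr// ltW.
Qed.

Let layers_le_riesz l x : 0 < l -> E x -> (layers l 1 x <= riesz_dist p (X x))%E.
Proof.
move=> l0 Ex; have /andP[X0 XleD] := XD Ex; rewrite /riesz_dist p0 /=.
case: eqVneq => [x0|x0]; first exact: leey.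
have [|k [kP /andP[kle _]]] := @layer_index p l D (X x) p0 l0.
  by rewrite lt_neqAle eq_sym x0 X0.
apply: (@le_trans _ _ (D `^ (- p) * expR (l * p) ^+ k)%:E); last by rewrite lee_fin.
rewrite -sum_layer_weight EFinD leeD2l//.
rewrite (nneseries_split 0 k); last first.
  by move=> j _; rewrite mule_ge0// lee_fin ?layer_weight_ge0.
rewrite add0n big_mkord -sumEFin [X in (_ + X)%E]eseries0 ?adde0.
  by apply: lee_sum => j _; rewrite -EFinM lee_fin ler_piMr ?layer_weight_ge0.
move=> j kj _; rewrite indicE memNset ?mule0//= => -[_ /=].
by rewrite kP addn1 ltnNge kj.
Qed.

Let s := N%:R - p.
Let s0 : 0 < s. Proof. by rewrite subr_gt0. Qed.

Let ratio_lt1 l : 0 < l -> 0 <= expR (- (l * s)) < 1.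
Proof.
by move=> l0; rewrite expR_ge0/= -[ltRHS]expR0 ltr_expR oppr_lt0 mulr_gt0.
Qed.

Let layer_term l j : layer_weight p l D j * (C * layer_radius D l j ^+ N) =
  C * D `^ s * (expR (l * p) - 1) * expR (- (l * s)) ^+ j.
Proof.
rewrite /layer_weight /layer_radius exprMn /s -[D ^+ N]powR_mulrn ?(ltW D0)//.
rewrite powRD; last by rewrite (gt_eqF D0) implybT.
rewrite -!expRM_natl.
have -> : expR (j%:R * - (l * (N%:R - p))) =
    expR (j%:R * (l * p)) * expR (N%:R * - (j%:R * l)).
  by rewrite -expRD; congr expR; ring.
by ring.
Qed.

(** Summing the geometric series of the layers gives (1 - q^N) / (1 - q^s) up to
    a factor exp(l p); this tends to N / s, and is at most exp(N l) N / s. *)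
Lemma radial_integral_le :
  (forall r, 0 < r <= D -> (nu (A r) <= (C * r ^+ N)%:E)%E) ->
  (\int[nu]_(x in E) riesz_dist p (X x) <= (N%:R * C * D `^ s / s)%:E)%E.
Proof.
move=> nuC.
have B0 : 0 <= N%:R * C * D `^ s / s.
  by rewrite divr_ge0 ?(ltW s0)// !mulr_ge0// powR_ge0.
have N0 : 0 < N%:R :> R by exact: lt_trans pN.
have I0 : (0 <= \int[nu]_(x in E) riesz_dist p (X x))%E.
  by apply: integral_ge0 => x _; exact: riesz_dist_ge0.
have bound l : 0 < l -> (\int[nu]_(x in E) riesz_dist p (X x) <=
    (N%:R * C * D `^ s / s * expR (N%:R * l))%:E)%E.
  move=> l0; set z := expR (- (l * s)); have /andP[z0 z1] := ratio_lt1 l0.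
  apply: (@le_trans _ _ (\int[nu]_(x in E) layers l 0 x)%E).
    apply: ge0_le_integral => //.
    - by move=> x _; exact: riesz_dist_ge0.
    - exact: measurable_layers.
    - by move=> x Ex; exact: riesz_le_layers.
  rewrite integral_layers//.
  apply: (@le_trans _ _ ((C * D `^ s)%:E +
      \sum_(j <oo) (C * D `^ s * (expR (l * p) - 1) * z ^+ j)%:E)%E).
    apply: leeD.
      rewrite -[X in nu X]AD; apply: (@le_trans _ _ ((D `^ (- p))%:E * (C * D ^+ N)%:E)%E).
        by rewrite lee_pmul2l ?lte_fin ?powR_gt0// nuC// D0/=.
      rewrite -EFinM lee_fin /s powRD; last by rewrite (gt_eqF D0) implybT.
      by rewrite powR_mulrn ?(ltW D0)// le_eqVlt; apply/orP; left; apply/eqP; ring.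
    apply: lee_nneseries => j _.
      by move=> *; rewrite mule_ge0// lee_fin layer_weight_ge0.
    rewrite addn0 -layer_term [leRHS]EFinM.
    apply: lee_pmul; rewrite ?lee_fin ?layer_weight_ge0//.
    have rj0 : 0 < layer_radius D l j by rewrite mulr_gt0 ?expR_gt0.
    apply: nuC; rewrite rj0 ler_piMr ?(ltW D0)// -[leRHS]expR0 ler_expR.
    by rewrite oppr_le0 mulr_ge0 ?(ltW l0).
  rewrite nneseries_geometric ?z0// -EFinD lee_fin.
  have z10 : 0 < 1 - z by rewrite subr_gt0.
  have zE : z = expR (l * p) * expR (- (l * N%:R)).
    by rewrite -expRD; congr expR; rewrite /s; ring.
  rewrite [leLHS](_ : _ = C * D `^ s * (expR (l * p) * (1 - expR (- (l * N%:R))) / (1 - z))); last first.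
    have -> : expR (l * p) * (1 - expR (- (l * N%:R))) = expR (l * p) - z.
      by rewrite mulrBr mulr1 -zE.
    by field; rewrite gt_eqF.
  rewrite [leRHS](_ : _ = C * D `^ s * (N%:R / s * expR (N%:R * l))); last by ring.
  apply: ler_wpM2l; first by rewrite mulr_ge0 ?powR_ge0.
  rewrite ler_pdivrMr//.
  have h1 := onem_expRN_le (l * N%:R); have h2 := onem_expRN_ge (l * s).
  apply: (@le_trans _ _ (expR (l * p) * (l * N%:R))).
    by rewrite ler_wpM2l ?expR_ge0.
  apply: (@le_trans _ _ (N%:R / s * expR (N%:R * l) * (l * s * z))); last first.
    by rewrite ler_wpM2l// mulr_ge0 ?expR_ge0// divr_ge0 ?(ltW s0) ?(ltW N0).
  have -> : expR (l * p) = expR (N%:R * l) * z.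
    by rewrite -expRD; congr expR; rewrite /s; ring.
  by rewrite le_eqVlt; apply/orP; left; apply/eqP; field; rewrite gt_eqF.
have fin : (\int[nu]_(x in E) riesz_dist p (X x))%E \is a fin_num.
  by rewrite ge0_fin_numE// (le_lt_trans (bound 1 ltr01))// ltry.
rewrite -(fineK fin) lee_fin; apply: (le_of_expR B0 N0) => l l0.
by rewrite -lee_fin fineK// bound.
Qed.

(** The same series with the radii shifted by one step, which costs a factor
    exp(-N l). *)
Lemma radial_integral_ge :
  (forall r, 0 < r <= D -> ((C * r ^+ N)%:E <= nu (A r))%E) ->
  ((N%:R * C * D `^ s / s)%:E <= \int[nu]_(x in E) riesz_dist p (X x))%E.
Proof.
move=> nuC.
have N0 : 0 < N%:R :> R by exact: lt_trans pN.
have [->|Ioo] := eqVneq (\int[nu]_(x in E) riesz_dist p (X x))%E +oo%E.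
  exact: leey.
have I0 : (0 <= \int[nu]_(x in E) riesz_dist p (X x))%E.
  by apply: integral_ge0 => x _; exact: riesz_dist_ge0.
have fin : (\int[nu]_(x in E) riesz_dist p (X x))%E \is a fin_num.
  by rewrite ge0_fin_numE// ltey.
rewrite -(fineK fin) lee_fin; apply: (@le_of_expR _ _ N%:R) => //.
  exact: fine_ge0.
move=> l l0; rewrite -ler_pdivrMr ?expR_gt0// -lee_fin fineK//.
set z := expR (- (l * s)); have /andP[z0 z1] := ratio_lt1 l0.
apply: (@le_trans _ _ (\int[nu]_(x in E) layers l 1 x)%E); last first.
  apply: ge0_le_integral => //.
  - move=> x _; rewrite adde_ge0 ?lee_fin ?powR_ge0//; apply: nneseries_ge0 => j _ _.
    by rewrite mule_ge0// lee_fin ?layer_weight_ge0.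
  - exact: measurable_layers.
  - by move=> x Ex; exact: layers_le_riesz.
rewrite integral_layers//.
have w0 j : 0 <= layer_weight p l D j by exact: layer_weight_ge0.
apply: (@le_trans _ _ ((C * D `^ s)%:E +
    \sum_(j <oo) (C * D `^ s * (expR (l * p) - 1) * expR (- (l * N%:R)) * z ^+ j)%:E)%E); last first.
  apply: leeD.
    rewrite -[X in nu X]AD; apply: (@le_trans _ _ ((D `^ (- p))%:E * (C * D ^+ N)%:E)%E).
      rewrite -EFinM lee_fin /s powRD; last by rewrite (gt_eqF D0) implybT.
      by rewrite powR_mulrn ?(ltW D0)// le_eqVlt; apply/orP; left; apply/eqP; ring.
    by rewrite lee_pmul2l ?lte_fin ?powR_gt0// nuC// D0/=.
  have lp1 : 0 <= expR (l * p) - 1.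
    by rewrite subr_ge0 -[leLHS]expR0 ler_expR mulr_ge0 ?(ltW l0) ?(ltW p0).
  apply: lee_nneseries => j _.
    by move=> *; rewrite lee_fin !mulr_ge0 ?powR_ge0 ?exprn_ge0 ?expR_ge0.
  have -> : C * D `^ s * (expR (l * p) - 1) * expR (- (l * N%:R)) * z ^+ j =
      layer_weight p l D j * (C * layer_radius D l (j + 1) ^+ N).
    have -> : layer_radius D l (j + 1) ^+ N =
        layer_radius D l j ^+ N * expR (- (l * N%:R)).
      rewrite /layer_radius !exprMn -mulrA -!expRM_natl -expRD; congr (_ * expR _).
      by rewrite natrD; ring.
    by rewrite mulrAC -layer_term; ring.
  rewrite [leLHS]EFinM; apply: lee_pmul; rewrite ?lee_fin ?w0//.
    by rewrite mulr_ge0// exprn_ge0// mulr_ge0 ?expR_ge0 ?(ltW D0).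
  apply: nuC; rewrite mulr_gt0 ?expR_gt0//= ler_piMr ?(ltW D0)// -[leRHS]expR0 ler_expR.
  by rewrite oppr_le0 mulr_ge0 ?(ltW l0).
rewrite nneseries_geometric ?z0// -EFinD lee_fin.
have z10 : 0 < 1 - z by rewrite subr_gt0.
have zE : z = expR (l * p) * expR (- (l * N%:R)).
  by rewrite -expRD; congr expR; rewrite /s; ring.
rewrite [leRHS](_ : _ = C * D `^ s * ((1 - expR (- (l * N%:R))) / (1 - z))); last first.
  by rewrite -mulrA [X in _ + X](_ : _ = C * D `^ s * (z - expR (- (l * N%:R))) / (1 - z));
    [|rewrite zE; ring]; field; rewrite gt_eqF.
rewrite -expRN [leLHS](_ : _ = C * D `^ s * (N%:R / s * expR (- (N%:R * l)))); last by ring.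
apply: ler_wpM2l; first by rewrite mulr_ge0 ?powR_ge0.
rewrite ler_pdivlMr//.
have h1 := onem_expRN_ge (l * N%:R); have h2 := onem_expRN_le (l * s).
apply: le_trans h1; apply: (@le_trans _ _ (N%:R / s * expR (- (N%:R * l)) * (l * s))).
  by rewrite ler_wpM2l// mulr_ge0 ?expR_ge0// divr_ge0 ?(ltW s0) ?(ltW N0).
rewrite [N%:R * l]mulrC le_eqVlt; apply/orP; left; apply/eqP; field.
by rewrite gt_eqF.
Qed.

End RadialLayers.

(** * The binomial series with a negative exponent *)

Section BinomialSeries.
Context {R : realType}.
Implicit Types (a u w : R) (N k : nat).

(** The coefficients of (1 - w)^(-a). *)
Definition binom_coef a k : R := \prod_(i < k) ((a + i%:R) / i.+1%:R).

Lemma binom_coef_ge0 a k : 0 <= a -> 0 <= binom_coef a k.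
Proof. by move=> a0; apply: prodr_ge0 => i _; rewrite divr_ge0// addr_ge0. Qed.

Lemma binom_coefS a k : k.+1%:R * binom_coef a k.+1 = (a + k%:R) * binom_coef a k.
Proof.
rewrite /binom_coef big_ord_recr /= mulrC -mulrA divfK ?pnatr_eq0//.
exact: mulrC.
Qed.

Lemma binom_coef_shift a k : k.+1%:R * binom_coef a k.+1 = a * binom_coef (a + 1) k.
Proof.
elim: k => [|k IH]; first by rewrite binom_coefS /binom_coef !big_ord0 addr0.
have k0 : k.+1%:R != 0 :> R by rewrite pnatr_eq0.
apply: (mulfI k0); rewrite binom_coefS mulrCA IH.
rewrite [RHS]mulrCA binom_coefS -natr1; ring.
Qed.

(** (1 - w)^a times a partial sum of the series of (1 - w)^(-a), at
    w = 1 - exp(-u). *)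
Definition binom_partial a N u : R :=
  expR (- a * u) * \sum_(k < N) binom_coef a k * (1 - expR (- u)) ^+ k.

(** In the variable w = 1 - exp(-u) the derivative of (1 - w)^a times a partial
    sum telescopes to a single term. *)
Lemma is_derive_binom_partial a N u : is_derive u 1 (binom_partial a N)
  (- (N%:R * binom_coef a N * (1 - expR (- u)) ^+ N.-1 * expR (- a * u))).
Proof.
elim: N => [|N IH].
  rewrite (_ : binom_partial a 0 = cst 0).
    by rewrite !mul0r oppr0; exact: is_derive_cst.
  by apply/funext => v; rewrite /binom_partial big_ord0 mulr0.
have dE : is_derive u 1 (fun v => expR (- a * v)) (- a * expR (- a * u)).
  have H : is_derive u 1 (fun v => - a * v) (- a).
    by rewrite -[X in is_derive _ _ _ X]mulr1; exact: is_deriveZ.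
  have := is_derive1_comp (is_derive_expR (- a * u)) H.
  by rewrite mulrC.
have dW : is_derive u 1 (fun v : R => 1 - expR (- v)) (expR (- u)).
  have H : is_derive u 1 (fun v : R => - v) (- 1) by apply: is_deriveN.
  have H1 := is_derive1_comp (is_derive_expR (- u)) H.
  have := is_deriveB (is_derive_cst (1 : R) u 1) H1.
  by rewrite mulrN1 sub0r opprK.
have dX : is_derive u 1 (fun v : R => (1 - expR (- v)) ^+ N)
    (N%:R * (1 - expR (- u)) ^+ N.-1 * expR (- u)).
  by have := is_deriveX N dW; rewrite exprfctE.
have := is_deriveD IH (is_deriveZ (binom_coef a N) (is_deriveM dE dX)).
rewrite (_ : _ + _ = binom_partial a N.+1); last first.
  apply/funext => v; rewrite /binom_partial big_ord_recr /= mulrDr.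
  rewrite -[LHS]/(_ + binom_coef a N * (expR (- a * v) * (1 - expR (- v)) ^+ N)).
  by congr (_ + _); exact: mulrCA.
move=> /is_derive_eq; apply; rewrite binom_coefS /GRing.scale /=.
move: (binom_coef a N) (expR (- a * u)) (expR (- u)) => c E e.
case: N {IH dX} => [|N] /=; last by rewrite exprS; ring.
by rewrite !expr0 !mul0r; ring.
Qed.

Lemma binom_partial0 a N : binom_partial a N.+1 0 = 1.
Proof.
rewrite /binom_partial oppr0 mulr0 expR0 subrr mul1r big_ord_recl expr0.
rewrite /binom_coef big_ord0 mulr1 big1 ?addr0// => i _.
by rewrite expr0n mulr0.
Qed.

Lemma binom_partial_MVT a N u : 0 < u -> exists2 v, 0 < v < u &
  1 - binom_partial a N.+1 u =
  N.+1%:R * binom_coef a N.+1 * (1 - expR (- v)) ^+ N * expR (- a * v) * u.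
Proof.
move=> u0; have dg := is_derive_binom_partial a N.+1.
have [c] := @MVT R (binom_partial a N.+1) _ 0 u u0 (fun x _ => dg x)
  (derivable_within_continuous (fun x _ => @ex_derive _ _ _ _ _ _ _ (dg x))).
rewrite in_itv /= => cu E; exists c => //.
by move: E; rewrite binom_partial0 subr0 mulNr => E; rewrite -opprB E opprK.
Qed.

Lemma onem_expRN_itv u : 0 <= u -> 0 <= 1 - expR (- u) < 1.
Proof.
move=> u0; rewrite subr_ge0 -[leRHS]expR0 ler_expR oppr_le0 u0/=.
by rewrite ltrBlDr ltrDl expR_gt0.
Qed.

Lemma binom_partial_le1 a N u : 0 <= a -> 0 <= u -> binom_partial a N u <= 1.
Proof.
move=> a0; case: N => [|N]; first by rewrite /binom_partial big_ord0 mulr0.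
rewrite le_eqVlt => /predU1P[<-|u0]; first by rewrite binom_partial0.
have [v /andP[v0 vu] E] := binom_partial_MVT a N u0.
rewrite -subr_ge0 E; have /andP[w0 _] := onem_expRN_itv (ltW v0).
by rewrite !mulr_ge0 ?expR_ge0 ?exprn_ge0 ?binom_coef_ge0// ltW.
Qed.

Lemma sum_binom_le a N u : 0 <= a -> 0 <= u ->
  \sum_(k < N) binom_coef a k * (1 - expR (- u)) ^+ k <= expR (a * u).
Proof.
move=> a0 u0; have := binom_partial_le1 N a0 u0; rewrite /binom_partial.
by rewrite ?mulNr (expRN (a * u)) mulrC ler_pdivrMr ?expR_gt0// mul1r.
Qed.

Lemma binom_coef_le a N u : 0 <= a -> 0 <= u ->
  binom_coef a N * (1 - expR (- u)) ^+ N <= expR (a * u).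
Proof.
move=> a0 u0; apply: le_trans (sum_binom_le N.+1 a0 u0).
have /andP[w0 _] := onem_expRN_itv u0.
rewrite big_ord_recr /= lerDr sumr_ge0// => i _.
by rewrite mulr_ge0 ?exprn_ge0 ?binom_coef_ge0.
Qed.

(** By the mean value theorem the remainder is at most
    a c_N(a + 1) w^N u, and c_N(a + 1) w'^N is bounded for the larger
    w' = 1 - exp(-u - 1), so that the remainder decays like (w / w')^N. *)
Lemma cvg_binom_partial a u : 0 < a -> 0 < u ->
  binom_partial a N.+1 u @[N --> \oo] --> (1 : R).
Proof.
move=> a0 u0.
set w := 1 - expR (- u); set w' := 1 - expR (- (u + 1)).
have /andP[w0 w1] := onem_expRN_itv (ltW u0).
have u10 : 0 <= u + 1 by rewrite addr_ge0// ltW.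
have /andP[w'0 w'1] := onem_expRN_itv u10.
have ww' : w < w' by rewrite ltrD2l ltrN2 ltr_expR ltrN2 ltrDl.
have {}w'0 : 0 < w' by apply: le_lt_trans ww'.
pose B := a * expR ((a + 1) * (u + 1)) * u.
pose z := w / w'.
have z0 : 0 <= z by rewrite divr_ge0 ?(ltW w'0).
have z1 : z < 1 by rewrite ltr_pdivrMr// mul1r.
apply: (@squeeze_cvgr _ _ _ _ (fun N => 1 - geometric B z N) (cst 1)).
- apply: nearW => N; rewrite binom_partial_le1 ?(ltW a0) ?(ltW u0)// andbT.
  rewrite lerBlDr -lerBlDl; have [v /andP[v0 vu] ->] := binom_partial_MVT a N u0.
  rewrite binom_coef_shift /geometric /= /B.
  have /andP[v0' _] := onem_expRN_itv (ltW v0).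
  have c0 : 0 <= binom_coef (a + 1) N by rewrite binom_coef_ge0// addr_ge0 ?(ltW a0).
  rewrite [leRHS]mulrAC ler_wpM2r ?(ltW u0)//.
  apply: (@le_trans _ _ (a * (binom_coef (a + 1) N * w ^+ N))).
    rewrite -!mulrA ler_wpM2l ?(ltW a0)// ler_wpM2l//.
    rewrite -[leRHS]mulr1 ler_pM ?exprn_ge0 ?expR_ge0//.
      rewrite lerXn2r ?nnegrE// lerD2l lerN2 ler_expR lerN2; exact: ltW.
    by rewrite -[leRHS]expR0 ler_expR mulNr oppr_le0 mulr_ge0 ?(ltW a0) ?(ltW v0).
  rewrite -mulrA ler_wpM2l ?(ltW a0)// /z expr_div_n mulrA.
  rewrite ler_pdivlMr ?exprn_gt0// mulrAC ler_wpM2r ?exprn_ge0//.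
  by apply: binom_coef_le => //; rewrite addr_ge0 ?(ltW a0).
- rewrite -[X in _ --> X](subr0 (1 : R)); apply: cvgB; first exact: cvg_cst.
  by apply: cvg_geometric; rewrite ger0_norm.
- exact: cvg_cst.
Qed.

Lemma binom_series a u : 0 < a -> 0 <= u ->
  (\sum_(k <oo) (binom_coef a k * (1 - expR (- u)) ^+ k)%:E = (expR (a * u))%:E)%E.
Proof.
move=> a0; rewrite le_eqVlt => /predU1P[<-|u0].
  rewrite nneseries_recl//; last first.
    by move=> k _; rewrite lee_fin mulr_ge0 ?binom_coef_ge0 ?(ltW a0)// oppr0 expR0 subrr exprn_ge0.
  rewrite expr0 mulr1 {1}/binom_coef big_ord0 mulr0 expR0 eseries0 ?adde0//.
  by move=> k k1 _; rewrite oppr0 expR0 subrr expr0n gtn_eqF// mulr0.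
apply/cvg_lim => //; rewrite -cvg_shiftS /=.
rewrite (_ : (fun N => _) = EFin \o (fun N => expR (a * u) * binom_partial a N.+1 u)).
  apply: cvg_EFin; first exact: nearW.
  rewrite -[X in _ --> X]mulr1; apply: cvgMr; exact: cvg_binom_partial.
apply/funext => N /=; rewrite big_mkord sumEFin /binom_partial mulrA -expRD.
by rewrite mulNr subrr expR0 mul1r.
Qed.

(** At w = 1 the series dominates its values (1 - w)^(-a) for all w < 1. *)
Lemma binom_series1 a : 0 < a -> (\sum_(k <oo) (binom_coef a k)%:E = +oo :> \bar R)%E.
Proof.
move=> a0; apply: eq_infty => r.
have u0 : 0 <= `|r| / a by rewrite divr_ge0// ltW.
apply: (@le_trans _ _ (expR (a * (`|r| / a)))%:E).
  rewrite lee_fin mulrC divfK ?gt_eqF// (le_trans (ler_norm r))//.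
  by rewrite (le_trans _ (expR_ge1Dx _))// lerDr.
rewrite -binom_series//; apply: lee_nneseries => k _.
  have /andP[w0 _] := onem_expRN_itv u0.
  by move=> *; rewrite lee_fin mulr_ge0 ?exprn_ge0 ?binom_coef_ge0 ?(ltW a0).
have /andP[w0 w1] := onem_expRN_itv u0.
by rewrite lee_fin ler_piMr ?binom_coef_ge0 ?(ltW a0)// exprn_ile1// ltW.
Qed.

End BinomialSeries.

(** * Positive definiteness of the Riesz kernel *)

Section FiniteRank.
Context {R : realType} {d : measure_display} {T : measurableType d}.
Implicit Types (k : T -> T -> R) (mu nu : probability T R).

(** Boundedness makes the moments of the f i exist for every probability. *)
Definition finite_rank k : Prop := exists (I : finType) (f : I -> T -> R),
  [/\ (forall i, measurable_fun [set: T] (f i)),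
      (exists M, forall i x, `|f i x| <= M) &
      (forall x y, k x y = \sum_i f i x * f i y)].

Lemma finite_rank1 (f : T -> R) M : measurable_fun [set: T] f ->
  (forall x, `|f x| <= M) -> finite_rank (fun x y => f x * f y).
Proof.
move=> mf fM; exists 'I_1, (fun=> f); split => //; first by exists M.
by move=> x y; rewrite big_ord1.
Qed.

Lemma finite_rankD k k' : finite_rank k -> finite_rank k' ->
  finite_rank (fun x y => k x y + k' x y).
Proof.
move=> [I [f [mf [M fM] kE]]] [J [g [mg [N gN] k'E]]].
exists (I + J)%type, (fun s => match s with inl i => f i | inr j => g j end).
split.
- by case.
- exists (Num.max M N) => -[i|j] x; rewrite le_max ?fM ?gN ?orbT//.
- by move=> x y; rewrite kE k'E big_sumType.
Qed.

(** Schur's product theorem for Gram kernels: tensor products of the feature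
    maps. *)
Lemma finite_rankM k k' : finite_rank k -> finite_rank k' ->
  finite_rank (fun x y => k x y * k' x y).
Proof.
move=> [I [f [mf [M fM] kE]]] [J [g [mg [N gN] k'E]]].
exists (I * J)%type, (fun s x => f s.1 x * g s.2 x); split.
- by move=> [i j]; apply: measurable_funM.
- by exists (M * N) => -[i j] x; rewrite normrM ler_pM.
- move=> x y; rewrite kE k'E big_distrlr/= pair_bigA/=.
  by apply: eq_bigr => -[i j] _ /=; rewrite mulrACA.
Qed.

Lemma finite_rankX k N : finite_rank k -> finite_rank (fun x y => k x y ^+ N).
Proof.
move=> fk; elim: N => [|N IH].
  have := @finite_rank1 (fun=> 1) 1 (measurable_cst _) _.
  rewrite mulr1; apply => x; by rewrite normr1.
have := finite_rankM fk IH; congr finite_rank.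
by apply/funext => x; apply/funext => y; rewrite exprS.
Qed.

Lemma finite_rankZ c k : 0 <= c -> finite_rank k ->
  finite_rank (fun x y => c * k x y).
Proof.
move=> c0; apply: finite_rankM.
have := @finite_rank1 (fun=> Num.sqrt c) (Num.sqrt c) (measurable_cst _) _.
by rewrite -expr2 sqr_sqrtr//; apply => x; rewrite ger0_norm ?sqrtr_ge0.
Qed.

Lemma bounded_integrable d' (S : measurableType d') (P : probability S R)
    (f : S -> R) M : measurable_fun [set: S] f -> (forall x, `|f x| <= M) ->
  P.-integrable [set: S] (EFin \o f).
Proof.
move=> mf fM; apply: measurable_bounded_integrable => //.
- exact: (le_lt_trans (probability_le1 P measurableT) (ltry 1)).
- exists M; split; first exact: num_real.
  by move=> r Mr x _; apply: le_trans (ltW Mr).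
Qed.

Lemma integral_tensor mu nu (f g : T -> R) M :
  measurable_fun [set: T] f -> measurable_fun [set: T] g ->
  (forall x, `|f x| <= M) -> (forall x, `|g x| <= M) ->
  ((mu \x nu).-integrable [set: T * T] (fun z => (f z.1 * g z.2)%:E) /\
  \int[mu \x nu]_z (f z.1 * g z.2)%:E =
    (fine (\int[mu]_x (f x)%:E) * fine (\int[nu]_x (g x)%:E))%:E)%E.
Proof.
move=> mf mg fM gM.
have h : ((mu \x nu).-integrable [set: T * T] (fun z => (f z.1 * g z.2)%:E))%E.
  apply: (@bounded_integrable _ _ (mu \x nu)%E _ (M * M)).
    apply: measurable_funM.
      exact: (measurableT_comp mf measurable_fst).
    exact: (measurableT_comp mg measurable_snd).
  by move=> z; rewrite normrM ler_pM.
split => //; rewrite -integral12_prod_meas1// /fubini_F /=.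
have If := bounded_integrable mu mf fM.
have Ig := bounded_integrable nu mg gM.
under eq_integral => x _.
  under eq_integral do rewrite EFinM.
  rewrite (integralZl _ Ig)//.
  rewrite -[X in (_ * X)%E]fineK; last exact: (integrable_fin_num _ Ig).
  rewrite muleC; over.
rewrite (integralZl _ If)// -[X in (_ * X)%E]fineK; last exact: (integrable_fin_num _ If).
by rewrite -EFinM mulrC.
Qed.

(** A finite-rank kernel is a Gram kernel, so the mutual energy of two
    probabilities is the scalar product of two vectors of moments. *)
Lemma finite_rank_moments k : finite_rank k ->
  exists (I : finType) (A : probability T R -> I -> R), forall mu nu,
  (\int[mu \x nu]_z (k z.1 z.2)%:E = (\sum_i A mu i * A nu i)%:E)%E.
Proof.
move=> [I [f [mf [M fM] kE]]]; exists I, (fun mu i => fine (\int[mu]_x (f i x)%:E)%E).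
move=> mu nu; under eq_integral do rewrite kE -sumEFin.
rewrite integral_sum//; last first.
  by move=> i; have [] := integral_tensor mu nu (mf i) (mf i) (fM i) (fM i).
rewrite -sumEFin; apply: eq_bigr => i _.
by have [] := integral_tensor mu nu (mf i) (mf i) (fM i) (fM i).
Qed.

Lemma finite_rank_measurable k : finite_rank k ->
  measurable_fun [set: T * T] (fun z : T * T => k z.1 z.2).
Proof.
move=> [I [f [mf _ kE]]].
rewrite (_ : (fun _ => _) = (fun z : T * T => \sum_i f i z.1 * f i z.2)); last first.
  by apply/funext => z; rewrite kE.
apply: measurable_sum => i; apply: measurable_funM.
  exact: (measurableT_comp (mf i) measurable_fst).
exact: (measurableT_comp (mf i) measurable_snd).
Qed.

(** Termwise the inequality 2 x y <= x^2 + y^2 for moments x and y. *)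
Lemma finite_rank_energy_le k mu nu (a b : R) : finite_rank k ->
  ((2 * a * b)%:E * \int[mu \x nu]_z (k z.1 z.2)%:E <=
   (a ^+ 2)%:E * \int[mu \x mu]_z (k z.1 z.2)%:E +
   (b ^+ 2)%:E * \int[nu \x nu]_z (k z.1 z.2)%:E)%E.
Proof.
move=> /finite_rank_moments[I [A AE]]; rewrite !AE -!EFinM -EFinD lee_fin.
rewrite !mulr_sumr -big_split/=; apply: ler_sum => i _.
have := sqr_ge0 (a * A mu i - b * A nu i); nra.
Qed.

Definition series_energy (k : nat -> T -> T -> R) mu nu : \bar R :=
  (\int[mu \x nu]_z \sum_(j <oo) (k j z.1 z.2)%:E)%E.

(** The inequality holds for each term, so it survives summation even when some
    of the energies are infinite. *)
Lemma series_energy_le (k : nat -> T -> T -> R) mu nu (a b : R) :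
  0 <= a -> 0 <= b ->
  (forall j, finite_rank (k j)) -> (forall j x y, 0 <= k j x y) ->
  ((2 * a * b)%:E * series_energy k mu nu <=
   (a ^+ 2)%:E * series_energy k mu mu + (b ^+ 2)%:E * series_energy k nu nu)%E.
Proof.
move=> a0 b0 fk k0.
have EE mu' nu' : series_energy k mu' nu' = (\sum_(j <oo) \int[mu' \x nu']_z (k j z.1 z.2)%:E)%E.
  rewrite /series_energy integral_nneseries//.
  - by move=> j; apply/measurable_EFinP; exact: finite_rank_measurable.
  - by move=> j z _; rewrite lee_fin.
have I0 mu' nu' j : (0 <= \int[mu' \x nu']_z (k j z.1 z.2)%:E)%E.
  by apply: integral_ge0 => z _; rewrite lee_fin.
rewrite !EE -!nneseriesZl// -nneseriesD//; last 2 first.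
- by move=> j _ _; rewrite mule_ge0// lee_fin sqr_ge0.
- by move=> j _ _; rewrite mule_ge0// lee_fin sqr_ge0.
apply: lee_nneseries => [j _ _|j _]; first by rewrite mule_ge0// lee_fin !mulr_ge0.
exact: finite_rank_energy_le.
Qed.

End FiniteRank.

Section RieszPositive.
Context {R : realType} {n : nat}.

(** Mutual energy; the domain is explicit because the expansion of the kernel
    is valid on bounded sets only. *)
Definition riesz_mutual (Q : set 'rV[R]_n) (p : R)
    (mu nu : probability (borel_rV R n) R) : \bar R :=
  (\int[mu \x nu]_(z in Q `*` Q) riesz_dist p (enorm (z.1 - z.2)))%E.

Local Notation V := 'rV[R]_n.
Local Notation T := (borel_rV R n).
Variables (Q : set V) (L p : R).
Hypotheses (mQ : measurable (Q : set T)) (L0 : 0 < L) (p0 : 0 < p).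
Hypothesis QL : forall x y, Q x -> Q y -> 2 * enorm (x - y) ^+ 2 <= L ^+ 2.
Implicit Types (x y : V) (mu nu : probability T R).

(** The conformal factor of stereographic projection, up to constants. *)
Let q x : R := L ^+ 2 + enorm x ^+ 2.
Let L20 : 0 < L ^+ 2. Proof. exact: exprn_gt0. Qed.
Let q_ge x : L ^+ 2 <= q x. Proof. by rewrite lerDl sqr_ge0. Qed.
Let q_gt0 x : 0 < q x. Proof. exact: lt_le_trans (q_ge x). Qed.

Let measurable_enorm_sqr : measurable_fun [set: T] (fun x : T => enorm (x : V) ^+ 2).
Proof.
by apply: measurable_funX; apply: measurable_fun_enorm => i; exact: measurable_coord.
Qed.

Let measurable_qV : measurable_fun [set: T] (fun x : T => (q x)^-1).
Proof.
rewrite (_ : (fun _ => _) = (fun x => q x `^ (-1))); last first.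
  by apply/funext => x; rewrite powR_inv1// ltW.
apply: (measurableT_comp (measurable_powR _)).
by apply: measurable_funD => //.
Qed.

(** Coordinates on the unit sphere of the inverse stereographic projection of
    x / L. *)
Definition stereo x (i : option 'I_n) : R :=
  match i with
  | Some i => 2 * L * x 0 i / q x
  | None => (L ^+ 2 - enorm x ^+ 2) / q x
  end.

Definition stereo_dot x y : R := \sum_i stereo x (Some i) * stereo y (Some i) +
  stereo x None * stereo y None.

Lemma finite_rank_stereo_dot : finite_rank (stereo_dot : T -> T -> R).
Proof.
apply: finite_rankD.
  exists 'I_n, (fun i (x : T) => stereo x (Some i)); split => //.
    move=> i /=; apply: measurable_funM => //.
    by apply: measurable_funM => //; exact: measurable_coord.
  exists 1 => i x; rewrite normrM [X in _ * X]ger0_norm ?invr_ge0 ?(ltW (q_gt0 _))//.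
  rewrite ler_pdivrMr// mul1r normrM ger0_norm ?mulr_ge0 ?(ltW L0)//.
  have := coord_le_enorm (x : V) i; have := sqr_ge0 (L - enorm (x : V)).
  rewrite /q; move: L0; nra.
apply: (@finite_rank1 _ _ _ (fun x : T => stereo x None) 1).
  by apply: measurable_funM => //; apply: measurable_funB.
move=> x; rewrite normrM [X in _ * X]ger0_norm ?invr_ge0 ?(ltW (q_gt0 _))//.
rewrite ler_pdivrMr// mul1r ler_norml /q; have := sqr_ge0 (enorm (x : V)).
by move: L20; lra.
Qed.

(** The formula for chordal distances, |X - Y|^2 = 2 (1 - X . Y). *)
Lemma stereo_dotE x y :
  1 - stereo_dot x y = 2 * L ^+ 2 * enorm (x - y) ^+ 2 / (q x * q y).
Proof.
have qx := lt0r_neq0 (q_gt0 x); have qy := lt0r_neq0 (q_gt0 y).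
have -> : enorm (x - y) ^+ 2 =
    enorm x ^+ 2 + enorm y ^+ 2 - 2 * \sum_i x 0 i * y 0 i.
  rewrite !enorm_sqr mulr_sumr -big_split -sumrB/=; apply: eq_bigr => i _.
  by rewrite !mxE; ring.
rewrite /stereo_dot /stereo.
have -> : \sum_i 2 * L * x 0 i / q x * (2 * L * y 0 i / q y) =
    4 * L ^+ 2 * (\sum_i x 0 i * y 0 i) / (q x * q y).
  rewrite mulr_sumr mulr_suml; apply: eq_bigr => i _; field.
  by rewrite qx qy.
move: qx qy; rewrite /q => qx qy; field.
by rewrite qx qy.
Qed.

(** The radius L is chosen so large that Q is mapped into a cap on which scalar
    products stay nonnegative. *)
Lemma stereo_dot_itv x y : Q x -> Q y -> 0 <= stereo_dot x y <= 1.
Proof.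
move=> Qx Qy; have h := stereo_dotE x y.
have : 0 <= 1 - stereo_dot x y <= 1; last by lra.
rewrite h divr_ge0 ?mulr_ge0 ?enorm_ge0 ?(ltW L0) ?(ltW (q_gt0 _))//=.
rewrite ler_pdivrMr ?mulr_gt0// mul1r.
have := QL Qx Qy; have := q_ge x; have := q_ge y; move: L20; nra.
Qed.

Let a := p / 2.
Let a0 : 0 < a. Proof. by rewrite divr_gt0. Qed.
Let G (x : T) : R := (q x)^-1 `^ a * \1_(Q : set T) x.

(** The term of |x - y|^(-p) that comes from w^j in the binomial series of
    (1 - w)^(-p/2), cut off outside Q so that it is nonnegative everywhere. *)
Definition riesz_term j (x y : T) : R :=
  (2 * L ^+ 2) `^ a * binom_coef a j * (G x * G y * stereo_dot x y ^+ j).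

Let finite_rank_riesz_term j : finite_rank (riesz_term j).
Proof.
apply: finite_rankZ; first by rewrite mulr_ge0 ?powR_ge0 ?binom_coef_ge0 ?ltW.
apply: finite_rankM; last exact: finite_rankX finite_rank_stereo_dot.
apply: (@finite_rank1 _ _ _ G ((L ^+ 2)^-1 `^ a)).
  apply: measurable_funM; last exact: measurable_indic.
  exact: (measurableT_comp (measurable_powR _)).
move=> x; rewrite /G normrM ger0_norm ?powR_ge0//.
rewrite (@le_trans _ _ ((q x)^-1 `^ a))//.
  rewrite ler_piMr ?powR_ge0// indicE; case: (_ \in _); rewrite ?normr1 ?normr0//.
apply: ge0_ler_powR; rewrite ?nnegrE ?invr_ge0 ?(ltW a0) ?(ltW L20) ?(ltW (q_gt0 _))//.
by rewrite lef_pV2 ?posrE.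
Qed.

Let riesz_term_ge0 j x y : 0 <= riesz_term j x y.
Proof.
rewrite /riesz_term; apply: mulr_ge0.
  by rewrite mulr_ge0 ?powR_ge0 ?binom_coef_ge0 ?(ltW a0).
rewrite /G !indicE; case: (boolP (x \in _)) => [/[!inE] Qx|_]; last by rewrite mulr0 !mul0r.
case: (boolP (y \in _)) => [/[!inE] Qy|_]; last by rewrite !mulr0 mul0r.
by rewrite !mulr1 !mulr_ge0 ?powR_ge0// exprn_ge0//; have /andP[] := stereo_dot_itv Qx Qy.
Qed.

Lemma riesz_dist_series x y : Q x -> Q y ->
  riesz_dist p (enorm (x - y)) = (\sum_(j <oo) (riesz_term j x y)%:E)%E.
Proof.
move=> Qx Qy; set B := (2 * L ^+ 2) `^ a * ((q x)^-1 `^ a * (q y)^-1 `^ a).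
have B0 : 0 < B by rewrite !mulr_gt0 ?powR_gt0 ?invr_gt0 ?mulr_gt0.
have termE j : riesz_term j x y = B * (binom_coef a j * stereo_dot x y ^+ j).
  by rewrite /riesz_term /G !indicE !mem_set// !mulr1 /B; ring.
have /andP[w0 w1] := stereo_dot_itv Qx Qy.
under eq_eseriesr do rewrite termE EFinM.
rewrite nneseriesZl; last first.
  by move=> j _; rewrite lee_fin mulr_ge0 ?exprn_ge0 ?binom_coef_ge0 ?(ltW a0).
have wE := stereo_dotE x y.
rewrite /riesz_dist p0/= enorm_eq0 subr_eq0; case: eqVneq => [xy|xy].
  have -> : stereo_dot x y = 1.
    move: wE; rewrite xy subrr enorm0 expr0n/= mulr0 mul0r => /eqP.
    by rewrite subr_eq0 eq_sym => /eqP.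
  under eq_eseriesr do rewrite expr1n mulr1.
  by rewrite binom_series1// gt0_muley// lte_fin.
have d0 : 0 < enorm (x - y) by rewrite enorm_gt0 subr_eq0.
set v := 1 - stereo_dot x y in wE.
have v0 : 0 < v by rewrite wE !divr_gt0 ?mulr_gt0 ?exprn_gt0.
have v1 : v <= 1 by rewrite /v gerBl.
have -> : stereo_dot x y = 1 - expR (- (- ln v)).
  by rewrite opprK lnK ?posrE// /v; ring.
rewrite binom_series//; last by rewrite oppr_ge0 ln_le0.
rewrite -EFinM; congr EFin; rewrite mulrN -mulNr.
have -> : expR (- a * ln v) = v `^ (- a) by rewrite /powR gt_eqF.
have vE : v^-1 * (2 * L ^+ 2 * ((q x)^-1 * (q y)^-1)) = (enorm (x - y) ^+ 2)^-1.
  rewrite wE; field; rewrite !lt0r_neq0//.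
have VE (z : R) r : 0 <= z -> z^-1 `^ r = z `^ (- r).
  by move=> z0; rewrite -powR_inv1// -powRrM mulN1r.
have -> : enorm (x - y) `^ (- p) = (enorm (x - y) ^+ 2)^-1 `^ a.
  by rewrite VE ?sqr_ge0// -powR_mulrn ?enorm_ge0// -powRrM mulrN /a mulrC divfK.
rewrite -vE -(VE v) ?(ltW v0)// /B [RHS]mulrC.
have qV0 z : 0 <= (q z)^-1 by rewrite invr_ge0 (ltW (q_gt0 z)).
have L2 : 0 <= 2 * L ^+ 2 by rewrite mulr_ge0 ?(ltW L20).
have v0' : 0 <= v^-1 by rewrite invr_ge0 (ltW v0).
have qq0 := mulr_ge0 (qV0 x) (qV0 y).
by rewrite (powRM _ v0' (mulr_ge0 L2 qq0)) (powRM _ L2 qq0) (powRM _ (qV0 x) (qV0 y)).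
Qed.

Lemma riesz_mutual_series mu nu :
  riesz_mutual Q p mu nu = series_energy riesz_term mu nu.
Proof.
rewrite /riesz_mutual integral_mkcond; apply: eq_integral => -[x y] _.
rewrite /patch; case: ifPn => [|/negP nQ].
  by rewrite inE => -[/= Qx Qy]; exact: riesz_dist_series.
rewrite eseries0// => j _ _; rewrite /riesz_term /G !indicE.
case: (boolP (x \in _)) => [/[!inE] Qx|_]; last by rewrite mulr0 !mul0r mulr0.
case: (boolP (y \in _)) => [/[!inE] Qy|_]; last by rewrite !mulr0 mul0r mulr0.
by case: nQ; rewrite inE.
Qed.

(** Cauchy-Schwarz for the positive definite Riesz kernel, in a form that makes
    sense for infinite energies. *)
Lemma riesz_mutual_le mu nu (b c : R) : 0 <= b -> 0 <= c ->
  ((2 * b * c)%:E * riesz_mutual Q p mu nu <=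
   (b ^+ 2)%:E * riesz_mutual Q p mu mu + (c ^+ 2)%:E * riesz_mutual Q p nu nu)%E.
Proof. by move=> b0 c0; rewrite !riesz_mutual_series; exact: series_energy_le. Qed.

End RieszPositive.

(** * Energies of uniform measures *)

Section UniformEnergy.
Context {R : realType} {n : nat}.
Local Notation V := 'rV[R]_n.+1.
Local Notation T := (borel_rV R n.+1).
Implicit Types (A K : set V) (p D c : R) (mu m : probability T R).
Local Notation lambda := (@leb R n).
Local Notation N := n.+1.
Local Notation omega := (@ball_volume R n).

Definition uniform_on A c m := forall B : set T, measurable B ->
  m B = (lambda (B `&` (A : set T)) * (c^-1)%:E)%E.

Lemma uniform_exists A c : measurable (A : set T) -> 0 < c ->
  lambda (A : set T) = c%:E -> exists m, uniform_on A c m.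
Proof.
move=> mA c0 Ac.
exists (mnormalize (mrestr lambda mA) (@dirac _ T 0 R)) => B mB.
transitivity (mrestr lambda mA B * (c^-1)%:E)%E => //.
apply: mnormalizeE => //.
exact: etrans (congr1 lambda (setTI (A : set T))) Ac.
Qed.

Lemma uniform_onT A c m : measurable (A : set T) -> 0 < c ->
  lambda (A : set T) = c%:E -> uniform_on A c m -> prob_on A m.
Proof.
move=> mA c0 Ac mU; have := mU A mA.
by rewrite setIid Ac -EFinM mulfV ?gt_eqF.
Qed.

Let mdist p := measurable_fun_dist (n := N) (measurable_riesz_dist p).

(** The potential of mu restricted to A. *)
Lemma measurable_potential p A mu : measurable (A : set T) ->
  measurable_fun [set: T]
    (fun x : T => (\int[mu]_(y in (A : set T)) riesz_dist p (enorm ((x : V) - y)))%E).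
Proof.
move=> mA; pose f (z : T * T) := (riesz_dist p (enorm ((z.1 : V) - z.2))).
rewrite (_ : (fun _ => _) = fubini_F mu (f \_ ([set: T] `*` (A : set T)))).
  apply: measurable_fun_fubini_tonelli_F.
    apply/(measurable_restrictT _ _).1 => //; first exact: measurableX.
    exact: measurable_funTS (mdist p).
  by move=> z; rewrite /patch; case: ifP => // _; exact: riesz_dist_ge0.
apply/funext => x; rewrite integral_mkcond; apply: eq_integral => y _.
by rewrite /patch in_setX in_setT.
Qed.

Lemma riesz_mutualE A p mu m : measurable (A : set T) -> riesz_mutual A p mu m =
  (\int[mu]_(x in (A : set T)) \int[m]_(y in (A : set T)) riesz_dist p (enorm ((x : V) - y)))%E.
Proof.
move=> mA; exact: (integral_setX mu m mA mA (mdist p) (fun x y _ _ => riesz_dist_ge0 _ _)).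
Qed.

(** At each point the radial integral bounds the potential of m, since m has
    density at most 1 / c. *)
Lemma uniform_energy_le A c D p m : measurable (A : set T) -> 0 < c ->
  lambda (A : set T) = c%:E -> uniform_on A c m -> 0 < D ->
  (forall x y, A x -> A y -> enorm (x - y) <= D) -> 0 < p -> p < N%:R ->
  (riesz_mutual A p m m <=
   (N%:R * omega * D `^ (N%:R - p) / ((N%:R - p) * c))%:E)%E.
Proof.
move=> mA c0 Ac mU D0 AD p0 pN; rewrite riesz_mutualE//.
set b := (N%:R * (omega * c^-1) * D `^ (N%:R - p) / (N%:R - p)).
have -> : N%:R * omega * D `^ (N%:R - p) / ((N%:R - p) * c) = b.
  by rewrite /b invfM; ring.
rewrite -(@integral_cst1 _ _ _ m (A : set T) mA (uniform_onT mA c0 Ac mU) b).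
apply: ge0_le_integral => //.
- by move=> x _; apply: integral_ge0 => y _; exact: riesz_dist_ge0.
- exact: measurable_funTS (measurable_potential _ _ _).
- move=> x Ax; apply: radial_integral_le => //.
  + exact: measurable_dist_to.
  + by move=> y Ay; rewrite enorm_ge0 AD.
  + by rewrite mulr_ge0 ?invr_ge0 ?(ltW c0) ?(ltW ball_volume_gt0).
  + move=> r /andP[r0 _]; have mAr : measurable ((A : set T) `&` eball x r).
      by apply: measurableI => //; exact: (measurable_eball x r).
    rewrite [X in (X <= _)%E](mU _ mAr) mulrAC EFinM -(leb_eball x r0); apply: lee_wpmul2r.
      by rewrite lee_fin invr_ge0 ltW.
    apply: le_measure; rewrite ?inE.
    * exact: measurableI.
    * exact: measurable_eball.
    * by move=> y [[_ ?] _].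
Qed.

(** Around each point of K the measure m has density 1 / c up to distance D, so
    its potential is at least the radial integral up to D. *)
Lemma uniform_mutual_ge A K c D p mu m : measurable (A : set T) ->
  measurable (K : set T) -> 0 < c ->
  lambda (A : set T) = c%:E -> uniform_on A c m -> prob_on K mu -> 0 < D ->
  K `<=` A -> (forall x y, K x -> enorm (x - y) <= D -> A y) -> 0 < p -> p < N%:R ->
  ((N%:R * omega * D `^ (N%:R - p) / ((N%:R - p) * c))%:E <= riesz_mutual A p mu m)%E.
Proof.
move=> mA mK c0 Ac mU muK D0 KA KAD p0 pN; rewrite riesz_mutualE//.
set b := (N%:R * (omega * c^-1) * D `^ (N%:R - p) / (N%:R - p)).
have -> : N%:R * omega * D `^ (N%:R - p) / ((N%:R - p) * c) = b.
  by rewrite /b invfM; ring.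
rewrite -(@integral_cst1 _ _ _ mu (K : set T) mK muK b).
have I0 x : (0 <= \int[m]_(y in (A : set T)) riesz_dist p (enorm ((x : V) - y)))%E.
  by apply: integral_ge0 => y _; exact: riesz_dist_ge0.
have mI := measurable_potential p m mA.
apply: (@le_trans _ _ (\int[mu]_(x in (K : set T))
    \int[m]_(y in (A : set T)) riesz_dist p (enorm ((x : V) - y)))%E); last first.
  by apply: ge0_subset_integral => //; exact: measurable_funTS.
have b0 : 0 <= b.
  by rewrite divr_ge0 ?mulr_ge0 ?powR_ge0 ?invr_ge0 ?(ltW c0) ?(ltW ball_volume_gt0)// subr_ge0 ltW.
apply: ge0_le_integral => //.
- exact: measurable_funTS.
- move=> x Kx; have EA : eball x D `<=` (A : set T) by move=> y; exact: KAD.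
  have mE := measurable_eball x D.
  apply: (@le_trans _ _ (\int[m]_(y in eball x D) riesz_dist p (enorm ((x : V) - y)))%E);
      last first.
    apply: ge0_subset_integral => //.
      apply: measurable_funTS.
      exact: (measurableT_comp (measurable_riesz_dist p) (measurable_dist_to x)).
    by move=> y _; exact: riesz_dist_ge0.
  apply: radial_integral_ge => //.
  + exact: measurable_dist_to.
  + by move=> y Ey; rewrite enorm_ge0.
  + by rewrite mulr_ge0 ?invr_ge0 ?(ltW c0) ?(ltW ball_volume_gt0).
  + move=> r /andP[r0 rD]; have mEr : measurable (eball x D `&` eball x r).
      by apply: measurableI => //; exact: (measurable_eball x r).
    rewrite [X in (_ <= X)%E](mU _ mEr) mulrAC EFinM -(leb_eball x r0); apply: lee_wpmul2r.
      by rewrite lee_fin invr_ge0 ltW.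
    apply: le_measure; rewrite ?inE.
    * exact: measurable_eball.
    * exact: measurableI.
    * move=> y yr; have yD : eball x D y by exact: le_trans rD.
      by split; [split | exact: EA].
Qed.

End UniformEnergy.

Section Thickening.
Context {R : realType} {n : nat}.
Local Notation V := 'rV[R]_n.+1.
Local Notation T := (borel_rV R n.+1).
Local Notation lambda := (@leb R n).
Local Notation N := n.+1.
Local Notation omega := (@ball_volume R n).
Variable (K : set V).
Hypotheses (cK : compact K) (K0 : K !=set0).
Implicit Types (e p : R) (mu m : probability T R).

Let mK : measurable (K : set T). Proof. exact: compact_borel. Qed.

(** A neighbourhood in the sup norm: it is open by construction, and contains
    the closed Euclidean balls of smaller radius around the points of K. *)
Definition thickening e : set V := \bigcup_(x in K) ball x e.

Lemma measurable_thickening e : measurable (thickening e : set T).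
Proof. by apply: borel_open; apply: bigcup_open => x _; exact: ball_open. Qed.

Lemma sub_thickening e : 0 < e -> K `<=` thickening e.
Proof. by move=> e0 x Kx; exists x => //; exact: ballxx. Qed.

Lemma thickening_bounded e : 0 < e -> exists2 D, 0 < D &
  (forall x, thickening e x -> forall i, `|x 0 i| <= D) /\
  (forall x y, thickening e x -> thickening e y -> enorm (x - y) <= D).
Proof.
move=> e0; have /compact_bounded[M [_ KM]] := cK.
have M1 x : K x -> `|x| <= `|M| + 1.
  by move: x; apply: KM; rewrite (le_lt_trans (ler_norm M))// ltrDl.
set B := `|M| + 1 + e; have B0 : 0 < B by rewrite /B ltr_wpDl.
have eB x : thickening e x -> forall i, `|x 0 i| <= B.
  move=> [z Kz]; rewrite -ball_normE /= => /ltW zx i.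
  rewrite -(subKr z x) !mxE (le_trans (ler_normB _ _))// lerD//.
    exact: le_trans (coord_le_norm _ _) (M1 _ Kz).
  have := coord_le_norm (z - x) i; rewrite !mxE => /le_trans; exact.
have N1 : 1 <= N%:R :> R by rewrite ler1n.
exists (N%:R * (B + B)); first by rewrite mulr_gt0 ?ltr0n// addr_gt0.
split=> [x /eB xB i|x y /eB xB /eB yB].
  rewrite (le_trans (xB i))// (@le_trans _ _ (B + B)) ?lerDl ?(ltW B0)//.
  exact: ler_peMl (addr_ge0 (ltW B0) (ltW B0)) N1.
apply: enorm_le_coord; first by rewrite addr_ge0 ?(ltW B0).
by move=> i; rewrite !mxE (le_trans (ler_normB _ _))// lerD.
Qed.

Lemma thickening_mass e : 0 < e ->
  exists2 c, 0 < c & lambda (thickening e : set T) = c%:E.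
Proof.
move=> e0; have [D _ [eD _]] := thickening_bounded e0.
have lt_oo : (lambda (thickening e : set T) < +oo)%E by exact: leb_bounded_lty eD.
have [x Kx] := K0; have e2 : 0 < e / 2 by rewrite divr_gt0.
exists (fine (lambda (thickening e : set T))); last first.
  by rewrite fineK// ge0_fin_numE.
apply: fine_gt0; rewrite lt_oo andbT.
apply: (@lt_le_trans _ _ (lambda (eball x (e / 2)))).
  by rewrite leb_eball// lte_fin mulr_gt0 ?ball_volume_gt0 ?exprn_gt0.
apply: le_measure; rewrite ?inE.
- exact: measurable_eball.
- exact: measurable_thickening.
- move=> y xy; exists x => //; rewrite -ball_normE /=.
  by rewrite (le_lt_trans (norm_le_enorm _))// (le_lt_trans xy)//; lra.
Qed.

Lemma bigcap_thickening : \bigcap_k thickening k.+1%:R^-1 = K.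
Proof.
apply/seteqP; split => [y yK|y Ky k _]; last first.
  by apply: sub_thickening => //; rewrite invr_gt0 ltr0n.
have /closure_id -> := compact_closed (@norm_hausdorff _ _) cK.
move=> U /nbhs_ballP[e /= e0 yeU].
have [k _ /(_ k (leqnn k)) ke] := near_infty_natSinv_lt (PosNum e0).
have [x Kx xy] := yK k I; exists x; split => //; apply: yeU.
apply: ball_sym; apply: le_ball xy; apply: ltW; exact: ke.
Qed.

Lemma cvg_thickening_mass : (lambda (thickening k.+1%:R^-1 : set T) @[k --> \oo] -->
  lambda (K : set T))%E.
Proof.
rewrite -[in X in _ --> X]bigcap_thickening.
apply: (@nonincreasing_cvg_mu _ _ _ lambda (fun k => thickening k.+1%:R^-1 : set T)).
- have [|D _ [eD _]] := @thickening_bounded 1%:R^-1; first by rewrite invr1.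
  exact: leb_bounded_lty eD.
- by move=> k; exact: measurable_thickening.
- by apply: bigcap_measurable => // k _; exact: measurable_thickening.
- move=> k l kl; apply/subsetPset => y [x Kx xy]; exists x => //.
  apply: le_ball xy; rewrite lef_pV2 ?posrE ?ltr0n//.
  by rewrite ler_nat.
Qed.

(** A probability on K does not charge the rest of A. *)
Lemma riesz_mutual_mean A p mu : measurable (A : set T) -> K `<=` A ->
  prob_on K mu -> riesz_mutual A p mu mu = mean_dist (riesz_dist p) K mu.
Proof.
move=> mA KA muK; rewrite /riesz_mutual /mean_dist.
have mAA : measurable (A `*` A : set (T * T)) by exact: measurableX.
have mKK : measurable (K `*` K : set (T * T)) by exact: measurableX.
have mf := measurable_fun_dist (n := N) (measurable_riesz_dist p).
have mD : measurable ((A `*` A) `\` (K `*` K) : set (T * T)) by exact: measurableD.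
have AE : A `*` A = (K `*` K) `|` ((A `*` A) `\` (K `*` K)).
  apply/esym/setDUK => -[x y] [/= Kx Ky]; split; exact: KA.
rewrite AE ge0_integral_setU//=; last 3 first.
- exact: measurable_funTS mf.
- by move=> z _; exact: riesz_dist_ge0.
- by apply/disj_setPS => z [? []].
rewrite [X in (_ + X)%E](_ : _ = 0%E) ?adde0//.
apply: null_set_integral => //; first exact: measurable_funTS mf.
apply: (@subset_measure0 _ _ _ (mu \x mu)%E _ (~` (K `*` K))) => //.
- exact: measurableC.
- by rewrite [LHS](probability_setC (mu \x mu)%E mKK) [X in (_ - X)%E](prod_prob_on mK muK) subee.
Qed.

(** Cauchy-Schwarz against the uniform measure m on the thickening. With
    f <= E(mu, m) and E(m, m) <= g, the inequality
    2 b c E(mu, m) <= b^2 E(mu, mu) + c^2 E(m, m) is used at b = g, c = f and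
    yields f^2 / g <= E(mu, mu). The ball radius e / 2 keeps the closed balls
    around points of K inside the thickening. *)
Lemma mean_riesz_lower e : 0 < e -> exists2 D, 0 < D & forall c p mu,
  lambda (thickening e : set T) = c%:E -> 0 < p -> p < N%:R -> prob_on K mu ->
  ((N%:R * omega * ((e / 2) `^ (N%:R - p)) ^+ 2 /
    ((N%:R - p) * c * D `^ (N%:R - p)))%:E <= mean_dist (riesz_dist p) K mu)%E.
Proof.
move=> e0; have [D D0 [_ eD]] := thickening_bounded e0.
exists D => // c p mu ec p0 pN muK.
have mA := measurable_thickening e; set A := thickening e in mA ec eD *.
have c0 : 0 < c by have [c' c'0] := thickening_mass e0; rewrite -/A ec => -[->].
have KA : K `<=` A by exact: sub_thickening.
have s0 : 0 < N%:R - p by rewrite subr_gt0.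
have [m mU] := uniform_exists mA c0 ec.
have e2 : 0 < e / 2 by rewrite divr_gt0.
have ub := uniform_energy_le mA c0 ec mU D0 eD p0 pN.
have lb : ((N%:R * omega * (e / 2) `^ (N%:R - p) / ((N%:R - p) * c))%:E <=
    riesz_mutual A p mu m)%E.
  apply: (uniform_mutual_ge mA mK c0 ec mU muK) => // x y Kx xy; exists x => //.
  rewrite -ball_normE /= (le_lt_trans (norm_le_enorm _))// (le_lt_trans xy)//; lra.
have L0 : 0 < 2 * D by rewrite mulr_gt0.
have DL x y : A x -> A y -> 2 * enorm (x - y) ^+ 2 <= (2 * D) ^+ 2.
  by move=> Ax Ay; have := eD _ _ Ax Ay; have := enorm_ge0 (x - y); nra.
rewrite -(riesz_mutual_mean p mA KA muK).
set f := N%:R * omega * (e / 2) `^ (N%:R - p) / ((N%:R - p) * c) in lb.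
set g := N%:R * omega * D `^ (N%:R - p) / ((N%:R - p) * c) in ub.
have w0 : 0 < N%:R * omega by rewrite mulr_gt0 ?ball_volume_gt0.
have f0 : 0 < f by rewrite divr_gt0 ?(mulr_gt0 w0) ?(mulr_gt0 s0) ?powR_gt0.
have g0 : 0 < g by rewrite divr_gt0 ?(mulr_gt0 w0) ?(mulr_gt0 s0) ?powR_gt0.
have -> : N%:R * omega * ((e / 2) `^ (N%:R - p)) ^+ 2 /
    ((N%:R - p) * c * D `^ (N%:R - p)) = f ^+ 2 / g.
  have DR : D `^ (N%:R - p) != 0 by rewrite gt_eqF ?powR_gt0.
  rewrite /f /g; move: (_ `^ _) DR => u; move: (_ `^ _) => v u0.
  move: (N%:R - p) s0 => s /lt0r_neq0 s0.
  move: (N%:R * omega) w0 => w /lt0r_neq0 w0.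
  by field; rewrite u0 s0 w0 (lt0r_neq0 c0).
have := riesz_mutual_le mA L0 p0 DL mu m (ltW g0) (ltW f0).
have E0 : (0 <= riesz_mutual A p mu mu)%E.
  by apply: integral_ge0 => z _; exact: riesz_dist_ge0.
case: (riesz_mutual A p mu mu) E0 => [v _| |]//; last by move=> *; rewrite leey.
have fl : ((2 * g * f * f)%:E <= (2 * g * f)%:E * riesz_mutual A p mu m)%E.
  rewrite EFinM; apply: lee_wpmul2l => //.
  by rewrite lee_fin (mulr_ge0 (mulr_ge0 _ (ltW g0)) (ltW f0)).
have gu : ((f ^+ 2)%:E * riesz_mutual A p m m <= (f ^+ 2 * g)%:E)%E.
  rewrite [X in (_ <= X)%E]EFinM; apply: lee_wpmul2l => //.
  by rewrite lee_fin sqr_ge0.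
move=> /(le_trans fl) H; have := le_trans H (leeD2l _ gu).
rewrite -EFinM -EFinD !lee_fin ler_pdivrMr// => H'.
rewrite -(ler_pM2l g0); nra.
Qed.


End Thickening.

(** * The limit at the dimension *)

Section PowerLimits.
Context {R : realType} {S : Type} (F : set_system S) {FF : Filter F}.

Lemma cvg_powR (f g : S -> R) (a b : R) : 0 < a ->
  f x @[x --> F] --> a -> g x @[x --> F] --> b ->
  f x `^ g x @[x --> F] --> a `^ b.
Proof.
move=> a0 fa gb; have -> : a `^ b = expR (b * ln a) by rewrite /powR gt_eqF.
apply: (@cvg_trans _ ((fun x => expR (g x * ln (f x))) @ F)).
  apply: near_eq_cvg; near=> x.
  rewrite /powR gt_eqF//; near: x; exact: cvgr_gt a0.
apply: continuous_cvg; first exact: continuous_expR.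
apply: cvgM => //; apply: cvg_comp fa _; exact: continuous_ln.
Unshelve. all: by end_near. Qed.

End PowerLimits.

Section CapacityRatio.
Context {R : realType} {n : nat}.
Local Notation V := 'rV[R]_n.+1.
Local Notation T := (borel_rV R n.+1).
Local Notation lambda := (@leb R n).
Local Notation N := n.+1.
Local Notation omega := (@ball_volume R n).
Variable (K : set V).
Hypotheses (cK : compact K) (K0 : K !=set0).
Implicit Types (e p lo hi : R) (mu m : probability T R).

Let mK : measurable (K : set T). Proof. exact: compact_borel. Qed.

Lemma powRV_ratio p v s : 0 < p -> 0 < v -> 0 < s ->
  v `^ (- p^-1) / s `^ p^-1 = ((v * s)^-1) `^ p^-1.
Proof.
move=> p0 v0 s0; rewrite powRN -invfM -powRM ?(ltW v0) ?(ltW s0)//.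
have vs0 : 0 <= v * s by rewrite mulr_ge0 ?(ltW v0) ?(ltW s0).
by rewrite -powRN -(powR_inv1 vs0) -powRrM mulN1r.
Qed.

Lemma riesz_ratio_le p lo s : 0 < p -> 0 < lo -> 0 < s ->
  (lo%:E <= riesz_energy p K)%E ->
  riesz_capacity p K / s `^ p^-1 <= ((lo * s)^-1) `^ p^-1.
Proof.
move=> p0 lo0 s0; rewrite /riesz_capacity gt_eqF//.
case: (riesz_energy p K) => [v|_|]//; last by rewrite mul0r powR_ge0.
rewrite lee_fin => lov; have v0 : 0 < v by apply: lt_le_trans lov.
rewrite powRV_ratio//; apply: ge0_ler_powR; rewrite ?nnegrE ?invr_ge0 ?mulr_ge0//;
  rewrite ?(ltW p0) ?(ltW v0) ?(ltW lo0) ?(ltW s0)//.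
by rewrite lef_pV2 ?posrE ?mulr_gt0// ler_pM2r.
Qed.

(** The positive lower bound lo excludes the value 0 of the energy, where the
    power is 0 by convention instead of infinite. *)
Lemma riesz_ratio_ge p lo hi s : 0 < p -> 0 < lo -> 0 < s ->
  (lo%:E <= riesz_energy p K)%E -> (riesz_energy p K <= hi%:E)%E ->
  ((hi * s)^-1) `^ p^-1 <= riesz_capacity p K / s `^ p^-1.
Proof.
move=> p0 lo0 s0; rewrite /riesz_capacity gt_eqF//.
case: (riesz_energy p K) => [v| |]//.
rewrite !lee_fin => lov vhi; have v0 : 0 < v by apply: lt_le_trans lov.
have hi0 : 0 < hi by apply: lt_le_trans vhi.
rewrite powRV_ratio//; apply: ge0_ler_powR; rewrite ?nnegrE ?invr_ge0 ?mulr_ge0//;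
  rewrite ?(ltW p0) ?(ltW v0) ?(ltW hi0) ?(ltW s0)//.
by rewrite lef_pV2 ?posrE ?mulr_gt0// ler_pM2r.
Qed.

Lemma riesz_energy_lower e c : 0 < e ->
  lambda (thickening K e : set T) = c%:E -> exists2 D, 0 < D & forall p,
  0 < p -> p < N%:R ->
  ((N%:R * omega * ((e / 2) `^ (N%:R - p)) ^+ 2 /
    ((N%:R - p) * c * D `^ (N%:R - p)))%:E <= riesz_energy p K)%E.
Proof.
move=> e0 ec; have [D D0 lb] := mean_riesz_lower cK K0 e0; exists D => // p p0 pN.
rewrite (riesz_energyP mK p0); apply: le_ereal_inf_tmp => _ [mu muK <-].
exact: lb.
Qed.

Lemma riesz_energy_upper c : 0 < c -> lambda (K : set T) = c%:E ->
  exists2 D, 0 < D & forall p, 0 < p -> p < N%:R ->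
  (riesz_energy p K <= (N%:R * omega * D `^ (N%:R - p) / ((N%:R - p) * c))%:E)%E.
Proof.
move=> c0 Kc; have [D D0 KD] := compact_dist_bounded cK.
have [m mU] := uniform_exists mK c0 Kc.
exists D => // p p0 pN; rewrite (riesz_energyP mK p0).
apply: le_trans (uniform_energy_le mK c0 Kc mU D0 KD p0 pN).
by apply: ereal_inf_lbound; exists m => //; exact: uniform_onT Kc mU.
Qed.

Let ratio p := riesz_capacity p K / (N%:R - p) `^ p^-1.

Let near_itv : \forall p \near (N%:R : R)^'-, 0 < p < N%:R.
Proof.
near=> p; apply/andP; split; near: p; last exact: nbhs_left_lt.
by apply: nbhs_left_gt; rewrite ltr0n.
Unshelve. all: by end_near. Qed.

Let cvg_gap : (N%:R : R) - p @[p --> (N%:R : R)^'-] --> (0 : R).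
Proof.
rewrite -[X in _ --> X](subrr (N%:R : R)).
by apply: cvgB; [exact: cvg_cst | apply: cvg_at_left_filter; exact: cvg_id].
Qed.

Let cvg_expo : p^-1 @[p --> (N%:R : R)^'-] --> (N%:R^-1 : R).
Proof. by apply: cvgV; [rewrite pnatr_eq0 | apply: cvg_at_left_filter; exact: cvg_id]. Qed.

Let cvg_pow_gap (D : R) : 0 < D -> D `^ (N%:R - p) @[p --> (N%:R : R)^'-] --> (1 : R).
Proof.
by move=> D0; rewrite -[X in _ --> X](powRr0 D); apply: cvg_powR => //; exact: cvg_cst.
Qed.

(** The lower bound of the energy times N - p tends to N omega / c. *)
Lemma riesz_ratio_limsup e c (z : R) : 0 < e ->
  lambda (thickening K e : set T) = c%:E -> (c / (N%:R * omega)) `^ N%:R^-1 < z ->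
  \forall p \near (N%:R : R)^'-, ratio p < z.
Proof.
move=> e0 ec zl; have [D D0 lb] := riesz_energy_lower e0 ec.
have c0 : 0 < c by have [c' c'0] := thickening_mass cK K0 e0; rewrite ec => -[->].
have w0 : 0 < N%:R * omega by rewrite mulr_gt0 ?ball_volume_gt0.
have e2 : 0 < e / 2 by rewrite divr_gt0.
pose h p := c / (N%:R * omega) * (D `^ (N%:R - p) / ((e / 2) `^ (N%:R - p)) ^+ 2).
have hc : h p `^ p^-1 @[p --> (N%:R : R)^'-] --> (c / (N%:R * omega)) `^ N%:R^-1.
  apply: cvg_powR => //; first by rewrite divr_gt0.
  rewrite -[X in _ --> X]mulr1; apply: cvgM; first exact: cvg_cst.
  rewrite -[X in _ --> X]divr1 -[X in _ / X](expr1n _ 2).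
  apply: cvgM; first exact: cvg_pow_gap.
  apply: cvgV; first by rewrite expr1n oner_eq0.
  rewrite !expr2; under eq_fun do rewrite expr2.
  by apply: cvgM; exact: cvg_pow_gap.
near=> p.
have /andP[p0 pN] : 0 < p < N%:R by near: p.
have s0 : 0 < N%:R - p by rewrite subr_gt0.
have D1 : 0 < D `^ (N%:R - p) by rewrite powR_gt0.
have e1 : 0 < (e / 2) `^ (N%:R - p) by rewrite powR_gt0.
have lo0 : 0 < N%:R * omega * ((e / 2) `^ (N%:R - p)) ^+ 2 /
    ((N%:R - p) * c * D `^ (N%:R - p)).
  by rewrite divr_gt0 ?(mulr_gt0 w0) ?exprn_gt0 ?(mulr_gt0 _ D1) ?(mulr_gt0 s0).
apply: le_lt_trans (riesz_ratio_le p0 lo0 s0 (lb p p0 pN)) _.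
rewrite [X in X `^ _](_ : _ = h p).
  by near: p; exact: cvgr_lt hc _ zl.
rewrite /h; move: (D `^ _) D1 => u /lt0r_neq0 u0; move: (_ `^ _) e1 => v /lt0r_neq0 v0.
move: (N%:R - p) s0 => s /lt0r_neq0 s0.
move: (N%:R * omega) w0 => w /lt0r_neq0 w0'.
by field; rewrite u0 s0 w0' v0 (lt0r_neq0 c0).
Unshelve. all: by end_near. Qed.

Lemma riesz_ratio_liminf c (z : R) : 0 < c -> lambda (K : set T) = c%:E ->
  z < (c / (N%:R * omega)) `^ N%:R^-1 ->
  \forall p \near (N%:R : R)^'-, z < ratio p.
Proof.
move=> c0 Kc zl; have [D D0 ub] := riesz_energy_upper c0 Kc.
have w0 : 0 < N%:R * omega by rewrite mulr_gt0 ?ball_volume_gt0.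
have e0 : 0 < 1 :> R by [].
have [ce ce0 ec] := thickening_mass cK K0 e0.
have [D' D'0 lb] := riesz_energy_lower e0 ec.
pose h p := c / (N%:R * omega) * (D `^ (N%:R - p))^-1.
have hc : h p `^ p^-1 @[p --> (N%:R : R)^'-] --> (c / (N%:R * omega)) `^ N%:R^-1.
  apply: cvg_powR => //; first by rewrite divr_gt0.
  rewrite -[X in _ --> X]divr1; apply: cvgM; first exact: cvg_cst.
  by apply: cvgV; [rewrite oner_eq0 | exact: cvg_pow_gap].
near=> p.
have /andP[p0 pN] : 0 < p < N%:R by near: p.
have s0 : 0 < N%:R - p by rewrite subr_gt0.
have D1 : 0 < D `^ (N%:R - p) by rewrite powR_gt0.
have D1' : 0 < D' `^ (N%:R - p) by rewrite powR_gt0.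
have e1 : 0 < (1 / 2 : R) `^ (N%:R - p) by rewrite powR_gt0 ?divr_gt0.
have lo0 : 0 < N%:R * omega * ((1 / 2) `^ (N%:R - p)) ^+ 2 /
    ((N%:R - p) * ce * D' `^ (N%:R - p)).
  by rewrite divr_gt0 ?(mulr_gt0 w0) ?exprn_gt0 ?(mulr_gt0 _ D1') ?(mulr_gt0 s0).
apply: lt_le_trans (riesz_ratio_ge p0 lo0 s0 (lb p p0 pN) (ub p p0 pN)).
rewrite [X in X `^ _](_ : _ = h p).
  by near: p; exact: cvgr_gt hc _ zl.
rewrite /h; move: (D `^ _) D1 => u /lt0r_neq0 u0.
move: (N%:R - p) s0 => s /lt0r_neq0 s0.
move: (N%:R * omega) w0 => w /lt0r_neq0 w0'.
by field; rewrite u0 s0 w0' (lt0r_neq0 c0).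
Unshelve. all: by end_near. Qed.

(** For the upper limit a thickening of mass close to that of K is chosen first;
    the lower limit is trivial when K is a null set. *)
Lemma cvg_riesz_ratio : ratio p @[p --> (N%:R : R)^'-] -->
  (fine (lambda (K : set T)) / (N%:R * omega)) `^ N%:R^-1.
Proof.
have w0 : 0 < N%:R * omega by rewrite mulr_gt0 ?ball_volume_gt0.
have N0 : 0 < (N%:R^-1 : R) by rewrite invr_gt0 ltr0n.
have lK : (lambda (K : set T) < +oo)%E.
  have [D _ [eD _]] := thickening_bounded cK (ltr01 : (0 : R) < 1).
  by apply: (@leb_bounded_lty _ _ _ D) => x Kx; apply: eD; exact: sub_thickening.
have cE : lambda (K : set T) = (fine (lambda (K : set T)))%:E.
  by rewrite fineK// ge0_fin_numE.
set c := fine _ in cE *; set l := (c / _) `^ _.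
have c0 : 0 <= c by exact: fine_ge0.
have l0 : 0 <= l by exact: powR_ge0.
apply/cvgrPdist_lt => z z0.
have up : \forall p \near (N%:R : R)^'-, ratio p < l + z.
  pose t := (l + z) `^ N%:R * (N%:R * omega).
  have lz : 0 < l + z by rewrite ltr_wpDl.
  have ct : c < t.
    have lN : l `^ N%:R = c / (N%:R * omega).
      by rewrite /l -powRrM mulVf ?pnatr_eq0// powRr1// divr_ge0// ltW.
    rewrite -ltr_pdivrMr// -lN; apply: gt0_ltr_powR; rewrite ?nnegrE ?ltr0n//.
      by rewrite ltW.
    by rewrite ltrDl.
  have ct' : (lambda (K : set T) < t%:E)%E by rewrite cE lte_fin.
  have nb : nbhs (lambda (K : set T)) [set y | (y < t%:E)%E].
    by apply: open_nbhs_nbhs; split => //; exact: open_ereal_lt_ereal.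
  have [k _ /(_ k (leqnn k)) /= lt_t] := cvg_thickening_mass cK nb.
  have k0 : 0 < (k.+1%:R^-1 : R) by rewrite invr_gt0 ltr0n.
  have [ck ck0 ckE] := thickening_mass cK K0 k0.
  apply: (riesz_ratio_limsup k0 ckE).
  move: lt_t; rewrite ckE lte_fin -ltr_pdivrMr// => lt_t.
  have -> : l + z = ((l + z) `^ N%:R) `^ N%:R^-1.
    by rewrite -powRrM mulfV ?pnatr_eq0// powRr1// ltW.
  by apply: gt0_ltr_powR; rewrite ?nnegrE ?powR_ge0 ?divr_ge0 ?(ltW ck0) ?(ltW w0).
have dn : \forall p \near (N%:R : R)^'-, l - z < ratio p.
  move: c0; rewrite le_eqVlt => /predU1P[c0|c0]; last first.
    by apply: (riesz_ratio_liminf c0 cE); rewrite ltrBlDr ltrDl.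
  apply: nearW => p; apply: (@lt_le_trans _ _ 0).
    by rewrite /l -c0 mul0r powR0 ?gt_eqF// sub0r oppr_lt0.
  by rewrite divr_ge0 ?powR_ge0 ?riesz_capacity_ge0.
near=> p; rewrite ltr_distlC; apply/andP; split; near: p => //.
Unshelve. all: by end_near. Qed.

(** Cap_N <= Cap_q for q < N, and Cap_q is a bounded ratio times
    (N - q)^(1/q). As (N - q)^(1/q) < t amounts to N - q < t^q, and t <= 1 gives
    t^N <= t^q, it is enough that N - q < t^N. *)
Lemma riesz_capacity_eq0 p : N%:R <= p -> riesz_capacity p K = 0.
Proof.
move=> Np; apply/eqP; rewrite eq_le riesz_capacity_ge0 andbT.
apply: le_trans (riesz_capacity_nincr cK K0 Np) _.
rewrite leNgt; apply/negP; set r := riesz_capacity _ _ => r0.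
set l := (fine (lambda (K : set T)) / (N%:R * omega)) `^ N%:R^-1.
have l1 : 0 < l + 1 by rewrite ltr_wpDl ?powR_ge0.
pose t := Num.min 1 (r / (l + 1)).
have t0 : 0 < t by rewrite lt_min ltr01 divr_gt0.
have t1 : t <= 1 by rewrite ge_min lexx.
suff : \forall p \near (N%:R : R)^'-, False by move=> /filter_ex[].
near=> q.
have /andP[q0 qN] : 0 < q < N%:R by near: q.
have s0 : 0 < N%:R - q by rewrite subr_gt0.
have st : N%:R - q < t `^ N%:R.
  by near: q; apply: cvgr_lt cvg_gap _ _; rewrite powR_gt0.
have rl : ratio q < l + 1.
  by near: q; apply: cvgr_lt cvg_riesz_ratio _ _; rewrite ltrDl.
have {}st : (N%:R - q) `^ q^-1 < t.
  have -> : t = (t `^ q) `^ q^-1 by rewrite -powRrM mulfV ?gt_eqF// powRr1// ltW.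
  apply: gt0_ltr_powR; rewrite ?invr_gt0 ?nnegrE ?powR_ge0 ?(ltW s0)//.
  apply: lt_le_trans st _; apply: ger_powR; first by rewrite t0.
  exact: ltW.
have := riesz_capacity_nincr cK K0 (ltW qN); rewrite -/r.
apply/negP; rewrite -ltNge.
have s1 : 0 < (N%:R - q) `^ q^-1 by rewrite powR_gt0.
rewrite ltr_pdivrMr// in rl.
apply: lt_le_trans rl _.
apply: (@le_trans _ _ ((l + 1) * t)); first by rewrite ler_pM2l// ltW.
by rewrite mulrC -ler_pdivlMr// ge_min lexx orbT.
Unshelve. all: by end_near. Qed.

End CapacityRatio.
Theorem theorem1p1 (R : realType) (n : nat) (n_ge1 : (1 <= n)%N)
    (K : set 'rV[R]_n) (cptK : compact K) (K_neq0 : K !=set0) :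
  [/\ (forall p q : R, p <= q -> riesz_capacity q K <= riesz_capacity p K),
      is_interval [set p : R | 0 < riesz_capacity p K] &
      (forall p q : R, 0 < riesz_capacity p K -> 0 < riesz_capacity q K ->
         p < q -> riesz_capacity q K < riesz_capacity p K)]
  /\
  [/\ (forall p : R, p < 0 ->
         2 `^ p^-1 * diam K <= riesz_capacity p K <= diam K),
      riesz_capacity p K @[p --> -oo] --> diam K &
      (n = 1%N -> forall p : R, p <= -1 ->
         riesz_capacity p K = 2 `^ p^-1 * diam K)]
  /\
  riesz_capacity p K / (n%:R - p) `^ p^-1 @[p --> (n%:R : R)^'-] -->
    (fine (lebesgue_rV K) / fine (surface_measure (usphere R n))) `^ n%:R^-1
  /\
  (forall p : R, n%:R <= p -> riesz_capacity p K = 0).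
Proof.
case: n n_ge1 K cptK K_neq0 => [//|n _ K cK K0].
split; [split|split; [split|split]].
- by move=> p q; exact: riesz_capacity_nincr.
- move=> p q /= _ q0 r /andP[_ rq]; apply: lt_le_trans q0 _.
  exact: riesz_capacity_nincr.
- by move=> p q _; exact: riesz_capacity_decr.
- move=> p p0; rewrite riesz_capacity_ge_diam//=.
  exact: riesz_capacity_le_diam.
- exact: cvg_riesz_capacity_diam.
- case=> n0; subst n; exact: riesz_capacity_line.
- rewrite surface_measure_usphere; exact: cvg_riesz_ratio.
- exact: riesz_capacity_eq0.
Qed.
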